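(* (1) Let $\Omega\subset\mathbb{C}^2$ be a $\mathbb{C}$-proper convex domain with Kobayashi distance $K_\Omega$. If $(\Omega,K_\Omega)$ is a CAT(0) space, then there exists $m\in\mathbb{N}$ such that $\Omega$ is locally $m$-convex. (2) Let $d\ge 2$ and let $\Omega\subset\mathbb{C}^d$ be a bounded convex domain with smooth ($C^\infty$) boundary and Kobayashi distance $K_\Omega$. If $(\Omega,K_\Omega)$ is a CAT(0) space, then $\partial\Omega$ has finite line type.
   Context: **$\mathbb{C}$-proper.** A convex domain $\Omega\subset\mathbb{C}^d$ (nonempty, open, convex) is $\mathbb{C}$-proper if it contains no entire complex affine line. **Kobayashi metric.** Let $\mathbb{D}$ be the unit disk in $\mathbb{C}$. For a domain $\Omega\subset\mathbb{C}^d$, $x\in\Omega$, $v\in\mathbb{C}^d$, set $$k_\Omega(x;v)=\inf\{|\xi| : f:\mathbb{D}\to\Omega \text{ holomorphic},\ f(0)=x,\ df_0(\xi)=v\}.$$ The Kobayashi (pseudo-)distance $K_\Omega(x,y)$ is the infimum of $L(\sigma)=\int_a^b k_\Omega(\sigma(t);\sigma'(t))\,dt$ over all absolutely continuous curves $\sigma:[a,b]\to\Omega$ with $\sigma(a)=x$, $\sigma(b)=y$. **CAT(0).** A metric space $(X,d)$ is geodesic if any two points are joined by a geodesic segment, i.e. a map $\sigma$ from an interval to $X$ with $d(\sigma(s),\sigma(t))=|s-t|$ for all $s,t$. A geodesic metric space $(X,d)$ is CAT(0) if for every geodesic triangle with vertices $a,b,c$ and sides $[a,b],[b,c],[c,a]$,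 and all $p\in[a,b]$, $q\in[a,c]$, one has $d(p,q)\le|\bar p-\bar q|$, where $\bar a,\bar b,\bar c\in\mathbb{R}^2$ are the vertices of a Euclidean triangle with the same side lengths and $\bar p\in[\bar a,\bar b]$, $\bar q\in[\bar a,\bar c]$ satisfy $|\bar a-\bar p|=d(a,p)$, $|\bar a-\bar q|=d(a,q)$. **Locally $m$-convex.** Let $\delta_\Omega(p)=\inf\{|p-x| : x\in\partial\Omega\}$ and, for $v\neq0$, $\delta_\Omega(p,v)=\inf\{|p-x| : x\in\partial\Omega\cap(p+\mathbb{C}v)\}$. A $\mathbb{C}$-proper convex domain $\Omega\subset\mathbb{C}^d$ is locally $m$-convex if for every $R>0$ there exists $C>0$ such that $\delta_\Omega(z,v)\le C\,\delta_\Omega(z)^{1/m}$ for all $z\in\Omega$ with $|z|<R$ and all non-zero $v\in\mathbb{C}^d$. **Finite line type.** Write $\Omega=\{z\in\mathbb{C}^d : r(z)<0\}$ with $r$ a $C^\infty$ defining function, $\nabla r\ne0$ near $\partial\Omega$. For $f:\mathbb{C}\to\mathbb{R}$ with $f(0)=0$, $\nu(f)\in\mathbb{N}\cup\{\infty\}$ denotes the order of vanishing of $f$ at $0$. A point $x\in\partial\Omega$ has finite line type if $$\sup\{\nu(r\circ\ell) : \ell:\mathbb{C}\to\mathbb{C}^d \text{ a non-constant complex affine map with } \ell(0)=x\}<\infty.$$ $\partial\Omega$ has finite line type if every point of $\partial\Omega$ has finite line type. *)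

(* Defs.v *)
From HB Require Import structures.
From mathcomp Require Import all_boot all_order all_algebra.
From mathcomp Require Import complex.
From mathcomp Require Import all_classical all_reals all_analysis.

Set Implicit Arguments.
Unset Strict Implicit.
Unset Printing Implicit Defensive.

Import Order.TTheory GRing.Theory Num.Theory.
Import numFieldNormedType.Exports.

Local Open Scope classical_set_scope.
Local Open Scope ring_scope.
Local Open Scope complex_scope.

(* The complex plane and C^d as normed modules over the field R[i] itself;
   differentiable and 'd are therefore complex-linear notions on them.  The
   library norm on row vectors is the sup norm: it gives the right topology,
   and the Euclidean norm is enorm below. *)
Notation Cplane R := (R[i]^o).
Notation Cvec R d := ('rV[R[i]^o]_d).

Definition cmod (R : realType) (z : R[i]) : R := complex.Re `|z|.

Definition enorm (R : realType) (d : nat) (z : Cvec R d) : R :=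
  Num.sqrt (\sum_(j < d) cmod (z 0 j) ^+ 2).

Definition boundary (T : topologicalType) (A : set T) : set T :=
  closure A `\` interior A.

(* In the order of R[i] the interval [0, 1] contains real numbers only, so
   convex_set over the scalars R[i] is real convexity. *)
Definition convex_domain (R : realType) (d : nat) (Om : set (Cvec R d)) : Prop :=
  [/\ Om !=set0, open Om & convex_set Om].

Definition C_proper (R : realType) (d : nat) (Om : set (Cvec R d)) : Prop :=
  ~ exists (p v : Cvec R d), v != 0 /\ forall zeta : R[i], Om (p + zeta *: v).

Definition bounded_domain (R : realType) (d : nat) (Om : set (Cvec R d)) : Prop :=
  exists M : R, forall z, Om z -> enorm z <= M.

Definition unit_disk (R : realType) : set (Cplane R) := [set z | cmod z < 1].
Arguments unit_disk : clear implicits.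

(* For x in an open Om the set of admissible xi is nonempty (affine disks), so
   this is a genuine infimum. *)
Definition kobayashi_metric (R : realType) (d : nat) (Om : set (Cvec R d))
    (x v : Cvec R d) : R :=
  inf [set s : R | exists (f : Cplane R -> Cvec R d) (xi : Cplane R),
    [/\ forall z, unit_disk R z -> differentiable f z,
        forall z, unit_disk R z -> Om (f z),
        f 0 = x,
        'd f (0 : Cplane R) xi = v
      & s = cmod xi] ].

Definition absolutely_continuous (R : realType) (d : nat) (a b : R)
    (sigma : R -> Cvec R d) : Prop :=
  forall eps : R, 0 < eps -> exists2 delta : R, 0 < delta &
  forall (n : nat) (s t : 'I_n -> R),
    (forall i, a <= s i /\ s i <= t i /\ t i <= b) ->
    trivIset setT (fun i => `]s i, t i[%classic) ->
    \sum_(i < n) (t i - s i) < delta ->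
    \sum_(i < n) enorm (sigma (t i) - sigma (s i)) < eps.

(* Coordinatewise derivative with respect to the real parameter; where sigma
   is not differentiable (a null set if sigma is absolutely continuous) the
   value is a default one. *)
Definition velocity (R : realType) (d : nat) (sigma : R -> Cvec R d) (t : R)
    : Cvec R d :=
  \row_(j < d) (derive1 (fun s => complex.Re (sigma s 0 j)) t
             +i* derive1 (fun s => complex.Im (sigma s 0 j)) t).

Definition kobayashi_length (R : realType) (d : nat) (Om : set (Cvec R d))
    (a b : R) (sigma : R -> Cvec R d) : \bar R :=
  (\int[@lebesgue_measure R]_(t in `[a, b])
     (kobayashi_metric Om (sigma t) (velocity sigma t))%:E)%E.

(* The infimum is finite as soon as x and y are joined by a curve of finite
   length, hence always on a convex domain; fine is then harmless. *)
Definition kobayashi_dist (R : realType) (d : nat) (Om : set (Cvec R d))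
    (x y : Cvec R d) : R :=
  fine (ereal_inf [set l : \bar R |
    exists (a b : R) (sigma : R -> Cvec R d),
      [/\ a <= b,
          absolutely_continuous a b sigma,
          forall t, a <= t <= b -> Om (sigma t),
          sigma a = x /\ sigma b = y
        & l = kobayashi_length Om a b sigma] ]).

(* Metric spaces are given by a set X of points and a distance function that
   is only relevant on X. *)
Definition metric_on (R : realType) (T : Type) (X : set T) (dist : T -> T -> R)
    : Prop :=
  [/\ forall x y, X x -> X y -> 0 <= dist x y,
      forall x y, X x -> X y -> (dist x y = 0 <-> x = y),
      forall x y, X x -> X y -> dist x y = dist y x
    & forall x y z, X x -> X y -> X z -> dist x z <= dist x y + dist y z].

Definition geodesic_segment (R : realType) (T : Type) (X : set T)
    (dist : T -> T -> R) (x y : T) (S : set T) : Prop :=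
  exists (l u : R) (sigma : R -> T),
    [/\ l <= u,
        forall s, l <= s <= u -> X (sigma s),
        forall s t, l <= s <= u -> l <= t <= u ->
          dist (sigma s) (sigma t) = `|s - t|,
        sigma l = x /\ sigma u = y
      & S = [set sigma s | s in `[l, u]]].

Definition geodesic_space (R : realType) (T : Type) (X : set T)
    (dist : T -> T -> R) : Prop :=
  metric_on X dist /\
  forall x y, X x -> X y -> exists S, geodesic_segment X dist x y S.

Definition plane_dist (R : realType) (u v : 'rV[R]_2) : R :=
  Num.sqrt (\sum_(j < 2) (u 0 j - v 0 j) ^+ 2).

Definition plane_segment (R : realType) (u v : 'rV[R]_2) : set 'rV[R]_2 :=
  [set w | exists2 t : R, 0 <= t <= 1 & w = (1 - t) *: u + t *: v].

Definition CAT0 (R : realType) (T : Type) (X : set T) (dist : T -> T -> R)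
    : Prop :=
  geodesic_space X dist /\
  forall (a b c : T) (Sab Sbc Sca : set T),
    X a -> X b -> X c ->
    geodesic_segment X dist a b Sab ->
    geodesic_segment X dist b c Sbc ->
    geodesic_segment X dist c a Sca ->
  forall p q : T, Sab p -> Sca q ->
  forall a' b' c' p' q' : 'rV[R]_2,
    plane_dist a' b' = dist a b ->
    plane_dist b' c' = dist b c ->
    plane_dist c' a' = dist c a ->
    plane_segment a' b' p' -> plane_segment a' c' q' ->
    plane_dist a' p' = dist a p -> plane_dist a' q' = dist a q ->
    dist p q <= plane_dist p' q'.

(* Both infima are over nonempty sets when Om is C-proper, p is in Om and
   v != 0. *)
Definition bdist (R : realType) (d : nat) (Om : set (Cvec R d)) (p : Cvec R d)
    : R :=
  inf [set enorm (p - x) | x in boundary Om].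

Definition bdist_dir (R : realType) (d : nat) (Om : set (Cvec R d))
    (p v : Cvec R d) : R :=
  inf [set enorm (p - x) | x in
         boundary Om `&` [set p + zeta *: v | zeta in [set: R[i]]]].

(* Meaningful for 0 < m only: 0%:R^-1 = 0. *)
Definition locally_convex_order (R : realType) (d m : nat)
    (Om : set (Cvec R d)) : Prop :=
  forall rho : R, 0 < rho -> exists2 C : R, 0 < C &
  forall z v : Cvec R d, Om z -> enorm z < rho -> v != 0 ->
    bdist_dir Om z v <= C * bdist Om z `^ (m%:R^-1).

(* Real directional derivative along v of a real-valued function on a complex
   normed space (C^d or the complex plane). *)
Definition rderivable (R : realType) (V : normedModType R[i]) (f : V -> R)
    (v z : V) : Prop :=
  derivable (fun t : R => f (z + t%:C *: v)) 0 1.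

Definition rderive (R : realType) (V : normedModType R[i]) (f : V -> R)
    (v : V) : V -> R :=
  fun z => derive1 (fun t : R => f (z + t%:C *: v)) 0.

Definition iter_rderive (R : realType) (V : normedModType R[i]) (vs : seq V)
    (f : V -> R) : V -> R :=
  foldr (fun v g => rderive g v) f vs.

(* C^oo in the real sense: directional derivatives of all orders exist
   everywhere and are continuous. *)
Definition smooth (R : realType) (V : normedModType R[i]) (f : V -> R) : Prop :=
  forall vs : seq V, continuous (iter_rderive vs f) /\
    forall v z, rderivable (iter_rderive vs f) v z.

(* Real gradient, with R^(2d) identified with C^d. *)
Definition gradient (R : realType) (d : nat) (r : Cvec R d -> R)
    (z : Cvec R d) : Cvec R d :=
  \row_(j < d) (rderive r (delta_mx 0 j) z
             +i* rderive r ('i *: (delta_mx 0 j : Cvec R d)) z).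

Definition smooth_defining_function (R : realType) (d : nat)
    (Om : set (Cvec R d)) (r : Cvec R d -> R) : Prop :=
  [/\ smooth r,
      Om = [set z | r z < 0]
    & forall x, boundary Om x -> \forall z \near x, gradient r z != 0].

(* Supremum of the n such that all real derivatives of f of order < n vanish
   at 0. *)
Definition vanishing_order (R : realType) (f : Cplane R -> R) : \bar R :=
  ereal_sup [set n%:R%:E | n in [set n : nat |
    forall vs : seq (Cplane R), (size vs < n)%N -> iter_rderive vs f 0 = 0]].

Definition complex_affine (R : realType) (d : nat)
    (ell : Cplane R -> Cvec R d) : Prop :=
  exists p v : Cvec R d, forall zeta, ell zeta = p + zeta *: v.

Definition affine_lines_at (R : realType) (d : nat) (x : Cvec R d)
    : set (Cplane R -> Cvec R d) :=
  [set ell | [/\ complex_affine ell,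
                 ~ (exists c, forall zeta, ell zeta = c)
               & ell 0 = x]].

Definition finite_line_type_at (R : realType) (d : nat) (r : Cvec R d -> R)
    (x : Cvec R d) : Prop :=
  (ereal_sup [set vanishing_order (r \o ell) | ell in affine_lines_at x] < +oo)%E.

Definition finite_line_type (R : realType) (d : nat) (Om : set (Cvec R d))
    (r : Cvec R d -> R) : Prop :=
  forall x, boundary Om x -> finite_line_type_at r x.

(* Main.v *)
(** In a CAT(0) space two points have only one midpoint up to an error controlled
    by the excess of the distances. Let b be a point outside of a convex domain
    Om, nearest to c in Om, and let a complex line through c leave Om at
    distance u. If the slice of Om in this direction at b + e (c - b) still
    contained a disc of radius u/4, with e a universal small constant, then
    explicit Moebius discs would produce two well separated almost-midpoints of
    one pair of points. The lower bounds for the distance come from real parts of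
    affine functionals: the Schwarz lemma for the half-plane bounds the metric,
    and an absolutely continuous function is the integral of its derivative.
    Hence, towards a boundary point, either the radius of these slices shrinks by
    a fixed factor between consecutive geometric scales or the ratio of the
    boundary distance to the scale grows by a fixed factor. The latter ratio is
    monotone and bounded, so the slices decay like a power of the boundary
    distance, with an exponent that depends neither on Om nor on the dimension.
    For a smooth boundary, a line with contact of order greater than m at x
    produces points at height about a^(m+1) above x whose slices have radius at
    least a, against local m-convexity. *)

Require Import Defs.
From HB Require Import structures.
From mathcomp Require Import all_boot all_order all_algebra.
From mathcomp Require Import complex.
From mathcomp Require Import all_classical all_reals all_analysis measurable_realfun.
From mathcomp Require Import ring lra zify.

Set Implicit Arguments.
Unset Strict Implicit.
Unset Printing Implicit Defensive.

Import Order.TTheory GRing.Theory Num.Theory.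
Import numFieldNormedType.Exports.

Local Open Scope classical_set_scope.
Local Open Scope ring_scope.
Local Open Scope complex_scope.

(** * Goursat's lemma, mean values and the Schwarz lemma for a half-plane *)

(** All scales of the two-midpoint configuration are powers of one small [s]: the points have
    heights about [s ^+ 4] over b, the Moebius parameter is [1 - 6 * s], and the slice assumed large
    sits at height [s ^+ 6]. The gap between these powers is what lets the average of the slice and
    of the ball contain the discs. Replacing 1 by [1 - 6 * s] costs O(s) in distance, so the
    comparison confines the almost-midpoints to O(sqrt s), while their separation [ln (64 / 63) / 2]
    does not involve s. This fixes s, and with it the exponent, once and for all. The definitions
    shape the analytic half. Competing discs are only complex differentiable at each point, so the
    Schwarz lemma starts from Goursat's bisection. Competing curves are arbitrary absolutely
    continuous ones whose Kobayashi speed is not known to be measurable, so the lower bound must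
    compare the integral of a measurable function with that of a possibly nonmeasurable one. *)

Section SegmentIntegral.
Variable R : realType.
Implicit Types (f g : R -> R) (a b c k M : R).
Notation mu := (@lebesgue_measure R).

Definition sint f a b : R := \int[mu]_(x in `[a, b]) f x.

Lemma within_pointwise f a b :
  (forall x, a <= x <= b -> {for x, continuous f}) -> {within `[a, b], continuous f}.
Proof.
move=> h; apply: continuous_in_subspaceT => x; rewrite inE/= in_itv/= => xab.
exact: h.
Qed.

Lemma sint_integrable f a b : {within `[a, b], continuous f} ->
  mu.-integrable `[a, b] (EFin \o f).
Proof. by move=> cf; apply: continuous_compact_integrable => //; exact: segment_compact. Qed.

Lemma sint_chasles f a b c : a <= c -> c <= b -> {within `[a, b], continuous f} ->
  sint f a b = sint f a c + sint f c b.
Proof.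
move=> ac cb cf; have fi := sint_integrable cf.
have := @Rintegral_itvB R f (BLeft a) (BRight b) c fi.
rewrite !bnd_simp => /(_ ac cb) h; rewrite /sint.
rewrite -(@Rintegral_itv_obnd_cbnd R c (BRight b)); first by rewrite -h addrC subrK.
apply: integrableS fi => // x /=; rewrite !in_itv/= => /andP[cx ->].
by rewrite (ltW (le_lt_trans ac cx)).
Qed.

Lemma sintB f g a b : {within `[a, b], continuous f} -> {within `[a, b], continuous g} ->
  sint (fun x => f x - g x) a b = sint f a b - sint g a b.
Proof. by move=> cf cg; rewrite /sint RintegralB//; exact: sint_integrable. Qed.

Lemma sint_cst a b k : a <= b -> sint (fun=> k) a b = k * (b - a).
Proof.
move=> ab; rewrite /sint Rintegral_cst//.
have := @lebesgue_measure_itv R `[a, b]; rewrite /= lte_fin => ->.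
by move: ab; rewrite le_eqVlt => /predU1P[->|->]//=; rewrite ltxx subrr.
Qed.

Lemma sint_near_cst f a b k M : a <= b -> {within `[a, b], continuous f} ->
  (forall x, a <= x <= b -> `|f x - k| <= M) ->
  `|sint f a b - k * (b - a)| <= M * (b - a).
Proof.
move=> ab cf h; rewrite -!sint_cst// -sintB//; last first.
  by apply: within_pointwise => x _; exact: cst_continuous.
have cB : {within `[a, b], continuous (fun x => f x - k)}.
  by move=> x; apply: continuousB; [exact: cf|exact: cst_continuous].
apply: le_trans (le_normr_Rintegral _ (sint_integrable cB)) _ => //.
apply: le_Rintegral => //.
- apply: sint_integrable => x.
  exact: (continuous_comp (cB x) (@norm_continuous _ _ _)).
- by apply: sint_integrable; apply: within_pointwise => x _; exact: cst_continuous.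
Qed.

Lemma sint_ge0 f a b : (forall x, a <= x <= b -> 0 <= f x) -> 0 <= sint f a b.
Proof. by move=> h; apply: Rintegral_ge0 => x /=; rewrite in_itv/=; exact: h. Qed.

Lemma sint_FTC f (F : R -> R) a b : a < b ->
  (forall x, a <= x <= b -> {for x, continuous f}) ->
  (forall x : R, a <= x <= b -> is_derive x (1 : R) F (f x)) -> sint f a b = F b - F a.
Proof.
move=> ab cf dF; rewrite /sint /Rintegral.
have cF x : a <= x <= b -> {for x, continuous F}.
  by move=> xab; apply: differentiable_continuous; apply/derivable1_diffP; have [] := dF x xab.
have oc x : x \in `]a, b[ -> a <= x <= b.
  by rewrite in_itv/= => /andP[/ltW -> /ltW ->].
rewrite (@continuous_FTC2 R f F)//.
- exact: within_pointwise.
- split=> [x /oc xab||]; first by have [] := dF x xab.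
  + by apply/cvg_at_right_filter/cF; rewrite lexx ltW.
  + by apply/cvg_at_left_filter/cF; rewrite lexx andbT ltW.
- by move=> x /oc xab; rewrite derive1E; have [_ ->] := dF x xab.
Qed.

End SegmentIntegral.

Section Goursat.
Variable R : realType.
Variables P Q : R -> R -> R.

(** The integral of P dx + Q dy along the boundary of [x, x + w] x [y, y + h], counterclockwise;
    opposite sides are paired so that each integrand is a difference of nearby values. *)
Definition circulation x w y h : R :=
  sint (fun s => P s y - P s (y + h)) x (x + w) +
  sint (fun t => Q (x + w) t - Q x t) y (y + h).

(* The differential form P dx + Q dy has first derivatives at (x, y) that make
   it closed there; their continuity is not assumed. *)
Definition closed_at (x y : R) := exists a b c : R, forall e : R, 0 < e -> exists2 d : R, 0 < d &
  forall x' y' : R, `|x' - x| < d -> `|y' - y| < d ->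
    `|P x' y' - P x y - (a * (x' - x) + b * (y' - y))| <= e * (`|x' - x| + `|y' - y|) /\
    `|Q x' y' - Q x y - (b * (x' - x) + c * (y' - y))| <= e * (`|x' - x| + `|y' - y|).

Lemma linearly_approximable_continuous (F : R -> R) z k d : 0 < d ->
  (forall z', `|z' - z| < d -> `|F z' - F z - k * (z' - z)| <= `|z' - z|) ->
  {for z, continuous F}.
Proof.
move=> d0 hF; apply/cvgrPdist_le => e e0.
have K0 : 0 < `|k| + 1 by rewrite ltr_wpDl.
near=> z'.
have zd : `|z' - z| < d.
  by rewrite distrC; near: z'; apply: (@cvgr_dist_lt _ _ _ _ _ id z) => //; exact: cvg_id.
have ze : `|z' - z| < e / (`|k| + 1).
  rewrite distrC; near: z'; apply: (@cvgr_dist_lt _ _ _ _ _ id z); last by rewrite divr_gt0.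
  exact: cvg_id.
rewrite distrC -(subrK (k * (z' - z)) (F z' - F z)).
apply: le_trans (ler_normD _ _) _; rewrite normrM.
apply: le_trans (lerD (hF _ zd) (lexx _)) _.
by rewrite -{1}(mul1r `|z' - z|) -mulrDl addrC mulrC -ler_pdivlMr// ltW.
Unshelve. all: by end_near. Qed.

Lemma closed_at_continuous x y : closed_at x y ->
  [/\ {for x, continuous (fun s => P s y)}, {for y, continuous (fun t => Q x t)}
    , {for x, continuous (fun s => Q s y)} & {for y, continuous (fun t => P x t)}].
Proof.
move=> [a [b [c h]]]; have [d d0 {}h] := h 1 ltr01.
have key F z k := @linearly_approximable_continuous F z k d d0.
split.
- apply: (key _ _ a) => s sd; have [|+ _] := h s y sd; first by rewrite subrr normr0.
  by rewrite subrr normr0 mulr0 !addr0 mul1r.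
- apply: (key _ _ c) => s sd; have [|_ +] := h x s _ sd; first by rewrite subrr normr0.
  by rewrite subrr normr0 mulr0 !add0r mul1r.
- apply: (key _ _ b) => s sd; have [|_ +] := h s y sd; first by rewrite subrr normr0.
  by rewrite subrr normr0 mulr0 !addr0 mul1r.
- apply: (key _ _ b) => s sd; have [|+ _] := h x s _ sd; first by rewrite subrr normr0.
  by rewrite subrr normr0 mulr0 !add0r mul1r.
Qed.

Section Rect.
Variables x0 w0 y0 h0 : R.
Hypothesis w0_gt0 : 0 < w0.
Hypothesis h0_gt0 : 0 < h0.
Hypothesis PQ : forall x y, x0 <= x <= x0 + w0 -> y0 <= y <= y0 + h0 -> closed_at x y.

Let inrect (x w y h : R) := [/\ x0 <= x, 0 <= w, x + w <= x0 + w0, y0 <= y & 0 <= h /\ y + h <= y0 + h0].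

Let contP (y a b : R) : x0 <= a -> b <= x0 + w0 -> y0 <= y <= y0 + h0 ->
  {within `[a, b], continuous (fun s => P s y)}.
Proof.
move=> xa bx yy; apply: within_pointwise => s /andP[as_ sb].
by have [] := closed_at_continuous (@PQ s y _ yy); rewrite ?(le_trans xa as_) ?(le_trans sb bx).
Qed.

Let contQ (x a b : R) : y0 <= a -> b <= y0 + h0 -> x0 <= x <= x0 + w0 ->
  {within `[a, b], continuous (fun s => Q x s)}.
Proof.
move=> xa bx yy; apply: within_pointwise => s /andP[as_ sb].
by have [] := closed_at_continuous (@PQ x s yy _); rewrite ?(le_trans xa as_) ?(le_trans sb bx).
Qed.

(** The inner sides are run twice, in opposite directions. *)
Let circulation_split (x w y h : R) : inrect x (w + w) y (h + h) ->
  circulation x (w + w) y (h + h) =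
  circulation x w y h + circulation (x + w) w y h +
  (circulation x w (y + h) h + circulation (x + w) w (y + h) h).
Proof.
move=> [xx ww xw yy [hh yh]].
have w1 : 0 <= w by lra.
have h1 : 0 <= h by lra.
rewrite /circulation !addrA.
have cP t a b : y0 <= t -> t <= y0 + h0 -> x0 <= a -> b <= x0 + w0 ->
    {within `[a, b], continuous (fun s => P s t)}.
  by move=> t1 t2 a1 b1; apply: contP => //; rewrite t1.
have cQ t a b : x0 <= t -> t <= x0 + w0 -> y0 <= a -> b <= y0 + h0 ->
    {within `[a, b], continuous (fun s => Q t s)}.
  by move=> t1 t2 a1 b1; apply: contQ => //; rewrite t1.
rewrite !sintB; try by (apply: cP; lra).
all: try by (apply: cQ; lra).
rewrite (@sint_chasles _ (fun s => P s y) x (x + w + w) (x + w)); [|lra|lra|apply: cP; lra].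
rewrite (@sint_chasles _ (fun s => P s (y + h + h)) x (x + w + w) (x + w)); [|lra|lra|apply: cP; lra].
rewrite (@sint_chasles _ (fun s => Q x s) y (y + h + h) (y + h)); [|lra|lra|apply: cQ; lra].
rewrite (@sint_chasles _ (fun s => Q (x + w + w) s) y (y + h + h) (y + h)); [|lra|lra|apply: cQ; lra].
ring.
Qed.

Let state := (R * R)%type.
(** Invariant of the bisection: a rectangle with both sides halved n times still carries at least
    the fraction 4^-n of the whole circulation. *)
Let good n (p : state) := inrect p.1 (w0 / 2 ^+ n) p.2 (h0 / 2 ^+ n) /\
  `|circulation x0 w0 y0 h0| <= 4 ^+ n * `|circulation p.1 (w0 / 2 ^+ n) p.2 (h0 / 2 ^+ n)|.

Let step n (p : state) : good n p -> exists q : state, good n.+1 q /\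
  [/\ p.1 <= q.1, q.1 <= p.1 + w0 / 2 ^+ n.+1, p.2 <= q.2 & q.2 <= p.2 + h0 / 2 ^+ n.+1].
Proof.
case: p => x y [/= ir]; set w := w0 / 2 ^+ n.+1; set h := h0 / 2 ^+ n.+1.
have e2 : (2 ^+ n : R) != 0 by rewrite expf_neq0.
have -> : w0 / 2 ^+ n = w + w by rewrite /w exprS; field.
have -> : h0 / 2 ^+ n = h + h by rewrite /h exprS; field.
have ew : w0 / 2 ^+ n = w + w by rewrite /w exprS; field.
have eh : h0 / 2 ^+ n = h + h by rewrite /h exprS; field.
rewrite ew eh in ir.
have w1 : 0 < w by rewrite divr_gt0// exprn_gt0.
have h1 : 0 < h by rewrite divr_gt0// exprn_gt0.
rewrite circulation_split// => hc.
set S := `|circulation x0 w0 y0 h0| in hc *.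
set a := circulation x w y h in hc; set b := circulation (x + w) w y h in hc.
set c := circulation x w (y + h) h in hc; set d := circulation (x + w) w (y + h) h in hc.
case: ir => i1 i2 i3 i4 [i5 i6].
have e4 : 0 < (4 ^+ n : R) by rewrite exprn_gt0.
have [Sa|Sa] := leP S (4 ^+ n.+1 * `|a|).
  by exists (x, y); rewrite /good/= -/w -/h; repeat split => //; lra.
have [Sb|Sb] := leP S (4 ^+ n.+1 * `|b|).
  by exists (x + w, y); rewrite /good/= -/w -/h; repeat split => //; lra.
have [Sc|Sc] := leP S (4 ^+ n.+1 * `|c|).
  by exists (x, y + h); rewrite /good/= -/w -/h; repeat split => //; lra.
have [Sd|Sd] := leP S (4 ^+ n.+1 * `|d|).
  by exists (x + w, y + h); rewrite /good/= -/w -/h; repeat split => //; lra.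
(* If all four quarters violated the bound, the rectangle that they form would violate it as
   well. *)
exfalso.
have T : `|a + b + (c + d)| <= `|a| + `|b| + (`|c| + `|d|).
  by apply: le_trans (ler_normD _ _) _; apply: lerD; exact: ler_normD.
have := le_trans hc (ler_wpM2l (ltW e4) T).
move: Sa Sb Sc Sd; rewrite exprS; nra.
Qed.

Let seqst : {f : nat -> state | forall n, good n (f n) /\
   [/\ (f n).1 <= (f n.+1).1, (f n.+1).1 <= (f n).1 + w0 / 2 ^+ n.+1,
       (f n).2 <= (f n.+1).2 & (f n.+1).2 <= (f n).2 + h0 / 2 ^+ n.+1]}.
Proof.
have g0 : good 0 (x0, y0).
  by rewrite /good /inrect/= !expr0 !divr1 mul1r; repeat split; rewrite ?lexx// ltW.
have st (n : nat) (p : {p : state | good n p}) : {q : {q : state | good n.+1 q} |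
  [/\ (sval p).1 <= (sval q).1, (sval q).1 <= (sval p).1 + w0 / 2 ^+ n.+1,
   (sval p).2 <= (sval q).2 & (sval q).2 <= (sval p).2 + h0 / 2 ^+ n.+1]}.
  have [q [gq hq]] := cid (step (svalP p)).
  by exists (exist _ q gq).
pose F := fix F n : {p : state | good n p} :=
  if n is m.+1 then sval (st m (F m)) else exist _ _ g0.
exists (fun n => sval (F n)) => n; split; first exact: svalP.
exact: (svalP (st n (F n))).
Qed.

Lemma goursat : circulation x0 w0 y0 h0 = 0.
Proof.
case: seqst => f hf.
have lim1 (g : nat -> R) (w : R) : 0 < w -> (forall n, g n <= g n.+1 /\ g n.+1 <= g n + w / 2 ^+ n.+1) ->
    exists z, forall n, g n <= z <= g n + w / 2 ^+ n.
  move=> wp hg.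
  have mono n m : g n <= g (n + m)%N.
    by elim: m => [|m IH]; rewrite ?addn0// addnS (le_trans IH)//; have [] := hg (n + m)%N.
  have up n m : g (n + m)%N + w / 2 ^+ (n + m)%N <= g n + w / 2 ^+ n.
    elim: m => [|m IH]; first by rewrite addn0.
    apply: le_trans IH; rewrite addnS; have [_ h] := hg (n + m)%N.
    have : w / 2 ^+ (n + m)%N = w / 2 ^+ (n + m).+1 + w / 2 ^+ (n + m).+1.
      by rewrite exprS; field; rewrite expf_neq0.
    by lra.
  have bd n m : g m <= g n + w / 2 ^+ n.
    have wn k : 0 <= w / 2 ^+ k by rewrite divr_ge0// ?exprn_ge0// ltW.
    have [nm|mn] := leqP n m.
      rewrite -(subnKC nm); apply: le_trans (up n (m - n)%N); rewrite lerDl; exact: wn.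
    rewrite -{2}(subnKC (ltnW mn)); apply: le_trans (mono m (n - m)%N) _.
    by rewrite subnKC 1?ltnW// lerDl wn.
  have hs : has_sup (range g).
    split; first by exists (g 0%N), 0%N.
    by exists (g 0%N + w / 2 ^+ 0) => _ [m _ <-]; exact: bd.
  exists (sup (range g)) => n; apply/andP; split.
    by apply: ub_le_sup; [exact: hs.2|exists n].
  by apply: ge_sup; [exact: hs.1|move=> _ [m _ <-]; exact: bd].
have [X hX] := lim1 (fun n => (f n).1) w0 w0_gt0 (fun n => let: conj _ (And4 a b _ _) := hf n in conj a b).
have [Y hY] := lim1 (fun n => (f n).2) h0 h0_gt0 (fun n => let: conj _ (And4 _ _ a b) := hf n in conj a b).
have [[[a1 a2 a3 a4 [a5 a6]] _] _] := hf 0%N.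
have Xin : x0 <= X <= x0 + w0.
  by have /andP[u v] := hX 0%N; rewrite (le_trans a1 u) (le_trans v a3).
have Yin : y0 <= Y <= y0 + h0.
  by have /andP[u v] := hY 0%N; rewrite (le_trans a4 u) (le_trans v a6).
have [a [b [c hc]]] := PQ Xin Yin.
apply/eqP; rewrite -normr_le0; apply/ler_addgt0Pl => e e0; rewrite addr0.
(* The constant e / (2 s^2) anticipates the final estimate 4^n * 2 k (s / 2^n)^2 = e. *)
set s := w0 + h0; have s0 : 0 < s by rewrite addr_gt0.
have k0 : 0 < e / (2 * s ^+ 2) by rewrite divr_gt0// mulr_gt0// exprn_gt0.
have [d d0 hd] := hc _ k0.
have [n hn] : exists n, s / 2 ^+ n < d.
  exists (Num.bound (s / d)); rewrite ltr_pdivrMr ?exprn_gt0//.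
  rewrite mulrC -ltr_pdivrMr//.
  apply: lt_trans (archi_boundP (ltW (divr_gt0 s0 d0))) _.
  by rewrite -natrX ltr_nat ltn_expl.
have [[[i1 i2 i3 i4 [i5 i6]] hcirc] _] := hf n.
apply: le_trans hcirc _.
move: (hX n) (hY n) i1 i2 i3 i4 i5 i6.
set x := (f n).1; set y := (f n).2; set w := w0 / 2 ^+ n; set h := h0 / 2 ^+ n.
move=> /andP[X1 X2] /andP[Y1 Y2] i1 i2 i3 i4 i5 i6.
have whd : w + h < d by rewrite /w /h -mulrDl.
set k := e / (2 * s ^+ 2) in k0 hd *.
have near x' y' : x <= x' <= x + w -> y <= y' <= y + h ->
  `|P x' y' - P X Y - (a * (x' - X) + b * (y' - Y))| <= k * (w + h) /\
  `|Q x' y' - Q X Y - (b * (x' - X) + c * (y' - Y))| <= k * (w + h).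
  move=> /andP[u1 u2] /andP[v1 v2].
  have n1 : `|x' - X| <= w by rewrite ler_norml; apply/andP; split; lra.
  have n2 : `|y' - Y| <= h by rewrite ler_norml; apply/andP; split; lra.
  have [||p q] := hd x' y'; [lra|lra|].
  by split; [apply: (le_trans p)|apply: (le_trans q)]; rewrite ler_pM2l// lerD.
have xw : x <= x + w by rewrite lerDl.
have yh : y <= y + h by rewrite lerDl.
have yy0 : y <= y <= y + h by rewrite lexx.
have yy1 : y <= y + h <= y + h by rewrite lexx andbT.
have xx0 : x <= x <= x + w by rewrite lexx.
have xx1 : x <= x + w <= x + w by rewrite lexx andbT.
(* The integrand is nearly - b h here and nearly b w on the vertical sides; the contributions - b h
   w and b w h cancel, which is where closedness enters. *)
have J1 : `|sint (fun s => P s y - P s (y + h)) x (x + w) - (- (b * h)) * (x + w - x)| <=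
    (2 * k * (w + h)) * (x + w - x).
  apply: sint_near_cst => //.
    by move=> t; apply: continuousB; apply: contP => //; rewrite ?i4 ?(le_trans yh)// ?(le_trans i4).
  move=> t tx; have [p _] := near t y tx yy0.
  have [p' _] := near t (y + h) tx yy1.
  move: p p'; rewrite !ler_norml => /andP[p1 p2] /andP[p3 p4].
  by apply/andP; split; lra.
have J2 : `|sint (fun t => Q (x + w) t - Q x t) y (y + h) - (b * w) * (y + h - y)| <=
    (2 * k * (w + h)) * (y + h - y).
  apply: sint_near_cst => //.
    by move=> t; apply: continuousB; apply: contQ => //; rewrite ?i1 ?(le_trans xw)// ?(le_trans i1).
  move=> t tx; have [_ p] := near x t xx0 tx.
  have [_ p'] := near (x + w) t xx1 tx.
  move: p p'; rewrite !ler_norml => /andP[p1 p2] /andP[p3 p4].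
  by apply/andP; split; lra.
have : `|circulation x w y h| <= 2 * k * (w + h) ^+ 2.
  rewrite /circulation; move: J1 J2.
  have -> : x + w - x = w by ring.
  have -> : y + h - y = h by ring.
  rewrite !ler_norml => /andP[p1 p2] /andP[p3 p4].
  by apply/andP; split; lra.
move=> /(ler_wpM2l (exprn_ge0 n (ler0n R 4))) /le_trans; apply.
have -> : w + h = s / 2 ^+ n by rewrite /w /h /s -mulrDl.
rewrite /k expr_div_n -exprM mulnC exprM (_ : 2 ^+ 2 = 4 :> R); last by rewrite -natrX.
rewrite le_eqVlt; apply/orP; left; apply/eqP; field.
by rewrite expf_neq0// gt_eqF.
Qed.

End Rect.
End Goursat.

Section ComplexModulus.
Variable R : realType.
Implicit Types (z w : R[i]) (x : R).

Lemma cmodE z : cmod z = Num.sqrt (complex.Re z ^+ 2 + complex.Im z ^+ 2).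
Proof. by rewrite /cmod normc_def. Qed.

Lemma normC_cmod z : `|z| = (cmod z)%:C.
Proof. by rewrite normc_def cmodE. Qed.

Lemma cmod_ge0 z : 0 <= cmod z.
Proof. by rewrite cmodE sqrtr_ge0. Qed.

Lemma cmodM z w : cmod (z * w) = cmod z * cmod w.
Proof. by apply: complexI; rewrite rmorphM/= -!normC_cmod normrM. Qed.

Lemma cmodD z w : cmod (z + w) <= cmod z + cmod w.
Proof. by rewrite -lecR rmorphD/= -!normC_cmod ler_normD. Qed.

Lemma cmodN z : cmod (- z) = cmod z.
Proof. by apply: complexI; rewrite -!normC_cmod normrN. Qed.

Lemma cmodV z : cmod z^-1 = (cmod z)^-1.
Proof. by apply: complexI; rewrite -normC_cmod normfV normC_cmod fmorphV. Qed.

Lemma cmod0 : cmod (0 : R[i]) = 0.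
Proof. by apply: complexI; rewrite -normC_cmod normr0. Qed.

Lemma cmod1 : cmod (1 : R[i]) = 1.
Proof. by apply: complexI; rewrite -normC_cmod normr1. Qed.

Lemma cmod_eq0 z : (cmod z == 0) = (z == 0).
Proof. by rewrite -(inj_eq (@complexI R)) -normC_cmod normr_eq0. Qed.

Lemma cmod_gt0 z : (0 < cmod z) = (z != 0).
Proof. by rewrite lt_def cmod_ge0 andbT cmod_eq0. Qed.

Lemma cmod_real x : cmod x%:C = `|x|.
Proof. by rewrite cmodE/= expr0n/= addr0 sqrtr_sqr. Qed.

Lemma cmod_sq z : cmod z ^+ 2 = complex.Re z ^+ 2 + complex.Im z ^+ 2.
Proof. by rewrite cmodE sqr_sqrtr// addr_ge0// sqr_ge0. Qed.

Lemma Re_le_cmod z : `|complex.Re z| <= cmod z.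
Proof. by rewrite cmodE -sqrtr_sqr ler_wsqrtr// lerDl sqr_ge0. Qed.

Lemma Im_le_cmod z : `|complex.Im z| <= cmod z.
Proof. by rewrite cmodE -sqrtr_sqr ler_wsqrtr// lerDr sqr_ge0. Qed.

Lemma cmod_le_ReIm z : cmod z <= `|complex.Re z| + `|complex.Im z|.
Proof.
rewrite cmodE -(ler_pXn2r (ltn0Sn 1)) ?nnegrE ?sqrtr_ge0 ?addr_ge0//.
rewrite sqr_sqrtr ?addr_ge0 ?sqr_ge0// sqrrD !real_normK ?num_real//.
by rewrite lerD2r lerDl mulrn_wge0// mulr_ge0.
Qed.

Lemma ReM z w : complex.Re (z * w) = complex.Re z * complex.Re w - complex.Im z * complex.Im w.
Proof. by case: z; case: w. Qed.

Lemma ImM z w : complex.Im (z * w) = complex.Re z * complex.Im w + complex.Im z * complex.Re w.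
Proof. by case: z; case: w. Qed.

Lemma ReD z w : complex.Re (z + w) = complex.Re z + complex.Re w.
Proof. by case: z; case: w. Qed.

Lemma ImD z w : complex.Im (z + w) = complex.Im z + complex.Im w.
Proof. by case: z; case: w. Qed.

Lemma ReN z : complex.Re (- z) = - complex.Re z.
Proof. by case: z. Qed.

Lemma ImN z : complex.Im (- z) = - complex.Im z.
Proof. by case: z. Qed.

Lemma posC_real (e : R[i]) : 0 < e -> exists2 x : R, 0 < x & e = x%:C.
Proof.
move=> e0; have er := gtr0_real e0; have E := RRe_real er.
by exists (complex.Re e); rewrite ?E// -ltcR E.
Qed.

End ComplexModulus.

Section FirstOrder.
Variable R : realType.

(** Differentials on [Cplane R] are linear over R[i], those of real functions over R. The
    epsilon-delta forms [first_order], [first_order2] and [cfirst_order] are the common language in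
    which complex differentiability becomes a statement on two real variables. *)
Definition first_order (F : R -> R) (x k : R) := forall e : R, 0 < e -> exists2 d : R, 0 < d &
  forall x', `|x' - x| < d -> `|F x' - F x - k * (x' - x)| <= e * `|x' - x|.

Lemma is_derive_first_order (F : R -> R) (x k : R) : is_derive x (1 : R) F k -> first_order F x k.
Proof.
move=> [dF kE] e e0.
have : (fun h => h^-1 *: ((F \o shift x) (h *: (1 : R)) - F x)) @ (0 : R)^' --> k.
  by rewrite -kE; exact: dF.
move/cvgrPdist_le => /(_ _ e0); rewrite near_withinE near_simpl => /nbhs_ballP[d /= d0 hd].
exists d => // x' xd.
have [->|nx] := eqVneq x' x; first by rewrite !subrr mulr0 subrr normr0 mulr0.
have := hd (x' - x); rewrite -ball_normE/= sub0r normrN => /(_ xd).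
rewrite subr_eq0 => /(_ nx); rewrite /= [_%:A](mulr1) subrK => h.
have h0 : 0 < `|x' - x| by rewrite normr_gt0 subr_eq0.
rewrite -ler_pdivrMr//.
have -> : `|F x' - F x - k * (x' - x)| / `|x' - x| = `|k - (x' - x)^-1 * (F x' - F x)|.
  rewrite -[in LHS]normfV -normrM -normrN; congr `|_|; field.
  by rewrite subr_eq0.
exact: h.
Qed.

Definition first_order2 (F : R -> R -> R) (x y a b : R) := forall e : R, 0 < e -> exists2 d : R, 0 < d &
  forall x' y', `|x' - x| < d -> `|y' - y| < d ->
  `|F x' y' - F x y - (a * (x' - x) + b * (y' - y))| <= e * (`|x' - x| + `|y' - y|).

Lemma first_order_mul (f g : R -> R) (x y a b : R) : first_order f x a -> first_order g y b ->
  first_order2 (fun s t => f s * g t) x y (a * g y) (f x * b).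
Proof.
move=> hf hg e e0.
set K := 1 + `|f x| + `|g y| + `|a| + `|b|.
have K1 : 1 <= K by rewrite /K -!addrA lerDl !addr_ge0.
have fK : `|f x| <= K by rewrite /K; have := normr_ge0 (g y); have := normr_ge0 a; have := normr_ge0 b; lra.
have gK : `|g y| <= K by rewrite /K; have := normr_ge0 (f x); have := normr_ge0 a; have := normr_ge0 b; lra.
have aK : `|a| <= K by rewrite /K; have := normr_ge0 (g y); have := normr_ge0 (f x); have := normr_ge0 b; lra.
have bK : `|b| + 1 <= K by rewrite /K; have := normr_ge0 (g y); have := normr_ge0 (f x); have := normr_ge0 a; lra.
have K0 : 0 < K by lra.
set e1 := Num.min 1 (e / (3 * K)).
have e10 : 0 < e1 by rewrite lt_min ltr01 divr_gt0// mulr_gt0.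
have e11 : e1 <= 1 by rewrite ge_min lexx.
have e1e : e1 <= e / (3 * K) by rewrite ge_min lexx orbT.
have [d1 d10 h1] := hf e1 e10; have [d2 d20 h2] := hg e1 e10.
exists (Num.min (Num.min d1 d2) (e / (6 * K ^+ 2))).
  by rewrite !lt_min d10 d20 divr_gt0// mulr_gt0// exprn_gt0.
move=> x' y'; rewrite !lt_min => /andP[/andP[xd1 _] xe] /andP[/andP[_ yd2] ye].
have p := h1 x' xd1; have q := h2 y' yd2.
set X := x' - x in p xe *; set Y := y' - y in q ye *.
set u := f x' - f x - a * X in p; set v := g y' - g y - b * Y in q.
have -> : f x' * g y' - f x * g y - (a * g y * X + f x * b * Y) =
  u * g y + f x * v + (u + a * X) * (v + b * Y) by rewrite /u /v; ring.
have X0 := normr_ge0 X; have Y0 := normr_ge0 Y.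
have B1 : `|u * g y| <= e / 3 * `|X|.
  rewrite normrM; apply: le_trans (ler_pM (normr_ge0 _) (normr_ge0 _) p gK) _.
  rewrite mulrAC ler_wpM2r//; apply: le_trans (ler_wpM2r (ltW K0) e1e) _.
  by rewrite le_eqVlt; apply/orP; left; apply/eqP; field; rewrite gt_eqF.
have B2 : `|f x * v| <= e / 3 * `|Y|.
  rewrite normrM; apply: le_trans (ler_pM (normr_ge0 _) (normr_ge0 _) fK q) _.
  rewrite mulrA ler_wpM2r//; apply: le_trans (ler_wpM2l (ltW K0) e1e) _.
  by rewrite le_eqVlt; apply/orP; left; apply/eqP; field; rewrite gt_eqF.
have B3 : `|(u + a * X) * (v + b * Y)| <= e / 3 * `|X|.
  have U : `|u + a * X| <= 2 * K * `|X|.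
    apply: le_trans (ler_normD _ _) _; rewrite normrM.
    have : `|a| * `|X| <= K * `|X| by rewrite ler_wpM2r.
    have : e1 * `|X| <= K * `|X| by rewrite ler_wpM2r// (le_trans e11).
    by lra.
  have V : `|v + b * Y| <= K * `|Y|.
    apply: le_trans (ler_normD _ _) _; rewrite normrM.
    have : (`|b| + 1) * `|Y| <= K * `|Y| by rewrite ler_wpM2r.
    have : e1 * `|Y| <= 1 * `|Y| by rewrite ler_wpM2r.
    by lra.
  rewrite normrM; apply: le_trans (ler_pM (normr_ge0 _) (normr_ge0 _) U V) _.
  have -> : 2 * K * `|X| * (K * `|Y|) = 2 * K ^+ 2 * `|Y| * `|X| by ring.
  rewrite ler_wpM2r//.
  apply: le_trans (ler_wpM2l _ (ltW ye)) _; first by rewrite mulr_ge0// sqr_ge0.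
  by rewrite le_eqVlt; apply/orP; left; apply/eqP; field; rewrite gt_eqF.
apply: le_trans (ler_normD _ _) _; apply: le_trans (lerD (ler_normD _ _) (lexx _)) _.
have : 0 <= e * `|X| by rewrite mulr_ge0// ltW.
have : 0 <= e * `|Y| by rewrite mulr_ge0// ltW.
by lra.
Qed.

Definition cfirst_order (H : R[i] -> R[i]) (z c : R[i]) := forall e : R, 0 < e -> exists2 d : R, 0 < d &
  forall w, cmod (w - z) < d -> cmod (H w - H z - c * (w - z)) <= e * cmod (w - z).

Lemma differentiable_cfirst_order (H : Cplane R -> Cplane R) (z : Cplane R) :
  differentiable H z -> cfirst_order H z ('d H z 1).
Proof.
move=> dH e e0.
have dv : derivable H z 1 by apply/derivable1_diffP.
have : (fun h => h^-1 *: ((H \o shift z) (h *: (1 : Cplane R)) - H z)) @ (0 : Cplane R)^' --> 'd H z 1.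
  by rewrite -deriveE//; exact: dv.
have ec0 : 0 < e%:C by rewrite ltcR.
move/cvgrPdist_le => /(_ _ ec0); rewrite near_withinE. move=> /(@nbhs_ballP _ (Cplane R))[d' /= d0 hd].
have [d dp dE] := posC_real d0.
exists d => // w wd.
set c := 'd H z 1 in hd *.
have [->|nx] := eqVneq w z; first by rewrite !subrr mulr0 subrr cmod0 mulr0.
have := hd (w - z); rewrite -ball_normE/= sub0r normrN normC_cmod dE ltcR => /(_ wd).
rewrite subr_eq0 => /(_ nx); rewrite /= [_%:A](mulr1) subrK => h.
have h0 : 0 < cmod (w - z) by rewrite cmod_gt0 subr_eq0.
rewrite -ler_pdivrMr//.
have -> : cmod (H w - H z - c * (w - z)) / cmod (w - z) = cmod (c - (w - z)^-1 * (H w - H z)).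
  rewrite -cmodV -cmodM -cmodN; congr cmod; field.
  by rewrite subr_eq0.
by rewrite -lecR -normC_cmod.
Qed.

End FirstOrder.

Section MeanValue.
Variable R : realType.

Definition polar (s t : R) : R[i] := (s * cos t) +i* (s * sin t).

Lemma cmod_polar s t : 0 <= s -> cmod (polar s t) = s.
Proof.
move=> s0; rewrite cmodE/= !exprMn -mulrDr cos2Dsin2 mulr1 sqrtr_sqr ger0_norm//.
Qed.

(* Im H ds + Re H dt is the real part of H dz / (i z) in the coordinates
   z = exp (s + i t). *)
Lemma cfirst_order_polar (H : R[i] -> R[i]) (c : R[i]) (s t : R) :
  cfirst_order H (polar (expR s) t) c ->
  closed_at (fun s t => complex.Im (H (polar (expR s) t)))
            (fun s t => complex.Re (H (polar (expR s) t))) s t.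
Proof.
set z := polar (expR s) t => hH.
exists (complex.Im (c * z)), (complex.Re (c * z)), (- complex.Im (c * z)) => e e0.
have hx := first_order_mul (is_derive_first_order (is_derive_expR s)) (is_derive_first_order (is_derive_cos t)).
have hy := first_order_mul (is_derive_first_order (is_derive_expR s)) (is_derive_first_order (is_derive_sin t)).
set K := 2 * cmod z + 2; have K0 : 0 < K by rewrite /K ltr_wpDl// mulr_ge0// cmod_ge0.
set C := cmod c + 1; have C0 : 0 < C by rewrite /C ltr_wpDl// cmod_ge0.
set e1 := Num.min 1 (e / (4 * C)).
have e10 : 0 < e1 by rewrite lt_min ltr01 divr_gt0// mulr_gt0.
have e11 : e1 <= 1 by rewrite ge_min lexx.
have e1e : e1 <= e / (4 * C) by rewrite ge_min lexx orbT.
have [d1 d10 h1] := hx e1 e10; have [d2 d20 h2] := hy e1 e10.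
have eK : 0 < e / (2 * K) by rewrite divr_gt0// mulr_gt0.
have [d3 d30 h3] := hH _ eK.
exists (Num.min (Num.min d1 d2) (d3 / (2 * K))).
  by rewrite !lt_min d10 d20 divr_gt0// mulr_gt0.
move=> s' t'; rewrite !lt_min => /andP[/andP[sd1 sd2] sd3] /andP[/andP[td1 td2] td3].
have {h1} p := h1 s' t' sd1 td1; have {h2} q := h2 s' t' sd2 td2.
set X := s' - s in sd1 sd2 sd3 p q *; set Y := t' - t in td1 td2 td3 p q *.
set z' := polar (expR s') t'.
set N := `|X| + `|Y| in p q *.
have N0 : 0 <= N by rewrite addr_ge0.
set dl := z' - z - z * (X +i* Y).
have dlN : cmod dl <= 2 * e1 * N.
  apply: le_trans (cmod_le_ReIm _) _.
  have -> : complex.Re dl = expR s' * cos t' - expR s * cos t -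
      (expR s * cos t * X + expR s * - sin t * Y).
    by rewrite /dl !(ReD, ReN, ReM)/=; ring.
  have -> : complex.Im dl = expR s' * sin t' - expR s * sin t -
      (expR s * sin t * X + expR s * cos t * Y).
    by rewrite /dl !(ImD, ImN, ImM)/=; ring.
  by apply: le_trans (lerD p q) _; lra.
have XYN : cmod (X +i* Y) <= N by apply: le_trans (cmod_le_ReIm _) _.
have zzN : cmod (z' - z) <= K * N.
  rewrite -(subrK (z * (X +i* Y)) (z' - z)) -/dl; apply: le_trans (cmodD _ _) _.
  rewrite cmodM; have : cmod z * cmod (X +i* Y) <= cmod z * N by rewrite ler_wpM2l// cmod_ge0.
  have : e1 * N <= 1 * N by rewrite ler_wpM2r.
  have : 0 <= cmod z * N by rewrite mulr_ge0// cmod_ge0.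
  by rewrite /K; lra.
have Nd : K * N < d3.
  have : N < d3 / K.
    rewrite /N (_ : d3 / K = d3 / (2 * K) + d3 / (2 * K)); first exact: ltrD.
    by field; rewrite gt_eqF.
  by rewrite ltr_pdivlMr// mulrC.
have {h3} h3 := h3 z' (le_lt_trans zzN Nd).
have main : cmod (H z' - H z - c * z * (X +i* Y)) <= e * N.
  have -> : H z' - H z - c * z * (X +i* Y) = (H z' - H z - c * (z' - z)) + c * dl.
    by rewrite /dl; ring.
  apply: le_trans (cmodD _ _) _; rewrite cmodM.
  have : e / (2 * K) * cmod (z' - z) <= e / (2 * K) * (K * N).
    by rewrite ler_wpM2l// ltW// divr_gt0// mulr_gt0.
  have -> : e / (2 * K) * (K * N) = e / 2 * N by field; rewrite gt_eqF.
  have : cmod c * cmod dl <= C * (2 * e1 * N).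
    by rewrite ler_pM ?cmod_ge0// /C lerDl.
  have : C * (2 * e1 * N) <= C * (2 * (e / (4 * C)) * N).
    by rewrite ler_wpM2l ?(ltW C0)// ler_wpM2r// ler_wpM2l.
  have -> : C * (2 * (e / (4 * C)) * N) = e / 2 * N by field; rewrite gt_eqF.
  by lra.
split; apply: le_trans main; [apply: le_trans (Im_le_cmod _)|apply: le_trans (Re_le_cmod _)].
- rewrite !(ImD, ImN) -/z -/z'; case: (c * z) => p1 p2 /=.
  by rewrite le_eqVlt; apply/orP; left; apply/eqP; congr `|_|; ring.
- rewrite !(ReD, ReN) -/z -/z'; case: (c * z) => p1 p2 /=.
  by rewrite le_eqVlt; apply/orP; left; apply/eqP; congr `|_|; ring.
Qed.

(** Mean value property. In the coordinates z = exp (s + i t), two concentric circles are the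
    vertical sides of a rectangle whose horizontal sides agree by periodicity, so the integral does
    not depend on the radius, and small radii identify it. Only a limit at 0 is asked of H, so that
    a difference quotient at 0 is allowed. *)
Lemma sint_punctured_disk (H : R[i] -> R[i]) (L : R[i]) (r : R) :
  (forall z, 0 < cmod z < 1 -> exists c, cfirst_order H z c) ->
  (forall e : R, 0 < e -> exists2 d : R, 0 < d & forall z, 0 < cmod z < d -> cmod (H z - L) <= e) ->
  0 < r < 1 ->
  {within `[0, 0 + pi *+ 2], continuous (fun t : R => complex.Re (H (polar r t)))} /\
  sint (fun t => complex.Re (H (polar r t))) 0 (0 + pi *+ 2) = pi *+ 2 * complex.Re L.
Proof.
move=> dH H0 /andP[r0 r1].
set P := fun s t => complex.Im (H (polar (expR s) t)).
set Q := fun s t => complex.Re (H (polar (expR s) t)).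
have cl s t : s <= ln r -> closed_at P Q s t.
  move=> sr; have [c hc] : exists c, cfirst_order H (polar (expR s) t) c.
    apply: dH; rewrite cmod_polar ?expR_ge0// expR_gt0/=.
    by apply: le_lt_trans r1; rewrite -[leRHS](lnK r0) ler_expR.
  exact: cfirst_order_polar hc.
have cQ s : s <= ln r -> {within `[0, 0 + pi *+ 2], continuous (Q s)}.
  move=> sr; apply: within_pointwise => t _.
  by have [] := closed_at_continuous (cl s t sr).
have Qr : Q (ln r) = fun t => complex.Re (H (polar r t)).
  by apply/funext => t; rewrite /Q lnK.
rewrite -Qr; split; first exact: cQ.
have pi2 : 0 < (pi : R) *+ 2 by rewrite pmulrn_lgt0// pi_gt0.
apply/eqP; rewrite -subr_eq0 -normr_le0; apply/ler_addgt0Pl => e e0; rewrite addr0.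
have [d d0 hd] := H0 _ (divr_gt0 e0 pi2).
set r' := Num.min (r / 2) (d / 2).
have r'0 : 0 < r' by rewrite lt_min !divr_gt0.
have r'r : r' < r by apply: (@le_lt_trans _ _ (r / 2)); [rewrite ge_min lexx|lra].
have r'd : r' < d by apply: (@le_lt_trans _ _ (d / 2)); [rewrite ge_min lexx orbT|lra].
have w0 : 0 < ln r - ln r' by rewrite subr_gt0 ltr_ln.
have G : circulation P Q (ln r') (ln r - ln r') 0 (pi *+ 2) = 0.
  apply: goursat => //; move=> s t /andP[_ sr] _; apply: cl.
  by apply: le_trans sr _; rewrite addrC subrK.
move: G; rewrite /circulation.
have -> : (fun s => P s 0 - P s (0 + pi *+ 2)) = fun=> 0.
  by apply/funext => s; rewrite /P /polar add0r cos0 sin0 cos2pi sin2pi subrr.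
rewrite sint_cst; last by rewrite lerDl ltW.
rewrite mul0r add0r [ln r' + _]addrC subrK sintB; [|exact: cQ|by apply: cQ; rewrite ler_ln ?ltW].
move/eqP; rewrite subr_eq0 => /eqP ->.
have rr : ln r' <= ln r by rewrite ler_ln ?posrE// ltW.
have := @sint_near_cst R (Q (ln r')) 0 (0 + pi *+ 2) (complex.Re L) (e / (pi *+ 2)).
have -> : complex.Re L * (0 + pi *+ 2 - 0) = pi *+ 2 * complex.Re L by rewrite add0r subr0 mulrC.
have -> : e / (pi *+ 2) * (0 + pi *+ 2 - 0) = e by rewrite add0r subr0 divfK// gt_eqF.
apply; [by rewrite lerDl ltW|exact: cQ|].
move=> t _; rewrite /Q lnK// -ReN -ReD; apply: le_trans (Re_le_cmod _) _; apply: hd.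
by rewrite cmod_polar ?(ltW r'0)// r'0.
Qed.

(** The mean of Re f times the nonnegative kernel 1 - cos t over the circle of radius r is Re (f 0)
    - r / 2 Re f'(0); the claim is its nonnegativity as r tends to 1. *)
Lemma Schwarz_half_plane_Re (f : Cplane R -> Cplane R) :
  (forall z, unit_disk R z -> differentiable f z) ->
  (forall z, unit_disk R z -> 0 < complex.Re (f z)) ->
  complex.Re ('d f (0 : Cplane R) 1) <= 2 * complex.Re (f 0).
Proof.
move=> df fp.
have D0 : unit_disk R 0 by rewrite /unit_disk/= cmod0.
set c := 'd f (0 : Cplane R) 1; set f0 := f 0.
suff key r : 0 < r < 1 -> r * complex.Re c <= 2 * complex.Re f0.
  rewrite leNgt; apply/negP => h.
  have f00 : 0 < complex.Re f0 by exact: fp.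
  have c0 : 0 < complex.Re c by apply: lt_trans h; rewrite mulr_gt0.
  (* If the claim failed, the bound at the radius (q + 1) / 2, strictly between q and 1, would be
     violated. *)
  set q := 2 * complex.Re f0 / complex.Re c.
  have q1 : q < 1 by rewrite ltr_pdivrMr// mul1r.
  have q0 : 0 < q by rewrite divr_gt0// mulr_gt0.
  have q01 : 0 < (q + 1) / 2 < 1 by apply/andP; split; lra.
  by have := key _ q01; rewrite -ler_pdivlMr// -/q; lra.
move=> /andP[r0 r1].
(* On |z| = r one has z / (2 r) = exp (i t) / 2 and r / (2 z) = exp (- i t) / 2, so that Re H is Re
   f (1 - cos t) plus the trigonometric polynomial [g] below, of mean zero; the limit of H at 0 is f
   0 - r / 2 f'(0). *)
pose H (z : Cplane R) : Cplane R := f z * (1 - z * (2 * r)%:C^-1) - (r / 2)%:C * ((f z - f0) * z^-1).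
have dH (z : Cplane R) : 0 < cmod z < 1 -> exists k, cfirst_order H z k.
  move=> /andP[z0 z1]; exists ('d H (z : Cplane R) 1); apply: differentiable_cfirst_order.
  have dfz := df z z1.
  have zn : z != 0 by rewrite -cmod_gt0.
  have d1 : differentiable (fun z : Cplane R => (1 : Cplane R) - z * ((2 * r)%:C^-1 : Cplane R)) z.
    by apply: differentiableB => //; apply: differentiableM.
  have d2 : differentiable (fun z : Cplane R => (f z - f0) * (z^-1 : Cplane R)) z.
    by apply: differentiableM; [exact: differentiableB|exact: differentiableV].
  have d3 : differentiable (fun z : Cplane R => ((r / 2)%:C : Cplane R) * ((f z - f0) * (z^-1 : Cplane R))) z.
    exact: differentiableM.
  have d4 : differentiable (fun z : Cplane R => f z * ((1 : Cplane R) - z * ((2 * r)%:C^-1 : Cplane R))) z.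
    exact: differentiableM.
  exact: (differentiableB d4 d3).
have H0 e : 0 < e -> exists2 d : R, 0 < d & forall z, 0 < cmod z < d -> cmod (H z - (f0 - (r / 2)%:C * c)) <= e.
  move=> e0.
  have [d d0 hd] := differentiable_cfirst_order (df 0 D0) ltr01.
  have e2 : 0 < e / 2 by rewrite divr_gt0.
  have [d' d'0 hd'] := differentiable_cfirst_order (df 0 D0) e2.
  rewrite -/c -/f0 in hd hd'.
  set C := cmod c + 1; set F := cmod f0 + C.
  have C0 : 0 < C by rewrite ltr_wpDl ?cmod_ge0.
  have F0 : 0 < F by rewrite ltr_wpDl ?cmod_ge0.
  set K := C + F / (2 * r).
  have K0 : 0 < K by rewrite addr_gt0// divr_gt0// mulr_gt0.
  exists (Num.min (Num.min d d') (Num.min 1 (e / (2 * K)))).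
    by rewrite !lt_min d0 d'0 ltr01 divr_gt0// mulr_gt0.
  move=> z; rewrite !lt_min => /andP[z0 /andP[/andP[zd zd'] /andP[z1 ze]]].
  have zn : z != 0 by rewrite -cmod_gt0.
  have := hd z; rewrite subr0 => /(_ zd) p; have := hd' z; rewrite subr0 => /(_ zd') p'.
  have -> : H z - (f0 - (r / 2)%:C * c) =
      (f z - f0 - c * z) + c * z - f z * (z * (2 * r)%:C^-1) - (r / 2)%:C * ((f z - f0 - c * z) * z^-1).
    rewrite /H; move: ((2 * r)%:C^-1) ((r / 2)%:C) (f z) => k1 k2 k3.
    by field.
  have B1 : cmod (f z - f0 - c * z + c * z) <= C * cmod z.
    by apply: le_trans (cmodD _ _) _; rewrite cmodM /C mulrDl; lra.
  have Bf : cmod (f z) <= F.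
    rewrite -(subrK f0 (f z)) -(subrK (c * z) (f z - f0)); apply: le_trans (cmodD _ _) _.
    by rewrite /F addrC lerD2l; apply: le_trans B1 _; rewrite ger_pMr// ltW.
  have B2 : cmod (f z * (z * (2 * r)%:C^-1)) <= F / (2 * r) * cmod z.
    rewrite !cmodM cmodV cmod_real gtr0_norm ?mulr_gt0//.
    rewrite (_ : F / (2 * r) * cmod z = F * (cmod z / (2 * r))); last by rewrite mulrAC mulrA.
    by rewrite ler_wpM2r// divr_ge0 ?cmod_ge0// mulr_ge0// ltW.
  have B3 : cmod ((r / 2)%:C * ((f z - f0 - c * z) * z^-1)) <= e / 2.
    rewrite !cmodM cmodV cmod_real gtr0_norm ?divr_gt0//.
    have : cmod (f z - f0 - c * z) / cmod z <= e / 2 by rewrite ler_pdivrMr.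
    have : 0 <= cmod (f z - f0 - c * z) / cmod z by rewrite divr_ge0 ?cmod_ge0.
    by nra.
  have B4 : K * cmod z <= e / 2.
    have := ltW ze; rewrite ler_pdivlMr ?mulr_gt0//; lra.
  apply: le_trans (cmodD _ _) _; rewrite cmodN.
  apply: le_trans (lerD (cmodD _ _) (lexx _)) _; rewrite cmodN.
  by move: B4; rewrite /K mulrDl; lra.
have r01 : 0 < r < 1 by rewrite r0.
have [cH iH] := sint_punctured_disk dH H0 r01.
have pi2 : 0 < (pi : R) *+ 2 by rewrite pmulrn_lgt0// pi_gt0.
set a := complex.Re f0 in iH *; set b := complex.Im f0 in iH *.
pose g (t : R) := a / 2 * cos t + b / 2 * sin t.
have cg t : {for t, continuous g}.
  by apply: cvgD; apply: cvgMr; [exact: continuous_cos|exact: continuous_sin].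
have ig : sint g 0 (0 + pi *+ 2) = 0.
  pose G (t : R) := a / 2 * sin t - b / 2 * cos t.
  have dG (t : R) : is_derive t (1 : R) G (g t).
    by apply: is_derive_eq; rewrite /g /GRing.scale/=; ring.
  have p0 : 0 < 0 + (pi : R) *+ 2 by rewrite add0r.
  rewrite (sint_FTC p0 (fun t _ => cg t) (fun t _ => dG t)) /G add0r sin2pi cos2pi sin0 cos0; ring.
have := sintB cH (within_pointwise (fun t _ => cg t)).
rewrite iH ig subr0 => E.
have : 0 <= pi *+ 2 * complex.Re (f0 - (r / 2)%:C * c).
  rewrite -E; apply: sint_ge0 => t _.
  set z := polar r t.
  have zD : unit_disk R z by rewrite /unit_disk/= /z cmod_polar// ltW.
  have zi : z^-1 = (cos t / r) +i* (- sin t / r).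
    rewrite /z /polar; apply: (mulfI (x := z)).
      by rewrite -cmod_gt0 cmod_polar// ltW.
    rewrite mulfV; last by rewrite -cmod_gt0 cmod_polar// ltW.
    apply/eqP; rewrite eq_complex /= /z/=.
    have := cos2Dsin2 t => ct.
    by apply/andP; split; apply/eqP; [rewrite -[LHS]ct|]; field; rewrite gt_eqF.
  have Hz : H z = f z * (1 - (cos t / 2) +i* (sin t / 2)) - (f z - f0) * ((cos t / 2) +i* (- sin t / 2)).
    rewrite /H zi; congr (_ * (1 - _) - _).
      rewrite -fmorphV; apply/eqP; rewrite eq_complex /z/=.
      by apply/andP; split; apply/eqP; field; rewrite gt_eqF.
    rewrite mulrCA; congr (_ * _); apply/eqP; rewrite eq_complex/=.
    by apply/andP; split; apply/eqP; field; rewrite gt_eqF.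
  have -> : complex.Re (H z) - g t = complex.Re (f z) * (1 - cos t).
    rewrite Hz /g /a /b /f0; move: (f z) (f 0) => [u1 u2] [v1 v2] /=; by field.
  by rewrite mulr_ge0 ?(ltW (fp _ zD))// subr_ge0 cos_le1.
have ReZ (w : R[i]) : complex.Re ((r / 2)%:C * w) = r / 2 * complex.Re w.
  by case: w => w1 w2 /=; rewrite mul0r subr0.
rewrite pmulr_rge0// ReD ReN; have := ReZ c; rewrite -/a => ->; lra.
Qed.

Lemma cfirst_order_inj (H : R[i] -> R[i]) (z c c' : R[i]) :
  cfirst_order H z c -> cfirst_order H z c' -> c = c'.
Proof.
move=> h h'; apply/eqP; rewrite -subr_eq0 -cmod_eq0 eq_le cmod_ge0 andbT.
apply/ler_addgt0Pl => e e0; rewrite addr0.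
have e2 : 0 < e / 2 by rewrite divr_gt0.
have [d d0 hd] := h _ e2; have [d' d'0 hd'] := h' _ e2.
set m := Num.min d d' / 2.
have m0 : 0 < m by rewrite divr_gt0// lt_min d0.
have md : m < Num.min d d' by rewrite /m ltr_pdivrMr// ltr_pMr ?lt_min ?d0// ltr1n.
have mC : cmod (z + m%:C - z) = m by rewrite addrC addKr cmod_real gtr0_norm.
move: md; rewrite lt_min => /andP[md md'].
have := hd (z + m%:C); rewrite mC => /(_ md) p.
have := hd' (z + m%:C); rewrite mC => /(_ md') p'.
rewrite -(ler_pM2r m0) -{1}mC -cmodM.
have -> : (c - c') * (z + m%:C - z) = (H (z + m%:C) - H z - c' * (z + m%:C - z)) -
    (H (z + m%:C) - H z - c * (z + m%:C - z)) by ring.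
apply: le_trans (cmodD _ _) _; rewrite cmodN; lra.
Qed.

Lemma Schwarz_half_plane (f : Cplane R -> Cplane R) :
  (forall z, unit_disk R z -> differentiable f z) ->
  (forall z, unit_disk R z -> 0 < complex.Re (f z)) ->
  cmod ('d f (0 : Cplane R) 1) <= 2 * complex.Re (f 0).
Proof.
move=> df fp.
have D0 : unit_disk R 0 by rewrite /unit_disk/= cmod0.
set c := 'd f (0 : Cplane R) 1.
have [->|c0] := eqVneq c 0; first by rewrite cmod0 mulr_ge0// ltW// fp.
(* A rotation of the disc makes the derivative at 0 equal to its modulus. *)
pose u : Cplane R := (cmod c)%:C / c.
have u1 : cmod u = 1 by rewrite cmodM cmodV cmod_real ger0_norm ?cmod_ge0// divff// cmod_eq0.
pose g (z : Cplane R) : Cplane R := f (u * z).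
have uD z : unit_disk R z -> unit_disk R (u * z) by rewrite /unit_disk/= cmodM u1 mul1r.
have dg z : unit_disk R z -> differentiable g z.
  move=> zD; have d1 : differentiable (fun z : Cplane R => (u : Cplane R) * z) z.
    exact: differentiableM.
  exact: (differentiable_comp d1 (df _ (uD z zD))).
have := Schwarz_half_plane_Re dg (fun z zD => fp _ (uD z zD)).
have g0 : g 0 = f 0 by rewrite /g mulr0.
suff -> : 'd g (0 : Cplane R) 1 = u * c by rewrite g0 divfK.
apply: (cfirst_order_inj (differentiable_cfirst_order (dg 0 D0))) => e e0.
have [d d0 hd] := differentiable_cfirst_order (df 0 D0) e0.
exists d => // w wd; have := hd (u * w).
by rewrite g0 !subr0 cmodM u1 mul1r /g -/c mulrCA mulrA; apply; rewrite -[w]subr0.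
Qed.

End MeanValue.

(** * The Kobayashi metric and affine functionals *)

Section KobayashiMetric.
Variable R : realType.
Variable d : nat.
Implicit Types (x y v a : Cvec R d).

(** Bilinear, without conjugation: this is complex linear in y, so its composition with a
    holomorphic disc is holomorphic. *)
Definition cdot (y a : Cvec R d) : Cplane R := \sum_j y 0 j * a 0 j.

Lemma cdotD y z a : cdot (y + z) a = cdot y a + cdot z a.
Proof. by rewrite /cdot -big_split/=; apply: eq_bigr => j _; rewrite mxE mulrDl. Qed.

Lemma cdotZ (k : Cplane R) y a : cdot (k *: y) a = k * cdot y a.
Proof. by rewrite /cdot mulr_sumr; apply: eq_bigr => j _; rewrite mxE -mulrA. Qed.

Lemma cdotN y a : cdot (- y) a = - cdot y a.
Proof. by rewrite -scaleN1r cdotZ mulN1r. Qed.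

Lemma cdotB y z a : cdot (y - z) a = cdot y a - cdot z a.
Proof. by rewrite cdotD cdotN. Qed.

Lemma differentiable_big_sum (V W : normedModType R[i]) (I : Type) (s : seq I) (F : I -> V -> W) (x : V) :
  (forall i, differentiable (F i) x) -> differentiable (fun z => \sum_(i <- s) F i z) x.
Proof.
move=> dF; elim: s => [|i s IH].
  by rewrite (_ : (fun z => _) = cst 0); [exact: differentiable_cst|apply/funext => z; rewrite big_nil].
rewrite (_ : (fun z => _) = F i \+ (fun z => \sum_(i <- s) F i z)); last first.
  by apply/funext => z; rewrite big_cons.
exact: differentiableD.
Qed.

Lemma differentiable_cdot (f : Cplane R -> Cvec R d) a (p : Cvec R d) (z : Cplane R) : differentiable f z ->
  differentiable (fun z => cdot (f z - p) a) z.
Proof.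
move=> df; have dj j : differentiable (fun z => (f z 0 j : Cplane R)) z.
  exact: (differentiable_comp df (differentiable_coord (f z) 0 j)).
rewrite (_ : (fun z => _) = (fun z => cdot (f z) a) \- cst (cdot p a)); last first.
  by apply/funext => w /=; rewrite cdotB.
apply: differentiableB => //; apply: differentiable_big_sum => j.
exact: differentiableM.
Qed.

Lemma mx_norm_coord (y : Cvec R d) (j : 'I_d) : `|y 0 j| <= `|y|.
Proof.
rewrite [leRHS]/Num.Def.normr/= mx_normE [leLHS](_ : _ = (`|y 0 j|%:nng)%:num)// num_le.
by apply/bigmax_geP; right; exists (0, j).
Qed.

Lemma cfirst_order_coord (f : Cplane R -> Cvec R d) (z : Cplane R) (j : 'I_d) :
  differentiable f z -> cfirst_order (fun w => f w 0 j) z ('d f z 1 0 j).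
Proof.
move=> dH e e0.
have dv : derivable f z 1 by apply/derivable1_diffP.
have : (fun h => h^-1 *: ((f \o shift z) (h *: (1 : Cplane R)) - f z)) @ (0 : Cplane R)^' --> 'd f z 1.
  by rewrite -deriveE//; exact: dv.
have ec0 : 0 < e%:C by rewrite ltcR.
move/cvgrPdist_le => /(_ _ ec0); rewrite near_withinE => /(@nbhs_ballP _ (Cplane R))[d' /= d0 hd].
have [k dp dE] := posC_real d0.
exists k => // w wd.
set c := 'd f z 1 in hd *.
have [->|nx] := eqVneq w z; first by rewrite !subrr mulr0 subrr cmod0 mulr0.
have := hd (w - z); rewrite -ball_normE/= sub0r normrN normC_cmod dE ltcR => /(_ wd).
rewrite subr_eq0 => /(_ nx); rewrite /= [_%:A](mulr1) subrK => h.
have h0 : 0 < cmod (w - z) by rewrite cmod_gt0 subr_eq0.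
rewrite -ler_pdivrMr// -lecR.
apply: le_trans h; apply: le_trans (mx_norm_coord _ j).
rewrite !mxE normC_cmod lecR le_eqVlt; apply/orP; left; apply/eqP.
rewrite -cmodV -cmodM -cmodN; congr cmod; field.
by rewrite subr_eq0.
Qed.

Lemma cfirst_order_sum (I : Type) (s : seq I) (F : I -> R[i] -> R[i]) (z : R[i]) (c : I -> R[i]) (k : I -> R[i]) :
  (forall i, cfirst_order (F i) z (c i)) ->
  cfirst_order (fun w => \sum_(i <- s) F i w * k i) z (\sum_(i <- s) c i * k i).
Proof.
move=> hF; elim: s => [|i s IH] e e0.
  by exists 1 => // w _; rewrite !big_nil mul0r !subrr cmod0 mulr_ge0 ?cmod_ge0// ltW.
have K0 : 0 < 2 * (cmod (k i) + 1) by rewrite mulr_gt0// ltr_wpDl// cmod_ge0.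
have [d1 d10 h1] := hF i _ (divr_gt0 e0 K0).
have e2 : 0 < e / 2 by rewrite divr_gt0.
have [d2 d20 h2] := IH _ e2.
exists (Num.min d1 d2); first by rewrite lt_min d10.
move=> w; rewrite lt_min => /andP[w1 w2]; rewrite !big_cons.
set S := \sum_(j <- s) F j w * k j in h2 *; set T := \sum_(j <- s) _ in h2 *.
set U := \sum_(j <- s) _ in h2 *.
have -> : F i w * k i + \sum_(j <- s) F j w * k j - (F i z * k i + T) - (c i * k i + U) * (w - z) =
  (F i w - F i z - c i * (w - z)) * k i + (\sum_(j <- s) F j w * k j - T - U * (w - z)) by ring.
apply: le_trans (cmodD _ _) _; apply: le_trans (lerD (lexx _) (h2 w w2)) _.
rewrite cmodM; apply: le_trans (lerD (ler_wpM2r (cmod_ge0 _) (h1 w w1)) (lexx _)) _.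
have : e / (2 * (cmod (k i) + 1)) * cmod (w - z) * cmod (k i) <= e / 2 * cmod (w - z).
  rewrite mulrAC ler_wpM2r ?cmod_ge0// -mulrA ler_pM2l// ler_pdivrMl//.
  by have := cmod_ge0 (k i); lra.
lra.
Qed.

(** The inner product of R^(2d), with norm [enorm]; separation of convex sets takes place there. *)
Definition ipr (y z : Cvec R d) : R :=
  \sum_j (complex.Re (y 0 j) * complex.Re (z 0 j) + complex.Im (y 0 j) * complex.Im (z 0 j)).

Lemma iprC y z : ipr y z = ipr z y.
Proof. by apply: eq_bigr => j _; rewrite mulrC [X in _ + X]mulrC. Qed.

Lemma iprDl y y' z : ipr (y + y') z = ipr y z + ipr y' z.
Proof. by rewrite /ipr -big_split; apply: eq_bigr => j _; rewrite mxE ReD ImD/=; ring. Qed.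

Lemma iprZl (k : R) y z : ipr (k%:C *: y) z = k * ipr y z.
Proof.
rewrite /ipr mulr_sumr; apply: eq_bigr => j _; rewrite mxE.
by case: (y 0 j) => p q /=; ring.
Qed.

Lemma iprNl y z : ipr (- y) z = - ipr y z.
Proof.
rewrite /ipr -sumrN; apply: eq_bigr => j _; rewrite mxE.
by case: (y 0 j) => p q /=; ring.
Qed.

Lemma iprDr y y' z : ipr z (y + y') = ipr z y + ipr z y'.
Proof. by rewrite iprC iprDl iprC [X in _ + X]iprC. Qed.

Lemma iprZr (k : R) y z : ipr z (k%:C *: y) = k * ipr z y.
Proof. by rewrite iprC iprZl iprC. Qed.

Lemma iprNr y z : ipr z (- y) = - ipr z y.
Proof. by rewrite iprC iprNl iprC. Qed.

Lemma ipr_enorm y : ipr y y = enorm y ^+ 2.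
Proof.
rewrite /enorm sqr_sqrtr; last by apply: sumr_ge0 => j _; exact: sqr_ge0.
by apply: eq_bigr => j _; rewrite cmod_sq -!expr2.
Qed.

Lemma enorm_ge0 y : 0 <= enorm y.
Proof. exact: sqrtr_ge0. Qed.

Lemma ipr_le y z : ipr y z <= enorm y * enorm z.
Proof.
have [E|E] := eqVneq (enorm y) 0.
  suff -> : y = 0 by rewrite /ipr big1 ?mulr_ge0 ?enorm_ge0// => j _; rewrite mxE/= !mul0r addr0.
  apply/rowP => j; rewrite mxE; apply/eqP; rewrite -cmod_eq0 -sqrf_eq0.
  move: E => /eqP; rewrite /enorm sqrtr_eq0 => h.
  have : \sum_j cmod (y 0 j) ^+ 2 == 0 by rewrite eq_le h sumr_ge0// => k _; exact: sqr_ge0.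
  rewrite psumr_eq0 => [/allP/(_ j)/[!mem_index_enum]/(_ isT)//|k _]; exact: sqr_ge0.
have A0 : 0 < enorm y by rewrite lt_def E enorm_ge0.
have : 0 <= enorm (z - (ipr y z / enorm y ^+ 2)%:C *: y) ^+ 2 by exact: sqr_ge0.
rewrite -ipr_enorm !(iprDl, iprDr, iprNl, iprNr, iprZl, iprZr) !ipr_enorm [ipr z y]iprC.
move=> h; have {h} : 0 <= enorm z ^+ 2 - ipr y z ^+ 2 / enorm y ^+ 2.
  by apply: le_trans h _; rewrite le_eqVlt; apply/orP; left; apply/eqP; field.
rewrite subr_ge0 ler_pdivrMr ?exprn_gt0// -exprMn => h.
have [i0|i0] := leP (ipr y z) 0; first by apply: le_trans i0 _; rewrite mulr_ge0 ?enorm_ge0.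
by rewrite mulrC -(ler_pXn2r (ltn0Sn 1)) ?nnegrE ?mulr_ge0 ?enorm_ge0// ltW.
Qed.

Lemma enormD y z : enorm (y + z) <= enorm y + enorm z.
Proof.
rewrite -(ler_pXn2r (ltn0Sn 1)) ?nnegrE ?addr_ge0 ?enorm_ge0//.
rewrite -ipr_enorm !(iprDl, iprDr) !ipr_enorm [ipr z y]iprC.
by have := ipr_le y z; lra.
Qed.

Lemma enormZ (k : R[i]) y : enorm (k *: y) = cmod k * enorm y.
Proof.
rewrite /enorm -[cmod k]ger0_norm ?cmod_ge0// -sqrtr_sqr -sqrtrM ?sqr_ge0//.
by congr Num.sqrt; rewrite mulr_sumr; apply: eq_bigr => j _; rewrite mxE cmodM exprMn.
Qed.

Lemma enormN y : enorm (- y) = enorm y.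
Proof. by rewrite -scaleN1r enormZ cmodN cmod1 mul1r. Qed.

Lemma enormB y z : enorm (y - z) = enorm (z - y).
Proof. by rewrite -enormN opprB. Qed.

Lemma enorm0 : enorm (0 : Cvec R d) = 0.
Proof. by rewrite -[0](scale0r 0) enormZ cmod0 mul0r. Qed.

Lemma enorm_eq0 y : (enorm y == 0) = (y == 0).
Proof.
apply/eqP/eqP => [E|->]; last exact: enorm0.
apply/rowP => j; rewrite mxE; apply/eqP; rewrite -cmod_eq0 -sqrf_eq0.
move: E => /eqP; rewrite /enorm sqrtr_eq0 => h.
have : \sum_j cmod (y 0 j) ^+ 2 == 0 by rewrite eq_le h sumr_ge0// => k _; exact: sqr_ge0.
rewrite psumr_eq0 => [/allP/(_ j)/[!mem_index_enum]/(_ isT)//|k _]; exact: sqr_ge0.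
Qed.

Lemma coord_le_enorm y j : cmod (y 0 j) <= enorm y.
Proof.
rewrite -(ler_pXn2r (ltn0Sn 1)) ?nnegrE ?cmod_ge0 ?enorm_ge0//.
rewrite /enorm sqr_sqrtr; last by apply: sumr_ge0 => k _; exact: sqr_ge0.
by rewrite (bigD1 j)//= lerDl sumr_ge0// => k _; exact: sqr_ge0.
Qed.

Lemma mx_norm_le_enorm y : `|y| <= (enorm y)%:C.
Proof.
rewrite [leLHS]/Num.Def.normr/=.
have [->|/mx_norm_neq0[[i j] ->]/=] := eqVneq (mx_norm y) 0; first by rewrite lecR enorm_ge0.
by rewrite (ord1 i) normC_cmod lecR coord_le_enorm.
Qed.

Lemma enorm_le_mx_norm y (e : R) : `|y| <= e%:C -> enorm y <= d%:R * e.
Proof.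
move=> ye; have e0 : 0 <= e by rewrite -lecR; apply: le_trans ye.
rewrite -(ler_pXn2r (ltn0Sn 1)) ?nnegrE ?mulr_ge0 ?enorm_ge0//.
rewrite /enorm sqr_sqrtr; last by apply: sumr_ge0 => k _; exact: sqr_ge0.
have : \sum_j cmod (y 0 j) ^+ 2 <= \sum_(j < d) e ^+ 2.
  apply: ler_sum => j _; rewrite ler_pXn2r ?nnegrE ?cmod_ge0//.
  by rewrite -lecR -normC_cmod; apply: le_trans (mx_norm_coord _ _) ye.
rewrite sumr_const card_ord -[e ^+ 2 *+ d]mulr_natl => /le_trans; apply; rewrite exprMn.
apply: ler_wpM2r; first exact: sqr_ge0.
by rewrite -natrX ler_nat; case: (d) => [//|n]; rewrite leq_pmulr.
Qed.

(** The topology is that of the sup norm; from here on it is only handled through Euclidean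
    balls. *)
Lemma open_enormP (A : set (Cvec R d)) :
  open A <-> forall x, A x -> exists2 e : R, 0 < e & forall y, enorm (y - x) < e -> A y.
Proof.
split=> [oA x Ax|h].
  have : nbhs x A by exact: open_nbhs_nbhs.
  move=> /(@nbhs_ballP _ (Cvec R d))[e' /= e0 he].
  have [e ep eE] := posC_real e0; exists e => // y ye; apply: he.
  by rewrite -ball_normE/= distrC eE; apply: le_lt_trans (mx_norm_le_enorm _) _; rewrite ltcR.
rewrite openE => x /h[e e0 he]; apply/(@nbhs_ballP _ (Cvec R d)).
have K0 : 0 < e / (d%:R + 1) by rewrite divr_gt0// ltr_wpDl.
exists (e / (d%:R + 1))%:C => /=; first by rewrite ltcR.
move=> y; rewrite -ball_normE/= distrC => yx; apply: he.
apply: le_lt_trans (enorm_le_mx_norm (ltW yx)) _.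
by rewrite mulrCA gtr_pMr// ltr_pdivrMr ?ltr_wpDl// mul1r ltrDl.
Qed.

Lemma diff_cfirst_order (H : Cplane R -> Cplane R) (z c xi : Cplane R) :
  differentiable H z -> cfirst_order H z c -> 'd H z xi = xi * c.
Proof.
move=> dH Hc; rewrite -(cfirst_order_inj (differentiable_cfirst_order dH) Hc).
have E : xi *: (1 : Cplane R) = xi by rewrite -[RHS]mulr1.
by rewrite -[X in 'd H z X]E linearZ.
Qed.

Variable Om : set (Cvec R d).

Definition disks_through x v : set R := [set s : R | exists (f : Cplane R -> Cvec R d) (xi : Cplane R),
    [/\ forall z, unit_disk R z -> differentiable f z,
        forall z, unit_disk R z -> Om (f z),
        f 0 = x,
        'd f (0 : Cplane R) xi = v
      & s = cmod xi] ].

(** Both the affine discs and the Moebius discs with two directions have this form. *)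
Lemma affine_disk x (P : Cplane R -> Cplane R) (Q : Cplane R -> Cplane R) (w w' : Cvec R d) (z xi : Cplane R) :
  differentiable P z -> differentiable Q z ->
  differentiable (fun z => x + P z *: w + Q z *: w') z /\
  'd (fun z => x + P z *: w + Q z *: w') z xi = 'd P z xi *: w + 'd Q z xi *: w'.
Proof.
move=> dP dQ.
have d1 := @differentiableZl _ _ (Cvec R d) P w z dP.
have d2 := @differentiableZl _ _ (Cvec R d) Q w' z dQ.
have d3 := differentiableD (differentiable_cst x z) d1.
split; first exact: (differentiableD d3 d2).
have E1 : 'd (fun z => P z *: w) z xi = 'd P z xi *: w by rewrite (diffZl w dP).
have E2 : 'd (fun z => Q z *: w') z xi = 'd Q z xi *: w' by rewrite (diffZl w' dQ).
have E3 := congr1 (fun f => f xi) (diffD (differentiable_cst x z) d1).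
have E4 := congr1 (fun f => f xi) (diffD d3 d2).
have E5 : 'd (cst x : Cplane R -> Cvec R d) z xi = 0 by rewrite diff_cst.
exact: (etrans E4 (f_equal2 +%R (etrans E3 (etrans (f_equal2 +%R E5 E1) (add0r _))) E2)).
Qed.

Lemma affine_disk_through x v (e K : R) : 0 < K -> 0 < e -> enorm v <= K * e ->
  (forall w, enorm w < e -> Om (x + w)) -> disks_through x v K.
Proof.
move=> K0 e0 vK he.
pose P : Cplane R -> Cplane R := *:%R (K^-1)%:C.
have dP z : differentiable P z by exact: ex_diff.
have dQ z : differentiable (cst 0 : Cplane R -> Cplane R) z by [].
exists (fun z => x + P z *: v + (cst 0 : Cplane R -> Cplane R) z *: 0), K%:C; split.
- by move=> z _; have [] := affine_disk x v 0 0 (dP z) (dQ z).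
- move=> z zD; rewrite /= scaler0 addr0; apply: he; rewrite enormZ cmodM cmod_real.
  rewrite gtr0_norm ?invr_gt0// -mulrA ltr_pdivrMl//.
  have [->|v0] := eqVneq (enorm v) 0.
    by rewrite mulr0 mulr_gt0.
  apply: lt_le_trans vK; rewrite gtr_pMl//.
  by rewrite lt_def v0 enorm_ge0.
- by rewrite /= /P !scaler0 scale0r !addr0.
- have [_ E] := affine_disk x v 0 K%:C (dP 0) (dQ 0); apply: (etrans E).
  rewrite -[RHS]addr0; congr (_ + _); last exact: scaler0.
  rewrite -[RHS]scale1r; congr (_ *: _).
  rewrite (@diff_cfirst_order P 0 (K^-1)%:C K%:C (dP 0)).
    by rewrite -rmorphM/= divff// gt_eqF.
  move=> e1 e10; exists 1 => // w _; rewrite /P scaler0 !subr0 subrr cmod0.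
  by rewrite mulr_ge0 ?cmod_ge0// ltW.
- by rewrite cmod_real gtr0_norm.
Qed.

Lemma disks_through_neq0 x v : open Om -> Om x -> disks_through x v !=set0.
Proof.
move=> /open_enormP oOm /oOm[e e0 he].
have v1 : 0 < enorm v + 1 by rewrite ltr_wpDl// enorm_ge0.
exists ((enorm v + 1) / e); apply: (@affine_disk_through _ _ e).
- by rewrite divr_gt0.
- exact: e0.
- by rewrite divfK ?gt_eqF// lerDl.
- by move=> w we; apply: he; rewrite addrC addKr.
Qed.

Lemma disks_through_ge0 x v : lbound (disks_through x v) 0.
Proof. by move=> _ [f [xi [_ _ _ _ ->]]]; exact: cmod_ge0. Qed.

Lemma kobayashi_metric_ge0 x v : 0 <= kobayashi_metric Om x v.
Proof.
have [ne|ne] := pselect (disks_through x v !=set0).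
  by apply: lb_le_inf => //; exact: disks_through_ge0.
(* Without any disc the infimum has the default value 0. *)
by rewrite /kobayashi_metric inf_out// => -[].
Qed.

Lemma kobayashi_metric_le x v (f : Cplane R -> Cvec R d) (xi : Cplane R) :
  (forall z, unit_disk R z -> differentiable f z) ->
  (forall z, unit_disk R z -> Om (f z)) -> f 0 = x -> 'd f (0 : Cplane R) xi = v ->
  kobayashi_metric Om x v <= cmod xi.
Proof.
move=> df fOm f0 fv; apply: ge_inf; last by exists f, xi.
by exists 0; exact: disks_through_ge0.
Qed.

Lemma kobayashi_metric_le_ball x v (e K : R) : 0 < K -> 0 < e -> enorm v <= K * e ->
  (forall w, enorm w < e -> Om (x + w)) -> kobayashi_metric Om x v <= K.
Proof.
move=> K0 e0 vK he; apply: ge_inf; last exact: (affine_disk_through K0 e0 vK he).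
by exists 0; exact: disks_through_ge0.
Qed.

(** Composed with the functional, a disc through x becomes a holomorphic map to the right
    half-plane, whose derivative at 0 the Schwarz lemma bounds. *)
Lemma kobayashi_metric_ge x v a p : open Om -> Om x ->
  (forall y, Om y -> 0 < complex.Re (cdot (y - p) a)) ->
  cmod (cdot v a) <= 2 * complex.Re (cdot (x - p) a) * kobayashi_metric Om x v.
Proof.
move=> oOm xOm pos.
rewrite -ler_pdivrMl; last by rewrite mulr_gt0// pos.
apply: lb_le_inf; first exact: disks_through_neq0.
move=> _ [f [xi [df fOm f0 dfv ->]]].
have D0 : unit_disk R 0 by rewrite /unit_disk/= cmod0.
rewrite ler_pdivrMl; last by rewrite mulr_gt0// pos.
pose g (z : Cplane R) := cdot (f z - p) a.
have dg z : unit_disk R z -> differentiable g z by move=> zD; exact/differentiable_cdot/df.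
have := Schwarz_half_plane dg (fun z zD => pos _ (fOm z zD)).
rewrite {2}/g f0 => h.
rewrite -dfv.
have -> : 'd f (0 : Cplane R) xi = xi *: 'd f (0 : Cplane R) 1 by rewrite -linearZ/= [_%:A](mulr1).
rewrite cdotZ cmodM [leLHS]mulrC; apply: le_trans (ler_wpM2r (cmod_ge0 xi) h).
rewrite ler_wpM2r ?cmod_ge0// le_eqVlt; apply/orP; left; apply/eqP; congr cmod.
apply: (@cfirst_order_inj _ g 0); last exact: (differentiable_cfirst_order (dg 0 D0)).
have := cfirst_order_sum (index_enum 'I_d) (fun j => a 0 j) (fun j => cfirst_order_coord j (df 0 D0)).
move=> H e e0; have [k k0 hk] := H e e0; exists k => // w wk.
apply: le_trans (hk w wk); rewrite le_eqVlt; apply/orP; left; apply/eqP; congr cmod.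
by rewrite /g !cdotB /cdot; ring.
Qed.

End KobayashiMetric.

(** * Absolutely continuous functions *)

Section OrderedFamilies.
Variable R : realType.
Implicit Types (l : seq (R * R)) (u : R -> R).

(** Ordered lists of non-overlapping intervals, unlike families indexed by ['I_n], can be
    concatenated and refined by partitions; absolute continuity is recast for them in [acl]. *)
Definition ofam l := all (fun p => p.1 <= p.2) l && pairwise (fun p q => p.2 <= q.1) l.
Definition flen l : R := \sum_(p <- l) (p.2 - p.1).
Definition fvar u l : R := \sum_(p <- l) `|u p.2 - u p.1|.

Definition acl u := forall e : R, 0 < e -> exists2 d : R, 0 < d &
  forall l, ofam l -> flen l < d -> fvar u l < e.

Lemma itv_partition_zip (s t : R) p : itv_partition s t p ->
  [/\ ofam (zip (s :: p) p), flen (zip (s :: p) p) = t - s &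
   all (fun q => (s <= q.1) && (q.2 <= t)) (zip (s :: p) p)].
Proof.
elim: p s => [|x p IH] s; first by move=> /itv_partition_nil ->; rewrite /flen/= big_nil subrr.
move=> /[dup] h /itv_partition_cons /[dup] h' /IH[].
rewrite /ofam => /andP[ o1 o2] o3 o4.
have sx : s <= x by case: h => /= /andP[/ltW].
have xt : x <= t by exact: (itv_partition_le h').
rewrite [zip _ _]/=; split.
- by rewrite /= sx o1 o2 /= andbT; apply/allP => q /(allP o4) /andP[].
- by rewrite /flen big_cons/= [X in _ + X]o3; ring.
- rewrite /= lexx xt/=; apply/allP => q /(allP o4) /andP[q1 ->].
  by rewrite (le_trans sx q1).
Qed.

Lemma variation_zip_fvar u (s t : R) p : itv_partition s t p ->
  variation s t u p = fvar u (zip (s :: p) p).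
Proof.
move=> h; rewrite (variation_zip u h) /fvar.
have -> : zip p (s :: p) = [seq (q.2, q.1) | q <- zip (s :: p) p].
  move: (s :: p) => p'; elim: p p' {h} => [[]//|x p IH] [|y p']//=; by rewrite IH.
by rewrite big_map.
Qed.

End OrderedFamilies.

Section TotalVariation.
Variable R : realType.
Variables (a b : R) (u : R -> R).
Hypothesis ab : a < b.
Hypothesis uac : acl u.

Let TV s t := total_variation s t u.

(** Intervals shorter than the delta for epsilon 1 have variation at most 1, and finitely many steps
    of length d / 2 exhaust [s, t]. *)
Lemma acl_bounded_variation s t : s <= t -> (TV s t < +oo)%E.
Proof.
move=> st; have [d d0 hd] := uac ltr01.
have small x y : x <= y -> y - x < d -> (TV x y <= 1%:E)%E.
  move=> xy yxd; apply: ge_ereal_sup => _ [_ [p hp <-] <-].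
  have [p1 p2 _] := itv_partition_zip hp.
  by rewrite lee_fin (variation_zip_fvar u hp) ltW// hd// p2.
have d2 : 0 < d / 2 by rewrite divr_gt0.
have many n x y : x <= y -> y - x <= n%:R * (d / 2) -> (TV x y < +oo)%E.
  elim: n x y => [|n IH] x y xy.
    rewrite mul0r => h; apply: le_lt_trans (small x y xy _) (ltry _); lra.
  move=> h; have [yd|yd] := ltP (y - x) d; first exact: le_lt_trans (small x y xy yd) (ltry _).
  have x1 : x <= x + d / 2 by lra.
  have x2 : x + d / 2 <= y by lra.
  rewrite /TV (total_variationD u x1 x2) lte_add_pinfty//.
    apply: le_lt_trans (small _ _ x1 _) (ltry _); lra.
  by apply: IH => //; move: h; rewrite -natr1; lra.
apply: (many (Num.bound ((t - s) / (d / 2)))) => //.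
have k0 : 0 <= (t - s) / (d / 2) by rewrite divr_ge0// ?subr_ge0// ltW.
by rewrite -ler_pdivrMr//; exact/ltW/archi_boundP.
Qed.

(** Retraction of the line onto [a, b]. Functions are extended by their end values, so that measures
    and densities live on the whole line. *)
Definition clamp (t : R) : R := Num.max a (Num.min t b).

Lemma clamp_itv t : a <= clamp t <= b.
Proof. by rewrite /clamp le_max lexx/= ge_max (ltW ab) ge_min lexx orbT. Qed.

Lemma clampK t : a <= t <= b -> clamp t = t.
Proof. by move=> /andP[at_ tb]; rewrite /clamp min_l// max_r. Qed.

Lemma le_clamp s t : s <= t -> clamp s <= clamp t.
Proof.
move=> st; rewrite /clamp /Num.max /Num.min.
by do ! case: ifPn; rewrite -?leNgt; lra.
Qed.

Lemma clamp_le s t : s <= t -> clamp t - clamp s <= t - s.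
Proof.
move=> st; rewrite /clamp /Num.max /Num.min.
by do ! case: ifPn; rewrite -?leNgt; lra.
Qed.

Lemma clamp_inside s t : clamp s < clamp t -> s <= clamp s /\ clamp t <= t.
Proof.
rewrite /clamp /Num.max /Num.min.
by do ! case: ifPn; rewrite -?leNgt; lra.
Qed.

Definition tvar (t : R) : R := fine (TV a (clamp t)).

Lemma tvarB s t : s <= t -> (tvar t - tvar s)%:E = TV (clamp s) (clamp t).
Proof.
move=> st; have /andP[as_ _] := clamp_itv s; have /andP[at_ _] := clamp_itv t.
have sct := le_clamp st.
have f1 : TV a (clamp s) \is a fin_num.
  by rewrite ge0_fin_numE ?acl_bounded_variation ?total_variation_ge0.
have f2 : TV (clamp s) (clamp t) \is a fin_num.
  by rewrite ge0_fin_numE ?acl_bounded_variation ?total_variation_ge0.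
rewrite /tvar {1}/TV (total_variationD u as_ sct) fineD// addrAC subrr add0r fineK//.
Qed.

Lemma tvar_nd : {homo tvar : s t / s <= t}.
Proof.
move=> s t st; rewrite -subr_ge0 -lee_fin tvarB// total_variation_ge0//.
exact: le_clamp.
Qed.

Lemma tvar_ge s t : s <= t -> `|u (clamp t) - u (clamp s)| <= tvar t - tvar s.
Proof.
move=> st; rewrite -lee_fin tvarB//; apply: total_variation_ge; exact: le_clamp.
Qed.

(** Each interval is replaced by a partition of its part in [a, b] whose variation is within e of
    the supremum; intervals meeting [a, b] in at most a point are dropped. The last clause, that a
    new interval lies in an old one, carries the ordering through the induction. *)
Lemma tvar_refine (e : R) l : 0 < e -> ofam l -> exists l', [/\ ofam l', flen l' <= flen l,
   \sum_(p <- l) (tvar p.2 - tvar p.1) <= fvar u l' + (size l)%:R * e &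
   forall q, q \in l' -> exists2 p, p \in l & (p.1 <= q.1) && (q.2 <= p.2)].
Proof.
move=> e0; elim: l => [_|[s t] l IH].
  by exists [::]; rewrite /ofam /flen /fvar !big_nil mul0r addr0.
rewrite /ofam/= => /andP[/andP[st al] /andP[sl pl]].
have [|l' [ o1 o2 o3 o4]] := IH; first by rewrite /ofam al.
have [cst|cst] := leP (clamp t) (clamp s).
  exists l'; split => //.
  - by rewrite /flen big_cons/=; move: o2; rewrite /flen; lra.
  - rewrite big_cons/= -natr1 mulrDl mul1r.
    have -> : tvar t = tvar s by rewrite /tvar (@le_anti _ _ (clamp t) (clamp s))// cst le_clamp.
    by lra.
  - by move=> q /o4[p pin pq]; exists p => //; rewrite inE pin orbT.
have : ((tvar t - tvar s - e)%:E < TV (clamp s) (clamp t))%E.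
  by rewrite -tvarB// lte_fin; lra.
move=> /ereal_sup_gt[_ [_ [p hp <-] <-]]; rewrite lte_fin => hpe.
have [z1 z2 z3] := itv_partition_zip hp.
have [c1 c2] := clamp_inside cst.
set z := zip _ _ in z1 z2 z3.
exists (z ++ l'); split.
- move: z1 o1; rewrite /ofam => /andP[z11 z12] /andP[ o11 o12].
  rewrite all_cat z11 o11 pairwise_cat z12 o12 /= andbT.
  apply/allrelP => q q' /(allP z3)/andP[_ qt] /o4[p' p'in /andP[pq' _]].
  by have := allP sl _ p'in => /= tp; rewrite (le_trans qt)// (le_trans c2)// (le_trans tp).
- rewrite /flen big_cat big_cons/= lerD//.
  by move: z2; rewrite /flen => ->; exact: clamp_le.
- rewrite big_cons /fvar big_cat/= -natr1 mulrDl mul1r.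
  move: hpe o3; rewrite (variation_zip_fvar u hp) -/z /fvar; lra.
- move=> q; rewrite mem_cat => /orP[/(allP z3)/andP[q1 q2]|/o4[p' pin pq]].
    by exists (s, t); rewrite ?mem_head//= (le_trans c1 q1) (le_trans q2 c2).
  by exists p' => //; rewrite inE pin orbT.
Qed.

Lemma tvar_ac (e : R) : 0 < e -> exists2 d : R, 0 < d &
  forall l, ofam l -> flen l < d -> \sum_(p <- l) (tvar p.2 - tvar p.1) <= e.
Proof.
move=> e0; have [d d0 hd] := uac e0; exists d => // l ol fl.
apply/ler_addgt0Pl => k k0.
have k1 : 0 < k / ((size l)%:R + 1) by rewrite divr_gt0// ltr_wpDl.
have [l' [ o1 o2 o3 _]] := tvar_refine k1 ol.
apply: le_trans o3 _; rewrite addrC lerD//; last exact/ltW/hd/(le_lt_trans o2).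
by rewrite mulrCA ger_pMr// ler_pdivrMr ?ltr_wpDl// mul1r lerDl.
Qed.

End TotalVariation.

(** * Densities of monotone absolutely continuous functions *)

Section MonotoneDensity.
Variable R : realType.
Variables (a b : R) (V : R -> R).
Hypothesis ab : a < b.
Hypothesis Vnd : {homo V : s t / s <= t}.
Hypothesis Va : forall t, t <= a -> V t = V a.
Hypothesis Vb : forall t, b <= t -> V t = V b.
Hypothesis Vac : forall e : R, 0 < e -> exists2 d : R, 0 < d &
  forall l : seq (R * R), ofam l -> flen l < d -> \sum_(p <- l) (V p.2 - V p.1) <= e.
Notation mu := (@lebesgue_measure R).

Let Vcont : continuous V.
Proof.
move=> x; apply/cvgrPdist_le => e e0; have [d d0 hd] := Vac e0.
have key s t : s <= t -> t - s < d -> V t - V s <= e.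
  move=> st std; have := hd [:: (s, t)]; rewrite /ofam /flen !big_seq1/= st; exact.
near=> t.
have tx : `|x - t| < d by near: t; apply: (@cvgr_dist_lt _ _ _ _ _ id x) => //; exact: cvg_id.
move: tx; rewrite ltr_norml => /andP[t1 t2].
have [xt|xt] := leP x t.
  rewrite distrC ger0_norm; last by rewrite subr_ge0; exact: Vnd.
  by apply: key => //; lra.
rewrite ger0_norm; last by rewrite subr_ge0; exact/Vnd/ltW.
by apply: key; lra.
Unshelve. all: by end_near. Qed.

Let Vrc : right_continuous V.
Proof. by move=> x; apply: cvg_at_right_filter; exact: Vcont. Qed.

HB.instance Definition _ := isCumulative.Build R _ R V Vnd Vrc.

Let nu := lebesgue_stieltjes_measure V.

Let nu_itv s t : s <= t -> nu `]s, t]%classic = (V t - V s)%:E.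
Proof.
move=> st; rewrite /nu /lebesgue_stieltjes_measure /measure_extension measurable_mu_extE/=.
  by rewrite wlength_itv_bnd.
exact: is_ocitv.
Qed.

Let mu_itv s t : s <= t -> mu `]s, t]%classic = (t - s)%:E.
Proof.
move=> st; have := @lebesgue_measure_itv R `]s, t]; rewrite /= lte_fin => ->.
by move: st; rewrite le_eqVlt => /predU1P[->|->]//; rewrite ltxx subrr.
Qed.

(** Constancy of V outside [a, b] bounds the mass of every ]-n, n] by V b - V a. *)
Let nu_fin : fin_num_fun nu.
Proof.
pose I (n : nat) : set R := `]- n%:R, n%:R]%classic.
have nuT : (nu setT <= (V b - V a)%:E)%E.
  have nuI n : (nu (I n) <= (V b - V a)%:E)%E.
    rewrite /I nu_itv ?ge0_cp// lee_fin lerB//.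
      by have [nb|nb] := leP n%:R b; [exact: Vnd|rewrite Vb// ltW].
    by have [na|na] := leP (- n%:R) a; [rewrite Va|apply: Vnd; exact: ltW].
  have : nu (I n) @[n --> \oo] --> nu setT.
    rewrite -(bigcup_itvT false false); apply: nondecreasing_cvg_mu.
    - by move=> k; exact: measurable_itv.
    - by apply: bigcup_measurable => k _; exact: measurable_itv.
    by move=> *; apply/subsetPset/subset_itv; rewrite leBSide/= ?lerN2 ler_nat.
  move=> /cvg_lim <-//; apply: lime_le.
    apply: ereal_nondecreasing_is_cvgn => m n mn; apply: le_measure; rewrite ?inE; [exact: measurable_itv|exact: measurable_itv|].
    by apply/subset_itv; rewrite leBSide/= ?lerN2 ler_nat.
  by near=> n; exact: nuI.
move=> A mA; rewrite ge0_fin_numE//; apply: le_lt_trans (ltry (V b - V a)).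
by apply: le_trans nuT; apply: le_measure; rewrite ?inE.
Unshelve. all: by end_near. Qed.

Section Grid.
Variable U : set R.
Hypothesis oU : open U.

(** Dyadic grid of mesh 2^-n on [-n, n]; [A n] is the union of its half-open cells contained in U.
    These finite unions increase to U, so a condition on finite ordered families controls the
    Stieltjes measure of an open set. *)
Let gp (n j : nat) : R := j%:R / 2 ^+ n - n%:R.
Let cell n j : set R := `]gp n j, gp n j.+1]%classic.
Let ncell n := (n * 2 ^ n.+1)%N.
Let inU n j : bool := `[< cell n j `<=` U >].
Let ucell n j := if inU n j then cell n j else set0.
Let A n := \big[setU/set0]_(j < ncell n) ucell n j.

Let gp_le n i j : (i <= j)%N -> gp n i <= gp n j.
Proof. by move=> ij; rewrite /gp lerD2r ler_pM2r ?invr_gt0 ?exprn_gt0// ler_nat. Qed.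

Let mcell n j : measurable (cell n j).
Proof. exact: measurable_itv. Qed.

Let mucell n j : measurable (ucell n j).
Proof. by rewrite /ucell; case: ifP. Qed.

Let triv n : trivIset setT (ucell n).
Proof.
apply/trivIsetP => i j _ _; wlog ij : i j / (i < j)%N => [h|].
  by rewrite neq_lt => /orP[ij|ij]; [|rewrite setIC]; apply: h; rewrite // lt_eqF.
move=> _; rewrite -subset0 /ucell => x [].
case: ifP => // _; case: ifP => // _; rewrite /cell/= !in_itv/= => /andP[_ xi] /andP[xj _].
by have := lt_le_trans xj (le_trans xi (gp_le n ij)); rewrite ltxx.
Qed.

Let measA (m : {measure set (measurableTypeR R) -> \bar R}) n :
  m (A n) = (\sum_(j < ncell n) m (ucell n j))%E.
Proof.
apply: measure_semi_additive_ord_I => //.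
- by move=> k _; exact: mucell.
- by move=> i j _ _; exact: triv.
- by apply: bigsetU_measurable => k _; exact: mucell.
Qed.

Let fam n := [seq (gp n j, gp n j.+1) | j <- [seq j <- iota 0 (ncell n) | inU n j]].

Let ofam_fam n : ofam (fam n).
Proof.
rewrite /ofam all_map; apply/andP; split; first by apply/allP => j _ /=; exact: gp_le.
rewrite pairwise_map; apply: (@sub_pairwise _ ltn); first by move=> i j /= ij; exact: gp_le.
apply: (@subseq_pairwise _ _ _ (iota 0 (ncell n))); first exact: filter_subseq.
by rewrite -sorted_pairwise ?iota_ltn_sorted//; exact: ltn_trans.
Qed.

Let measA_fam (m : {measure set (measurableTypeR R) -> \bar R}) (g : R -> R) n :
  (forall s t, s <= t -> m `]s, t]%classic = (g t - g s)%:E) ->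
  m (A n) = (\sum_(p <- fam n) (g p.2 - g p.1))%:E.
Proof.
move=> hm; rewrite measA.
have -> : \sum_(p <- fam n) (g p.2 - g p.1) =
    \sum_(j < ncell n) (if inU n j then g (gp n j.+1) - g (gp n j) else 0).
  rewrite big_map big_filter big_mkcond/=.
  by rewrite -(big_mkord xpredT (fun j => if inU n j then g (gp n j.+1) - g (gp n j) else 0)) /index_iota subn0.
rewrite -sumEFin.
apply: eq_bigr => j _; rewrite /ucell; case: ifP => _; last by rewrite measure0.
by rewrite /cell hm// gp_le.
Qed.

Let A_sub n : A n `<=` U.
Proof.
rewrite /A -bigcup_mkord => x [j _]; rewrite /ucell; case: ifPn => // /asboolP; exact.
Qed.

Let A_mono n m : (n <= m)%N -> A n `<=` A m.
Proof.
move: m; apply: (@homo_leq _ A (fun B C => B `<=` C)); [by move=> B x|by move=> B C D CB BD x /CB/BD|].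
move=> {}n; rewrite /A -!bigcup_mkord => x [j /= jn]; rewrite /ucell.
case: ifPn => // /asboolP cU xc.
have e2 : (2 ^+ n : R) != 0 by rewrite expf_neq0.
(* The left end of the grid moves from -n to -(n + 1), that is by 2 ^ n.+1 cells of the finer mesh;
   hence the shift of the index. *)
have gE k : gp n k = gp n.+1 (k.*2 + 2 ^ n.+1).
  rewrite /gp natrD natrX -mul2n natrM mulrDl divff ?expf_neq0// -natr1.
  by rewrite exprS -mulf_div divff// mul1r; ring.
have jb : (j.*2 + 2 ^ n.+1 + 1 < ncell n.+1)%N.
  move: jn; rewrite /ncell !expnS => jn.
  have : (j.+1.*2 <= (n * (2 * 2 ^ n)).*2)%N by rewrite leq_double.
  have : (0 < 2 ^ n)%N by rewrite expn_gt0.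
  rewrite doubleS -!mul2n; set w := (2 ^ n)%N; nia.
have xc' := xc; move: xc; rewrite /cell/= in_itv/= gE (gE j.+1) => /andP[x1 x2].
have [xm|xm] := leP x (gp n.+1 (j.*2 + 2 ^ n.+1).+1).
  exists (j.*2 + 2 ^ n.+1)%N => /=; first by apply: leq_trans jb; rewrite addn1 ltnW.
  rewrite /ucell ifT; first by rewrite /cell/= in_itv/= x1.
  apply/asboolP => y; rewrite /cell/= in_itv/= => /andP[y1 y2]; apply: cU.
  rewrite /cell/= in_itv/= gE (gE j.+1) y1 (le_trans y2)// gp_le//.
exists (j.*2 + 2 ^ n.+1).+1 => /=; first by move: jb; rewrite addn1.
have E : ((j.*2 + 2 ^ n.+1).+2 = j.+1.*2 + 2 ^ n.+1)%N by rewrite doubleS !addSn.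
rewrite /ucell ifT; first by rewrite /cell/= in_itv/= xm E.
apply/asboolP => y; rewrite /cell/= in_itv/= E => /andP[y1 y2]; apply: cU.
by rewrite /cell/= in_itv/= gE (gE j.+1) y2 andbT (le_lt_trans _ y1)// gp_le.
Qed.

Let A_cover : U = \bigcup_n A n.
Proof.
apply/seteqP; split => [x Ux|x [n _ /A_sub]//].
have : nbhs x U by exact: open_nbhs_nbhs.
move=> /nbhs_ballP[e /= e0 he].
have [n [n1 n2]] : exists n, `|x| < n%:R /\ (2 ^+ n)^-1 < e.
  exists (maxn (Num.bound `|x|) (Num.bound e^-1)); split.
    apply: lt_le_trans (_ : (Num.bound `|x|)%:R <= _); first exact: archi_boundP.
    by rewrite ler_nat leq_maxl.
  rewrite invf_plt ?posrE ?exprn_gt0//.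
  apply: (@lt_le_trans _ _ (Num.bound e^-1)%:R); first by apply: archi_boundP; rewrite invr_ge0 ltW.
  rewrite -natrX ler_nat; apply: (@leq_trans (maxn (Num.bound `|x|) (Num.bound e^-1))).
    exact: leq_maxr.
  by rewrite ltnW// ltn_expl.
exists n => //; rewrite /A -bigcup_mkord.
have p2 : 0 < (2 ^+ n : R) by rewrite exprn_gt0.
set y := (x + n%:R) * 2 ^+ n.
have y0 : 0 < y by rewrite mulr_gt0//; move: n1; rewrite ltr_norml => /andP[]; lra.
have [j [j1 j2]] : exists j : nat, j%:R < y /\ y <= j.+1%:R.
  have ex : exists k : nat, y <= k%:R by exists (Num.bound y); exact/ltW/archi_boundP/ltW.
  case: (ex_minnP ex) => -[|k] hk hmin; first by move: hk; rewrite leNgt y0.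
  by exists k; split => //; rewrite ltNge; apply/negP => /hmin; rewrite ltnn.
have g1 : gp n j < x by rewrite /gp ltrBlDr ltr_pdivrMr.
have g2 : x <= gp n j.+1 by rewrite /gp lerBrDr ler_pdivlMr.
exists j.
  rewrite /= /ncell -(ltr_nat R) natrM natrX; apply: lt_le_trans j1 _.
  rewrite /y exprS mulrA ler_pM2r//; move: n1; rewrite ltr_norml => /andP[]; lra.
rewrite /ucell ifT; first by rewrite /cell/= in_itv/= g1.
apply/asboolP => z; rewrite /cell/= in_itv/= => /andP[z1 z2]; apply: he.
have gg : gp n j.+1 - gp n j = (2 ^+ n)^-1 by rewrite /gp -natr1 mulrDl mul1r; ring.
by rewrite -ball_normE/= ltr_norml; apply/andP; split; lra.
Qed.

Lemma stieltjes_open_le (e d : R) :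
  (forall l : seq (R * R), ofam l -> flen l < d -> \sum_(p <- l) (V p.2 - V p.1) <= e) ->
  (mu U < d%:E)%E -> (nu U <= e%:E)%E.
Proof.
move=> hd Ud.
have mA n : measurable (A n) by apply: bigsetU_measurable => k _; exact: mucell.
have nA n : (nu (A n) <= e%:E)%E.
  have -> : nu (A n) = (\sum_(p <- fam n) (V p.2 - V p.1))%:E.
    exact: (measA_fam (m := lebesgue_stieltjes_measure V)).
  rewrite lee_fin; apply: hd => //; rewrite -lte_fin; apply: le_lt_trans Ud.
  have -> : (flen (fam n))%:E = mu (A n).
    by rewrite /flen; apply/esym/(measA_fam (m := mu) (g := id)) => s t; exact: mu_itv.
  apply: le_measure; [rewrite inE; exact: mA|by rewrite inE; exact: measurable_realfun.open_measurable|exact: A_sub].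
have : nu (A n) @[n --> \oo] --> nu U.
  rewrite A_cover; apply: nondecreasing_cvg_mu; [exact: mA|by apply: bigcup_measurable => k _; exact: mA|].
  by move=> n m nm; apply/subsetPset; exact: A_mono.
move=> /cvg_lim <-//; apply: lime_le.
  apply: ereal_nondecreasing_is_cvgn => m n mn; apply: le_measure; [rewrite inE; exact: mA|rewrite inE; exact: mA|exact: A_mono].
by near=> n; exact: nA.
Unshelve. all: by end_near. Qed.

End Grid.

(** By outer regularity a null set lies in open sets of small Lebesgue measure, whose Stieltjes
    measure is small by absolute continuity of V. *)
Let dominated : lebesgue_stieltjes_measure V `<< mu.
Proof.
apply/null_content_dominatesP => A mA A0; apply/eqP.
rewrite eq_le measure_ge0 andbT; apply/lee_addgt0Pr => e e0; rewrite add0e.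
have [d d0 hd] := Vac e0.
have Aoo : (mu A < +oo)%E by rewrite [X in (X < _)%E]A0 ltry.
have [U [oU AU UA]] := lebesgue_regularity_outer mA Aoo d0.
have mU : measurable (U : set (measurableTypeR R)) := measurable_realfun.open_measurable oU.
apply: (@le_trans _ _ (nu U)).
  by apply: le_measure => //; rewrite inE.
apply: (stieltjes_open_le oU hd); rewrite -(setDUK AU).
apply: le_lt_trans (measureU2 _ mA (measurableD mU mA)) _.
by rewrite [X in (X + _ < _)%E]A0 add0e.
Qed.

(** Radon-Nikodym gives a density f of the Stieltjes measure; V differs by a constant from the
    indefinite integral of f, and differentiation of that integral identifies f with V' almost
    everywhere. *)
Lemma monotone_ac_density : exists f : R -> R,
  [/\ forall x, 0 <= f x, mu.-integrable setT (EFin \o f),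
      forall s t, s <= t -> (V t - V s)%:E = (\int[mu]_(x in `]s, t]) (f x)%:E)%E
    & {ae mu, forall x, derivable V x 1 /\ derive1 V x = f x}].
Proof.
pose nuM := Measure_isFinite.Build _ (measurableTypeR R) R (lebesgue_stieltjes_measure V) nu_fin.
pose nuF : {finite_measure set (measurableTypeR R) -> \bar R} := HB.pack (lebesgue_stieltjes_measure V) nuM.
have [g [g0 gfin gint gE]] := @radon_nikodym_sigma_finite _ _ _ mu nuF dominated.
pose f (x : R) : R := fine (g x).
have fE : EFin \o f = g by apply/funext => x /=; rewrite /f fineK.
have fint : mu.-integrable setT (EFin \o f) by rewrite fE.
have Vf s t : s <= t -> (V t - V s)%:E = (\int[mu]_(x in `]s, t]) (f x)%:E)%E.
  move=> st; rewrite -nu_itv// [LHS]gE//; first by rewrite -fE.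
exists f; split => //; first by move=> x; rewrite fine_ge0.
have fiy y : mu.-integrable `]-oo, y] (EFin \o f) by apply: integrableS fint.
have := integrable_locally measurableT fint.
have -> : f \_ [set: R] = f by apply/funext => x; rewrite patchE mem_setT.
move=> floc; have := FTC1Ny fiy floc.
set F := fun x => \int[mu]_(t in _) f t => dF.
have VF : V = F \+ cst (V 0 - F 0).
  apply/funext => x; rewrite /=.
  have key s t : s <= t -> V t - V s = F t - F s.
    move=> st; rewrite /F (@Rintegral_itvB R f -oo%O (BRight t) s) ?bnd_simp//.
    by rewrite /Rintegral -Vf.
  by have [h|/ltW h] := leP 0 x; have := key _ _ h; lra.
move: dF; apply: filterS; first exact: (ae_filter_ringOfSetsType mu).
move=> x [dF Fx]; rewrite VF; split.
  by apply: derivableD => //; exact: derivable_cst.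
by rewrite derive1E deriveD// derive_cst addr0 -derive1E.
Qed.

End MonotoneDensity.

Section Density.
Variable R : realType.
Variables (a b : R) (u : R -> R).
Hypothesis ab : a < b.
Hypothesis uac : acl u.
Hypothesis uconst : forall t, u (clamp a b t) = u t.
Notation mu := (@lebesgue_measure R).

(** Jordan decomposition u = V - W, with V the total variation: both terms are nondecreasing,
    absolutely continuous and constant outside [a, b]. *)
Lemma ac_density : exists f : R -> R,
  [/\ mu.-integrable setT (EFin \o f),
      forall s t, s <= t -> (u t - u s)%:E = (\int[mu]_(x in `]s, t]) (f x)%:E)%E
    & {ae mu, forall x, derivable u x 1 /\ derive1 u x = f x}].
Proof.
pose V := tvar a b u; pose W := fun t => V t - u t.
have ca t : t <= a -> clamp a b t = a.
  by move=> ta; rewrite /clamp max_l// ge_min ta.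
have cb t : b <= t -> clamp a b t = b.
  by move=> bt; rewrite /clamp min_r// max_r// ltW.
have Va t : t <= a -> V t = V a by move=> ta; rewrite /V /tvar !ca.
have Vb t : b <= t -> V t = V b by move=> bt; rewrite /V /tvar !cb.
have ua t : t <= a -> u t = u a by move=> ta; rewrite -uconst -[RHS]uconst !ca.
have ub t : b <= t -> u t = u b by move=> bt; rewrite -uconst -[RHS]uconst !cb.
have Vnd := tvar_nd ab uac; have Vac := tvar_ac ab uac.
have Wnd : {homo W : s t / s <= t}.
  move=> s t st; have := tvar_ge ab uac st; rewrite !uconst ler_norml => /andP[_].
  by rewrite /W /V; lra.
have Wac e : 0 < e -> exists2 d : R, 0 < d &
  forall l : seq (R * R), ofam l -> flen l < d -> \sum_(p <- l) (W p.2 - W p.1) <= e.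
  move=> e0; have e2 : 0 < e / 2 by rewrite divr_gt0.
  have [d d0 hd] := Vac _ e2; have [d' d'0 hd'] := uac e2.
  exists (Num.min d d'); first by rewrite lt_min d0.
  move=> l ol; rewrite lt_min => /andP[ld ld'].
  have -> : \sum_(p <- l) (W p.2 - W p.1) = \sum_(p <- l) (V p.2 - V p.1) + \sum_(p <- l) (u p.1 - u p.2).
    by rewrite -big_split/=; apply: eq_bigr => p _; rewrite /W; ring.
  have : \sum_(p <- l) (u p.1 - u p.2) <= fvar u l.
    by apply: ler_sum => p _; rewrite distrC ler_norm.
  by have := hd l ol ld; have := hd' l ol ld'; lra.
have Wa t : t <= a -> W t = W a by move=> ta; rewrite /W Va// ua.
have Wb t : b <= t -> W t = W b by move=> bt; rewrite /W Vb// ub.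
have [f [f0 fi fE df]] := monotone_ac_density ab Vnd Va Vb Vac.
have [g [g0 gi gE dg]] := monotone_ac_density ab Wnd Wa Wb Wac.
have fgi : mu.-integrable setT (EFin \o (fun x => f x - g x)).
  exact: (integrableB measurableT fi gi).
exists (fun x => f x - g x); split => //.
- move=> s t st.
  have fi' : mu.-integrable `]s, t] (EFin \o f) by apply: integrableS fi.
  have gi' : mu.-integrable `]s, t] (EFin \o g) by apply: integrableS gi.
  have -> : (\int[mu]_(x in `]s, t]) (f x - g x)%:E =
      \int[mu]_(x in `]s, t]) (f x)%:E - \int[mu]_(x in `]s, t]) (g x)%:E)%E.
    by rewrite -integralB_EFin.
  rewrite -fE// -gE// -EFinB; congr EFin; rewrite /W /V; ring.
- have FF := ae_filter_ringOfSetsType mu; have := @filterI _ _ FF _ _ df dg.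
  apply: filterS => x [[dV Vx] [dW Wx]].
  have uE : u = V - W by apply/funext => t; rewrite /= /GRing.add/= /GRing.opp/= /W; ring.
  rewrite uE; split; first exact: derivableB.
  by rewrite derive1E deriveB// -!derive1E Vx Wx.
Qed.

End Density.

Section NonmeasurableMajorant.
Context d (T : measurableType d) (R : realType) (mu : {measure set T -> \bar R}).

(* The Kobayashi metric along a curve is not known to be measurable, but the
   library integral is a supremum over simple functions, hence monotone on all
   nonnegative functions. *)
Lemma ge0_le_integral_majorant (D : set T) (f g : T -> \bar R) :
  (forall x, D x -> 0 <= f x)%E -> (forall x, D x -> f x <= g x)%E ->
  (\int[mu]_(x in D) f x <= \int[mu]_(x in D) g x)%E.
Proof.
move=> f0 fg; have g0 x : D x -> (0 <= g x)%E by move=> Dx; exact: (le_trans (f0 x Dx) (fg x Dx)).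
rewrite !ge0_integralE//; apply: ereal_sup_le => _ [h hf <-]; exists h => // x.
apply: le_trans (hf x) _; rewrite !patchE; case: ifPn => // xD.
by apply: fg; rewrite -[D x]in_setE.
Qed.

(** Only f is assumed measurable; hence it is f, and not g, that is set to zero on the exceptional
    null set. *)
Lemma ae_ge0_le_integral_majorant (D : set T) (f g : T -> \bar R) :
  measurable D -> measurable_fun D f ->
  (forall x, D x -> 0 <= f x)%E -> (forall x, D x -> 0 <= g x)%E ->
  {ae mu, forall x, D x -> (f x <= g x)%E} ->
  (\int[mu]_(x in D) f x <= \int[mu]_(x in D) g x)%E.
Proof.
move=> mD mf f0 g0 [N [mN N0 fgN]].
rewrite (ge0_negligible_integral mN mD mf f0 N0) setDE integral_mkcondr.
apply: ge0_le_integral_majorant => x Dx; rewrite patchE; case: ifPn => //; first by move=> _; exact: f0.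
  rewrite in_setE => xN; apply: contrapT => nfg; apply: xN; apply: fgN => /(_ Dx).
  exact: nfg.
by move=> _; exact: g0.
Qed.

End NonmeasurableMajorant.

(** * Bounds for the Kobayashi distance *)

Section AbsolutelyContinuousCurve.
Variable R : realType.
Variable d : nat.
Variables (a b : R) (sg : R -> Cvec R d).
Hypothesis ab : a < b.
Hypothesis sgac : absolutely_continuous a b sg.
Notation mu := (@lebesgue_measure R).

Let sc t := sg (clamp a b t).

Lemma absolutely_continuous_families (e : R) : 0 < e -> exists2 k : R, 0 < k &
  forall l, ofam l -> flen l < k -> \sum_(p <- l) enorm (sc p.2 - sc p.1) < e.
Proof.
move=> e0; have [k k0 hk] := sgac e0; exists k => // l /andP[l1 l2] lk.
pose s i := clamp a b (tnth (in_tuple l) i).1; pose t i := clamp a b (tnth (in_tuple l) i).2.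
have le i : (tnth (in_tuple l) i).1 <= (tnth (in_tuple l) i).2.
  by have := allP l1 _ (mem_tnth i (in_tuple l)).
have := hk (size l) s t.
rewrite (big_tnth _ _ l)/=; apply.
- move=> i; rewrite /s /t; have /andP[-> _] := clamp_itv ab (tnth (in_tuple l) i).1.
  by have /andP[_ ->] := clamp_itv ab (tnth (in_tuple l) i).2; rewrite le_clamp.
- apply/trivIsetP => i j _ _; wlog ij : i j / (i < j)%N => [h|].
    by rewrite neq_lt => /orP[ij|ij]; [|rewrite setIC]; apply: h; rewrite // lt_eqF.
  move=> _; rewrite -subset0 => x []; rewrite /s /t /= !in_itv/= => /andP[_ xi] /andP[xj _].
  have : (tnth (in_tuple l) i).2 <= (tnth (in_tuple l) j).1.
    rewrite !(tnth_nth (0, 0)) /=.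
    by have /(pairwiseP (0, 0)) := l2; apply; rewrite ?inE.
  by move=> /(le_clamp a b) h; have := lt_le_trans xj (le_trans (ltW xi) h); rewrite ltxx.
- apply: le_lt_trans lk; rewrite /flen (big_tnth _ _ l); apply: ler_sum => i _.
  exact: clamp_le.
Qed.

Lemma lipschitz_acl (F : R -> R) (K : R) :
  (forall s t, `|F t - F s| <= K * enorm (sc t - sc s)) -> acl F.
Proof.
move=> hF e e0; have K0 : 0 < `|K| + 1 by rewrite ltr_wpDl.
have [k k0 hk] := absolutely_continuous_families (divr_gt0 e0 K0); exists k => // l ol lk.
have := hk l ol lk; rewrite ltr_pdivlMr// mulr_suml; apply: le_lt_trans.
apply: ler_sum => p _; apply: le_trans (hF _ _) _; rewrite mulrC ler_wpM2l ?enorm_ge0//.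
by rewrite (le_trans (ler_norm K))// lerDl.
Qed.

End AbsolutelyContinuousCurve.

Lemma acl_continuous (R : realType) (F : R -> R) : acl F -> continuous F.
Proof.
move=> Fac x; apply/cvgrPdist_le => e e0; have [d d0 hd] := Fac e e0.
have key s t : s <= t -> t - s < d -> `|F t - F s| <= e.
  move=> st std; have := hd [:: (s, t)]; rewrite /ofam /flen /fvar !big_seq1/= st => h.
  exact/ltW/h.
near=> t.
have tx : `|x - t| < d by near: t; apply: (@cvgr_dist_lt _ _ _ _ _ id x) => //; exact: cvg_id.
move: tx; rewrite ltr_norml => /andP[t1 t2].
have [xt|xt] := leP x t; first by rewrite distrC; apply: key => //; lra.
by apply: key; lra.
Unshelve. all: by end_near. Qed.

Lemma ln_lipschitz (R : realType) (c x y : R) : 0 < c -> c <= x -> c <= y ->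
  `|ln x - ln y| <= c^-1 * `|x - y|.
Proof.
move=> c0; wlog xy : x y / y <= x => [h cx cy|cx cy].
  by have [yx|/ltW xy] := leP y x; [apply: h|rewrite distrC [`|x - y|]distrC; apply: h].
have y0 : 0 < y by exact: lt_le_trans cy.
have x0 : 0 < x by exact: lt_le_trans cx.
rewrite !ger0_norm ?subr_ge0 ?ler_ln//.
rewrite -ln_div//; apply: (@le_trans _ _ ((x - y) / y)).
  have -> : x / y = 1 + (x - y) / y by field; rewrite gt_eqF.
  by apply: le_ln1Dx; apply: (@lt_le_trans _ _ 0); rewrite ?ltrN10// divr_ge0 ?subr_ge0// ltW.
by rewrite mulrC ler_wpM2r ?subr_ge0// lef_pV2.
Qed.

Lemma is_derive_big_sum (R : realType) (I : Type) (s : seq I) (F : I -> R -> R) (dF : I -> R) (x : R) :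
  (forall i, is_derive x (1 : R) (F i) (dF i)) ->
  is_derive x (1 : R) (fun t => \sum_(i <- s) F i t) (\sum_(i <- s) dF i).
Proof.
move=> h; elim: s => [|i s IH].
  rewrite big_nil (_ : (fun t => _) = cst 0); first exact: is_derive_cst.
  by apply/funext => t; rewrite big_nil.
rewrite big_cons (_ : (fun t => _) = F i + (fun t => \sum_(j <- s) F j t)).
  exact: is_deriveD.
by apply/funext => t; rewrite big_cons.
Qed.

Section LengthLowerBound.
Variable R : realType.
Variable d : nat.
Notation mu := (@lebesgue_measure R).

Definition l1norm (v : Cvec R d) : R := \sum_j cmod (v 0 j).

Lemma cdot_le (y v : Cvec R d) : cmod (cdot y v) <= l1norm v * enorm y.
Proof.
rewrite /cdot /l1norm mulr_suml.
have h : cmod (\sum_j y 0 j * v 0 j) <= \sum_j cmod (y 0 j * v 0 j).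
  elim/big_rec2 : _ => [|i y1 y2 _ h]; first by rewrite cmod0.
  by apply: le_trans (cmodD _ _) _; rewrite lerD2l.
apply: le_trans h _; apply: ler_sum => j _.
by rewrite cmodM mulrC ler_wpM2l ?cmod_ge0// coord_le_enorm.
Qed.

Variable Om : set (Cvec R d).
Hypothesis oOm : open Om.
Variables (v p : Cvec R d).
Let lam (y : Cvec R d) : R := complex.Re (cdot (y - p) v).
Hypothesis lam_gt0 : forall y, Om y -> 0 < lam y.

Lemma lam_lipschitz (y z : Cvec R d) : `|lam y - lam z| <= l1norm v * enorm (y - z).
Proof.
rewrite /lam -ReN -ReD -cdotB; apply: le_trans (Re_le_cmod _) _.
by rewrite opprB addrA subrK; exact: cdot_le.
Qed.

(** Since lam is bounded away from 0 on the compact curve, ln (lam (sg t)) / 2 is absolutely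
    continuous. Its increment is the integral of its derivative, whose modulus is at most the
    Kobayashi speed by the Schwarz bound. *)
Lemma kobayashi_length_ge (a b : R) (sg : R -> Cvec R d) : a < b ->
  absolutely_continuous a b sg -> (forall t, a <= t <= b -> Om (sg t)) ->
  ((`|ln (lam (sg a)) - ln (lam (sg b))| / 2)%:E <= kobayashi_length Om a b sg)%E.
Proof.
move=> ab sgac sgOm.
pose sc t := sg (clamp a b t).
have scOm t : Om (sc t) by apply: sgOm; exact: clamp_itv.
pose P t := lam (sc t).
have Pac : acl P by apply: (lipschitz_acl ab sgac) => s t; exact: lam_lipschitz.
have [c cab cmin] := EVT_min (ltW ab) (within_pointwise (fun t _ => acl_continuous Pac (x:=t))).
have c0 : 0 < P c by apply: lam_gt0.
have Pc t : P c <= P t.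
  have E : P (clamp a b t) = P t by rewrite /P /sc clampK// clamp_itv.
  by rewrite -E; apply: cmin; rewrite in_itv/=; exact: clamp_itv.
pose u t := ln (P t) / 2.
have uac : acl u.
  apply: (lipschitz_acl (K := (P c)^-1 * l1norm v) ab sgac) => s t.
  rewrite /u -mulrBl normrM [`|2^-1|]ger0_norm ?invr_ge0//.
  have h : `|ln (P t) - ln (P s)| <= (P c)^-1 * (l1norm v * enorm (sc t - sc s)).
    apply: le_trans (ln_lipschitz c0 (Pc t) (Pc s)) _.
    by rewrite ler_wpM2l ?invr_ge0 ?(ltW c0)// lam_lipschitz.
  rewrite -mulrA; apply: le_trans h; rewrite ler_pdivrMr//.
  by rewrite ler_peMr// ler1n.
have uconst t : u (clamp a b t) = u t by rewrite /u /P /sc clampK// clamp_itv.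
have [f [fint fE df]] := ac_density ab uac uconst.
pose X j t := complex.Re (sc t 0 j); pose Y j t := complex.Im (sc t 0 j).
have Xd j : {ae mu, forall x, derivable (X j) x 1}.
  have Xac : acl (X j).
    apply: (lipschitz_acl (K := 1) ab sgac) => s t; rewrite mul1r /X -ReN -ReD.
    by apply: le_trans (Re_le_cmod _) _; have := coord_le_enorm (sc t - sc s) j; rewrite !mxE.
  have Xconst t : X j (clamp a b t) = X j t by rewrite /X /sc clampK// clamp_itv.
  have [g [_ _]] := ac_density ab Xac Xconst.
  by apply: filterS; [exact: (ae_filter_ringOfSetsType mu)|move=> x []].
have Yd j : {ae mu, forall x, derivable (Y j) x 1}.
  have Yac : acl (Y j).
    apply: (lipschitz_acl (K := 1) ab sgac) => s t; rewrite mul1r /Y -ImN -ImD.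
    by apply: le_trans (Im_le_cmod _) _; have := coord_le_enorm (sc t - sc s) j; rewrite !mxE.
  have Yconst t : Y j (clamp a b t) = Y j t by rewrite /Y /sc clampK// clamp_itv.
  have [g [_ _]] := ac_density ab Yac Yconst.
  by apply: filterS; [exact: (ae_filter_ringOfSetsType mu)|move=> x []].
(* [velocity] is meaningful only where every coordinate of the curve is differentiable; the finitely
   many exceptional sets are null. *)
have FF := ae_filter_ringOfSetsType mu.
have Xd' := @filter_forall _ _ (fun j => [set x | derivable (X j) x 1]) _ FF Xd.
have Yd' := @filter_forall _ _ (fun j => [set x | derivable (Y j) x 1]) _ FF Yd.
(* The end points are discarded as well: the clamped curve is only used where it agrees with [sg] in
   a whole neighbourhood. *)
have aeN (z : R) : {ae mu, forall x, x != z}.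
  exists [set z]; split; [exact: measurable_set1|exact: lebesgue_measure_set1|].
  by move=> x /= /negP; rewrite negbK => /eqP.
have pointwise x : a < x < b -> (forall j, derivable (X j) x 1) -> (forall j, derivable (Y j) x 1) ->
    (derivable u x 1 /\ derive1 u x = f x) ->
    `|f x| <= kobayashi_metric Om (sg x) (velocity sg x).
  move=> /andP[ax xb] dX dY [du uf].
  have near_sc : \forall t \near x, sg t = sc t.
    have xI : x \in `]a, b[ by rewrite in_itv/= ax.
    have := near_in_itvoo xI; apply: filterS => t; rewrite in_itv/= => /andP[at_ tb].
    by rewrite /sc clampK// !ltW.
  have Xder j : is_derive x (1 : R) (X j) (complex.Re (velocity sg x 0 j)).
    rewrite mxE/=; apply: DeriveDef; first exact: dX.
    rewrite derive1E; apply/esym/near_eq_derive.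
    by near=> t; rewrite /X (near near_sc).
  have Yder j : is_derive x (1 : R) (Y j) (complex.Im (velocity sg x 0 j)).
    rewrite mxE/=; apply: DeriveDef; first exact: dY.
    rewrite derive1E; apply/esym/near_eq_derive.
    by near=> t; rewrite /Y (near near_sc).
  have Pder : is_derive x (1 : R) P (complex.Re (cdot (velocity sg x) v)).
    have ReS (w : Cvec R d) : complex.Re (cdot w v) = \sum_(j < d) (complex.Re (v 0 j) * complex.Re (w 0 j) -
        complex.Im (v 0 j) * complex.Im (w 0 j)).
      rewrite /cdot; elim/big_rec2 : _ => [//|j y1 y2 _ <-]; rewrite ReD; congr (_ + _).
      by move: (w 0 j) (v 0 j) => [w1 w2] [v1 v2] /=; ring.
    have PE : P = (fun t => \sum_(j < d) (complex.Re (v 0 j) \*: X j - complex.Im (v 0 j) \*: Y j) t)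
        + cst (- complex.Re (cdot p v)).
      by apply/funext => t; rewrite /P /lam cdotB ReD ReN ReS.
    rewrite PE (ReS (velocity sg x)) -[X in is_derive _ _ _ X]addr0.
    by apply: is_deriveD; apply: is_derive_big_sum.
  have Pdx : 0 < P x by apply: lam_gt0.
  have uder : is_derive x (1 : R) u (complex.Re (cdot (velocity sg x) v) / (2 * P x)).
    have -> : u = 2^-1 \*: (@ln R \o P) by apply/funext => t; rewrite /u /= mulrC.
    have dl := is_derive1_comp (is_derive1_ln Pdx) Pder.
    apply: (@is_derive_eq _ _ _ _ _ _ _ _ (is_deriveZ 2^-1 dl)).
    by rewrite /GRing.scale/=; field; rewrite gt_eqF.
  have [_ ude] := uder.
  have Omx : Om (sg x) by apply: sgOm; rewrite !ltW.
  have scx : sc x = sg x by rewrite /sc clampK// !ltW.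
  rewrite -uf derive1E ude normrM [`|(2 * P x)^-1|]ger0_norm ?invr_ge0; last by rewrite mulr_ge0// ltW.
  rewrite ler_pdivrMr ?mulr_gt0// mulrC; apply: le_trans (Re_le_cmod _) _.
  by have := kobayashi_metric_ge (velocity sg x) oOm Omx lam_gt0; rewrite /P scx.
have main : {ae mu, forall x, x \in `[a, b] -> (`|(f x)%:E| <= (kobayashi_metric Om (sg x) (velocity sg x))%:E)%E}.
  have := @filterI _ _ FF _ _ (@filterI _ _ FF _ _ (aeN a) (aeN b)) (@filterI _ _ FF _ _ df (@filterI _ _ FF _ _ Xd' Yd')).
  apply: filterS => x [[xa xb] [dfx [Xx Yx]]]; rewrite in_itv/= => /andP[ax xb'].
  by rewrite lee_fin; apply: pointwise => //; rewrite !lt_neqAle eq_sym xa ax xb xb'.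
have fI : mu.-integrable `[a, b] (EFin \o f) by apply: integrableS fint.
have fm : measurable_fun (`[a, b] : set (measurableTypeR R)) (EFin \o f) by exact: (measurable_int mu).
have : (\int[mu]_(x in `[a, b]) `|(f x)%:E| <= kobayashi_length Om a b sg)%E.
  apply: ae_ge0_le_integral_majorant => //.
  - exact: measurableT_comp.
  - by move=> x _; rewrite lee_fin kobayashi_metric_ge0.
apply: le_trans; apply: le_trans (le_abse_integral mu _ fm) => //.
rewrite -(@integral_itv_obnd_cbnd R a (BRight b) (EFin \o f)); last first.
  by apply: measurable_funS fm => //; exact: subset_itv_oc_cc.
have -> : (\int[mu]_(x in `]a, b]) (EFin \o f) x = (u b - u a)%:E)%E by rewrite fE// ltW.
rewrite /= lee_fin /u -mulrBl normrM [`|2^-1|]ger0_norm ?invr_ge0//.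
by rewrite distrC /P /sc !clampK// ?lexx ltW.
Unshelve. all: by end_near. Qed.

End LengthLowerBound.

Section DistanceLower.
Variable R : realType.
Variable d : nat.
Notation mu := (@lebesgue_measure R).
Implicit Types (Om : set (Cvec R d)) (x y u v w : Cvec R d).

Definition curve_lengths Om x y : set (\bar R) := [set l : \bar R |
    exists (a b : R) (sigma : R -> Cvec R d),
      [/\ a <= b, absolutely_continuous a b sigma,
          forall t, a <= t <= b -> Om (sigma t),
          sigma a = x /\ sigma b = y
        & l = kobayashi_length Om a b sigma] ].

Lemma kobayashi_length_ge0 Om a b sg : (0 <= kobayashi_length Om a b sg)%E.
Proof. by apply: integral_ge0 => t _; rewrite lee_fin kobayashi_metric_ge0. Qed.

Lemma curve_lengths_ge0 Om x y : (0 <= ereal_inf (curve_lengths Om x y))%E.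
Proof.
apply: le_ereal_inf_tmp => _ [a [b [sg [_ _ _ _ ->]]]]; exact: kobayashi_length_ge0.
Qed.

(** The bound for the extended infimum is kept beside the one for its real value: it shows that
    [fine] does not take its default value. *)
Lemma kobayashi_dist_le Om x y a b sg (L : R) : a <= b -> absolutely_continuous a b sg ->
  (forall t, a <= t <= b -> Om (sg t)) -> sg a = x -> sg b = y ->
  (kobayashi_length Om a b sg <= L%:E)%E ->
  (ereal_inf (curve_lengths Om x y) <= L%:E)%E /\ kobayashi_dist Om x y <= L.
Proof.
move=> ab ac sOm sa sb sL.
have h : (ereal_inf (curve_lengths Om x y) <= L%:E)%E.
  apply: le_trans sL; apply: ereal_inf_lbound; exists a, b, sg; split => //.
split=> //; rewrite -lee_fin /kobayashi_dist -/(curve_lengths Om x y) fineK//.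
by rewrite ge0_fin_numE ?curve_lengths_ge0// (le_lt_trans h)// ltry.
Qed.

Lemma lipschitz_absolutely_continuous (a b K : R) (sg : R -> Cvec R d) :
  (forall s t, a <= s -> s <= t -> t <= b -> enorm (sg t - sg s) <= K * (t - s)) ->
  absolutely_continuous a b sg.
Proof.
move=> lip e e0; have K0 : 0 < `|K| + 1 by rewrite ltr_wpDl.
exists (e / (`|K| + 1)); first by rewrite divr_gt0.
move=> n s t st _; rewrite ltr_pdivlMr// mulr_suml; apply: le_lt_trans.
apply: ler_sum => i _; have [si [sti ti]] := st i.
apply: le_trans (lip _ _ si sti ti) _; rewrite mulrC ler_wpM2l ?subr_ge0//.
by rewrite (le_trans (ler_norm K))// lerDl.
Qed.

Lemma is_derive_velocity (sg : R -> Cvec R d) (t : R) (w : Cvec R d) :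
  (forall j, is_derive t (1 : R) (fun s => complex.Re (sg s 0 j)) (complex.Re (w 0 j))) ->
  (forall j, is_derive t (1 : R) (fun s => complex.Im (sg s 0 j)) (complex.Im (w 0 j))) ->
  velocity sg t = w.
Proof.
move=> hR hI; apply/rowP => j; rewrite mxE !derive1E.
have [_ ->] := hR j; have [_ ->] := hI j.
by case: (w 0 j).
Qed.

Lemma convexE Om x y (t : R) : convex_set Om -> Om x -> Om y -> 0 <= t <= 1 ->
  Om ((1 - t)%:C *: x + t%:C *: y).
Proof.
move=> cOm Ox Oy /andP[t0 t1].
have c0 : 0 <= (t%:C : R[i]) by rewrite lecR.
have c1 : (t%:C : R[i]) <= 1 by rewrite -[1]/(1%:C) lecR.
have := cOm y x (Itv01 c0 c1); rewrite !inE => /(_ Oy Ox).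
by rewrite addrC rmorphB.
Qed.

(** By convexity a ball of fixed radius [e] moves along the segment inside Om, which bounds the
    Kobayashi metric there. *)
Lemma segment_length_finite Om x y : convex_domain Om -> Om x -> Om y ->
  (ereal_inf (curve_lengths Om x y) < +oo)%E.
Proof.
move=> [_ oOm cOm] Ox Oy.
have [e1 e10 h1] := (open_enormP Om).1 oOm x Ox.
have [e2 e20 h2] := (open_enormP Om).1 oOm y Oy.
pose e := Num.min e1 e2; have e0 : 0 < e by rewrite lt_min e10.
have he1 : e <= e1 by rewrite ge_min lexx.
have he2 : e <= e2 by rewrite ge_min lexx orbT.
pose sg (t : R) : Cvec R d := x + t%:C *: (y - x).
have sgE t : sg t = (1 - t)%:C *: x + t%:C *: y.
  by rewrite /sg scalerBr rmorphB/= scalerBl scale1r addrA addrAC.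
have sgO t w : 0 <= t <= 1 -> enorm w < e -> Om (sg t + w).
  move=> t01 we.
  have -> : sg t + w = (1 - t)%:C *: (x + w) + t%:C *: (y + w).
    by rewrite sgE !scalerDr addrACA -scalerDl -rmorphD/= subrK scale1r.
  apply: convexE => //; [apply: h1|apply: h2]; rewrite addrC addKr.
    exact: lt_le_trans he1.
  exact: lt_le_trans he2.
set v := y - x.
have v1 : 0 < enorm v + 1 by rewrite ltr_wpDl// enorm_ge0.
set K := (enorm v + 1) / e; have K0 : 0 < K by rewrite divr_gt0.
have vel t : velocity sg t = v.
  have Rd j : is_derive t (1 : R) (fun s => complex.Re (sg s 0 j)) (complex.Re (v 0 j)).
    rewrite (_ : (fun s => _) = cst (complex.Re (x 0 j)) + complex.Re (v 0 j) \*: id).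
      by apply: is_derive_eq; rewrite add0r /GRing.scale/= mulr1.
    apply/funext => s; rewrite /sg -/v !mxE ReD /= /GRing.scale/=.
    by move: (y 0 j - x 0 j) => [p q] /=; rewrite mul0r subr0 mulrC.
  have Id j : is_derive t (1 : R) (fun s => complex.Im (sg s 0 j)) (complex.Im (v 0 j)).
    rewrite (_ : (fun s => _) = cst (complex.Im (x 0 j)) + complex.Im (v 0 j) \*: id).
      by apply: is_derive_eq; rewrite add0r /GRing.scale/= mulr1.
    apply/funext => s; rewrite /sg -/v !mxE ImD /= /GRing.scale/=.
    by move: (y 0 j - x 0 j) => [p q] /=; rewrite mul0r addr0 mulrC.
  exact: is_derive_velocity.
have len : (kobayashi_length Om 0 1 sg <= K%:E)%E.
  have kb t : 0 <= t <= 1 -> kobayashi_metric Om (sg t) (velocity sg t) <= K.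
    move=> t01; rewrite vel; apply: (@kobayashi_metric_le_ball _ _ _ _ _ e) => //.
      by rewrite divfK ?gt_eqF// lerDl.
    by move=> w; exact: sgO.
  have E : (\int[@lebesgue_measure R]_(t in `[0%R, 1%R]) cst K%:E t = K%:E)%E.
    rewrite integral_cst//; have := @lebesgue_measure_itv R `[0, 1].
    by rewrite /= lte_fin ltr01 => ->; rewrite sube0 mule1.
  rewrite -E; apply: ge0_le_integral_majorant => t; rewrite /= in_itv/= => t01.
    by rewrite lee_fin kobayashi_metric_ge0.
  by rewrite lee_fin kb.
have ac : absolutely_continuous 0 1 sg.
  apply: (@lipschitz_absolutely_continuous _ _ (enorm v)) => s t _ st _.
  have -> : sg t - sg s = (t - s)%:C *: v.
    by rewrite /sg opprD addrACA subrr add0r -scalerBl rmorphB.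
  by rewrite enormZ cmod_real ger0_norm ?subr_ge0// mulrC.
have sO0 t : 0 <= t <= 1 -> Om (sg t).
  by move=> t01; have := sgO t 0 t01; rewrite enorm0 addr0; exact.
have s0 : sg 0 = x by rewrite /sg scale0r addr0.
have s1 : sg 1 = y by rewrite /sg scale1r addrC subrK.
have [h _] := kobayashi_dist_le ler01 ac sO0 s0 s1 len.
exact: le_lt_trans h (ltry _).
Qed.

(* y |-> Re (cdot (y - p) v) maps discs in Om to the right half-plane, where the
   Schwarz lemma bounds the speed of its logarithm. *)
Lemma kobayashi_dist_ge Om x y v p : convex_domain Om -> Om x -> Om y ->
  (forall z, Om z -> 0 < complex.Re (cdot (z - p) v)) ->
  `|ln (complex.Re (cdot (x - p) v)) - ln (complex.Re (cdot (y - p) v))| / 2 <= kobayashi_dist Om x y.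
Proof.
move=> cOm Ox Oy pos; have [_ oOm _] := cOm.
have fin : ereal_inf (curve_lengths Om x y) \is a fin_num.
  by rewrite ge0_fin_numE ?curve_lengths_ge0// segment_length_finite.
rewrite -lee_fin /kobayashi_dist -/(curve_lengths Om x y) fineK//.
apply: le_ereal_inf_tmp => _ [a [b [sg [ab sac sOm [<- <-] ->]]]].
have /predU1P[E|{}ab] : (a == b) || (a < b) by rewrite -le_eqVlt.
  by rewrite -E subrr normr0 mul0r; exact: kobayashi_length_ge0.
exact: kobayashi_length_ge.
Qed.

End DistanceLower.

Section RealComplex.
Variable R : realType.
Implicit Types x y : R.

Lemma rcM x y : (x * y)%:C = x%:C * y%:C :> R[i].
Proof. exact: (rmorphM (real_complex R)). Qed.

Lemma rcD x y : (x + y)%:C = x%:C + y%:C :> R[i].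
Proof. exact: (rmorphD (real_complex R)). Qed.

Lemma rcB x y : (x - y)%:C = x%:C - y%:C :> R[i].
Proof. exact: (rmorphB (real_complex R)). Qed.

Lemma rcV x : (x^-1)%:C = (x%:C)^-1 :> R[i].
Proof. exact: (fmorphV (real_complex R)). Qed.

Lemma rc1 : (1 : R)%:C = 1 :> R[i].
Proof. by []. Qed.

End RealComplex.

(** * Moebius discs and upper bounds for the Kobayashi distance *)

Section Mobius.
Variable R : realType.
Implicit Types (al be ga de z : Cplane R).

Definition mobius al be ga de z : Cplane R := (al * z + be) / (ga * z + de).

Lemma differentiable_mobius al be ga de z : ga * z + de != 0 ->
  differentiable (mobius al be ga de) z.
Proof.
move=> nz.
have dl (p q : Cplane R) : differentiable (fun z : Cplane R => p * z + q) z.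
  have d1 : differentiable (fun z : Cplane R => p * z) z by exact: differentiableM.
  exact: (differentiableD d1 (differentiable_cst q z)).
exact: (differentiableM (dl al be) (differentiableV (dl ga de) nz)).
Qed.

Lemma cfirst_order_mobius al be ga de : de != 0 ->
  cfirst_order (mobius al be ga de) 0 ((al * de - be * ga) / de ^+ 2).
Proof.
move=> dn e e0; set D := al * de - be * ga.
have d0 : 0 < cmod de by rewrite cmod_gt0.
set G := cmod ga + 1; have G0 : 0 < G by rewrite ltr_wpDl// cmod_ge0.
set K := 2 * cmod ga * cmod D / cmod de ^+ 3 + 1.
have K0 : 0 < K by rewrite ltr_wpDl// !(mulr_ge0, invr_ge0, exprn_ge0)// cmod_ge0.
exists (Num.min (cmod de / (2 * G)) (e / K)).
  by rewrite lt_min !divr_gt0// mulr_gt0.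
move=> w; rewrite subr0 lt_min => /andP[w1 w2].
have gw : cmod (ga * w) <= cmod de / 2.
  rewrite cmodM; have : cmod ga * cmod w <= G * cmod w by rewrite ler_wpM2r ?cmod_ge0// lerDl.
  move: w1; rewrite invfM mulrA ltr_pdivlMr// mulrC; lra.
have den : cmod de / 2 <= cmod (ga * w + de).
  have := cmodD (ga * w + de) (- (ga * w)); rewrite cmodN addrAC subrr add0r; lra.
have nz : ga * w + de != 0 by rewrite -cmod_gt0; lra.
have -> : mobius al be ga de w - mobius al be ga de 0 - D / de ^+ 2 * w =
   - (ga * D / (de ^+ 2 * (ga * w + de)) * w) * w.
  by rewrite /mobius /D mulr0 add0r; field; rewrite nz.
rewrite cmodM cmodN ler_wpM2r ?cmod_ge0// !cmodM cmodV !cmodM.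
have B : cmod ga * cmod D / (cmod de * cmod de * cmod (ga * w + de)) <= K.
  apply: (@le_trans _ _ (cmod ga * cmod D / (cmod de * cmod de * (cmod de / 2)))).
    rewrite ler_wpM2l ?mulr_ge0 ?cmod_ge0// lef_pV2 ?posrE ?mulr_gt0 ?divr_gt0//; last by lra.
    by rewrite ler_pM2l// mulr_gt0.
  rewrite /K -subr_ge0.
  have -> : 2 * cmod ga * cmod D / cmod de ^+ 3 + 1 -
    cmod ga * cmod D / (cmod de * cmod de * (cmod de / 2)) = 1 by field; rewrite gt_eqF.
  by [].
apply: le_trans (ler_pM _ (cmod_ge0 _) B (ltW w2)) _.
  by rewrite !(mulr_ge0, invr_ge0, cmod_ge0).
by rewrite mulrC divfK// gt_eqF.
Qed.

Lemma cmod_lt_sq z w : (cmod z < cmod w) = (cmod z ^+ 2 < cmod w ^+ 2).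
Proof. by rewrite ltr_pXn2r ?nnegrE ?cmod_ge0. Qed.

(** |s z + 1|^2 - |z + s|^2 = (1 - s^2) (1 - |z|^2). *)
Lemma disk_translation_lt1 (s : R) z : `|s| < 1 -> cmod z < 1 ->
  (s%:C * z + 1 : Cplane R) != 0 /\ cmod (mobius 1 s%:C s%:C 1 z) < 1.
Proof.
move=> s1 z1.
have s2 : s ^+ 2 < 1 by rewrite -real_normK ?num_real// expr_lt1.
have z2 : cmod z ^+ 2 < 1 by rewrite expr_lt1// cmod_ge0.
have key : cmod (z + s%:C) < cmod (s%:C * z + 1).
  rewrite cmod_lt_sq !cmod_sq; move: z2; rewrite cmod_sq.
  case: z {z1} => x y /= z2.
  rewrite -subr_gt0.
  have -> : (s * x - 0 * y + 1) ^+ 2 + (s * y + 0 * x + 0) ^+ 2 - ((x + s) ^+ 2 + (y + 0) ^+ 2) =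
    (1 - s ^+ 2) * (1 - (x ^+ 2 + y ^+ 2)) by ring.
  by rewrite mulr_gt0// subr_gt0.
have dp : 0 < cmod (s%:C * z + 1) by apply: le_lt_trans key; exact: cmod_ge0.
split; first by rewrite -cmod_gt0.
by rewrite /mobius mul1r cmodM cmodV ltr_pdivrMr// mul1r.
Qed.

Lemma disk_den_neq0 (q : R) z : `|q| < 1 -> cmod z < 1 -> (1 - q%:C * z : Cplane R) != 0.
Proof.
move=> q1 z1; apply/eqP => E.
have : (q%:C * z : Cplane R) = 1 by apply/esym/eqP; rewrite -subr_eq0 E.
move=> /(congr1 (@cmod R)); rewrite cmodM cmod_real cmod1 => h.
have : `|q| * cmod z < 1 by rewrite mulr_ilt1// cmod_ge0.
by rewrite h ltxx.
Qed.

End Mobius.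

Section DiskUpperBound.
Variable R : realType.
Variable d : nat.
Variable Om : set (Cvec R d).
Variables (P N u : Cvec R d) (k q : R).
Hypothesis q1 : `|q| < 1.
Notation mu := (@lebesgue_measure R).

(** The discs [F] of this section have a Moebius coefficient with real parameters along [N] and the
    identity along [u]; [sg] is the image of the real diameter. *)
Let phi (s : R) : R := k * (1 + q * s) / (1 - q * s).
Let F (z : Cplane R) : Cvec R d :=
  P + (k%:C * (1 + q%:C * z) / (1 - q%:C * z) : Cplane R) *: N + z *: u.
Hypothesis FOm : forall z, cmod z < 1 -> Om (F z).
Let sg (s : R) : Cvec R d := P + (phi s)%:C *: N + s%:C *: u.
Let vel (s : R) : Cvec R d := (2 * k * q / (1 - q * s) ^+ 2)%:C *: N + u.

Let den_gt0 s : `|s| < 1 -> 0 < 1 - q * s.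
Proof.
move=> s1; rewrite subr_gt0; apply: le_lt_trans (ler_norm _) _.
by rewrite normrM mulr_ilt1.
Qed.

Let sgF s : sg s = F s%:C.
Proof.
have E : (phi s)%:C = k%:C * (1 + q%:C * s%:C) / (1 - q%:C * s%:C) :> R[i].
  by rewrite /phi rcM rcM rcV rcB rcD !rcM.
by rewrite /sg E.
Qed.

Let is_derive_phi s : `|s| < 1 -> is_derive s (1 : R) phi (2 * k * q / (1 - q * s) ^+ 2).
Proof.
move=> s1; have nz : 1 - q * s != 0 by rewrite gt_eqF// den_gt0.
have h1 : is_derive s (1 : R) (fun s => 1 - q * s) (- q).
  by apply: is_derive_eq; rewrite /GRing.scale/=; ring.
have h2 : is_derive s (1 : R) (fun s => (1 - q * s)^-1) (- (1 - q * s) ^- 2 *: (- q)).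
  have [d1 d2] := h1; apply: DeriveDef; first exact: derivableV.
  by rewrite deriveV// d2.
have h3 : is_derive s (1 : R) (fun s => k * (1 + q * s)) (k * q).
  by apply: is_derive_eq; rewrite /GRing.scale/=; ring.
apply: (is_derive_eq (is_deriveM h3 h2)).
by rewrite /GRing.scale/=; field.
Qed.

Let velocity_sg s : `|s| < 1 -> velocity sg s = vel s.
Proof.
move=> s1; have dp := is_derive_phi s1.
apply: is_derive_velocity => j.
- rewrite (_ : (fun _ => _) = cst (complex.Re (P 0 j)) + (complex.Re (N 0 j) \*: phi)
      + (complex.Re (u 0 j) \*: id)).
    apply: is_derive_eq; rewrite /vel !mxE add0r ReD /GRing.scale/= mulr1.
    by move: (N 0 j) (u 0 j) => [n1 n2] [u1 u2] /=; ring.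
  apply/funext => t.
  rewrite [RHS](_ : _ = complex.Re (P 0 j) + complex.Re (N 0 j) * phi t + complex.Re (u 0 j) * t)//.
  rewrite /sg !mxE !ReD /=.
  by move: (N 0 j) (u 0 j) => [n1 n2] [u1 u2] /=; ring.
- rewrite (_ : (fun _ => _) = cst (complex.Im (P 0 j)) + (complex.Im (N 0 j) \*: phi)
      + (complex.Im (u 0 j) \*: id)).
    apply: is_derive_eq; rewrite /vel !mxE add0r ImD /GRing.scale/= mulr1.
    by move: (N 0 j) (u 0 j) => [n1 n2] [u1 u2] /=; ring.
  apply/funext => t.
  rewrite [RHS](_ : _ = complex.Im (P 0 j) + complex.Im (N 0 j) * phi t + complex.Im (u 0 j) * t)//.
  rewrite /sg !mxE !ImD /=.
  by move: (N 0 j) (u 0 j) => [n1 n2] [u1 u2] /=; ring.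
Qed.

(** F is precomposed with the disc automorphism [mus], which sends 0 to s with derivative 1 - s^2.
    The resulting coefficient of N is simplified to the single Moebius map [h], whose derivative at
    0 can be read off. *)
Let metric_sg s : `|s| < 1 -> kobayashi_metric Om (sg s) (vel s) <= (1 - s ^+ 2)^-1.
Proof.
move=> s1.
have s2 : 0 < 1 - s ^+ 2 by rewrite subr_gt0 -real_normK ?num_real// expr_lt1.
have qs := den_gt0 s1.
pose mus := mobius 1 (s%:C : Cplane R) s%:C 1.
pose h := mobius ((k * (s + q))%:C : Cplane R) (k * (1 + q * s))%:C (s - q)%:C (1 - q * s)%:C.
have nz z : cmod z < 1 -> ((s - q)%:C * z + (1 - q * s)%:C : Cplane R) != 0 /\
    h z = k%:C * (1 + q%:C * mus z) / (1 - q%:C * mus z).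
  move=> z1; have [n1 m1] := disk_translation_lt1 s1 z1.
  have n2 := disk_den_neq0 q1 m1.
  have E : ((s - q)%:C * z + (1 - q * s)%:C : Cplane R) = (s%:C * z + 1) * (1 - q%:C * mobius 1 s%:C s%:C 1 z).
    rewrite /mobius !(rcB, rcM, rc1).
    move: s%:C q%:C n1 => S Q n1; field.
    by [].
  split; first by rewrite E mulf_neq0.
  rewrite /h /mobius E /mus.
  move: n2; rewrite /mobius !(rcB, rcM, rcD, rc1).
  move: s%:C q%:C k%:C n1 => S Q K n1.
  have -> : K * (S + Q) * z + K * (1 + Q * S) = K * (1 + Q * ((1 * z + S) / (S * z + 1))) * (S * z + 1).
    by field.
  move: ((1 * z + S) / (S * z + 1)) => M n2; move: (1 - Q * M) n2 => D n2.
  by field; rewrite ?n1 ?n2.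
have dmus (z : Cplane R) : cmod z < 1 -> differentiable mus z.
  by move=> z1; apply: differentiable_mobius; have [] := disk_translation_lt1 s1 z1.
have dh (z : Cplane R) : cmod z < 1 -> differentiable h z.
  by move=> z1; apply: differentiable_mobius; have [] := nz z z1.
have c0 : cmod (0 : Cplane R) < 1 by rewrite cmod0.
pose g (z : Cplane R) := P + h z *: N + mus z *: u.
pose xi : R[i] := ((1 - s ^+ 2)^-1)%:C.
have xiE : cmod xi = (1 - s ^+ 2)^-1 by rewrite cmod_real ger0_norm// invr_ge0 ltW.
rewrite -xiE; apply: (@kobayashi_metric_le _ _ _ _ _ g).
- by move=> z z1; have [] := affine_disk P N u 0 (dh z z1) (dmus z z1).
- move=> z z1; have [_ hz] := nz z z1; rewrite /g hz; apply: FOm.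
  by have [] := disk_translation_lt1 s1 z1.
- have h0 : h 0 = (phi s)%:C by rewrite /h /mobius !mulr0 !add0r /phi [RHS]rcM rcV.
  have m0 : mus 0 = s%:C by rewrite /mus /mobius !mulr0 !add0r divr1.
  by rewrite /g h0 m0.
- have [_ E] := affine_disk P N u xi (dh 0 c0) (dmus 0 c0).
  have qn : ((1 - q * s)%:C : Cplane R) != 0 by rewrite -cmod_gt0 cmod_real gtr0_norm.
  have D1 : 'd h (0 : Cplane R) xi = (2 * k * q / (1 - q * s) ^+ 2)%:C.
    apply: (etrans (diff_cfirst_order xi (dh 0 c0) (cfirst_order_mobius _ _ _ qn))).
    rewrite -!rcM -rcB expr2 -rcM -rcV -!rcM; congr (_%:C).
    by field; rewrite !gt_eqF.
  have D2 : 'd mus (0 : Cplane R) xi = 1.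
    apply: (etrans (diff_cfirst_order xi (dmus 0 c0) (cfirst_order_mobius _ _ _ (oner_neq0 _)))).
    rewrite expr1n divr1 mulr1 -rcM -{1}rc1 -rcB -rcM -rc1; congr (_%:C).
    by field; rewrite gt_eqF.
  exact: (etrans E (f_equal2 +%R (f_equal (fun c => c *: N) D1)
    (etrans (f_equal (fun c => c *: u) D2) (scale1r u)))).
Qed.

(** The right-hand side is artanh t, the primitive of 1 / (1 - s^2): the length of the radius from 0
    to t in the disc. *)
Lemma kobayashi_dist_le_disk (t : R) : 0 < t -> t < 1 ->
  kobayashi_dist Om (F 0) (F t%:C) <= (ln (1 + t) - ln (1 - t)) / 2.
Proof.
move=> t0 t1.
have st (s : R) : 0 <= s <= t -> `|s| < 1.
  by move=> /andP[s0 s_t]; rewrite ger0_norm// (le_lt_trans s_t).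
pose G (s : R) := (ln (1 + s) - ln (1 - s)) / 2.
have pos (s : R) : `|s| < 1 -> 0 < 1 + s /\ 0 < 1 - s by rewrite ltr_norml => /andP[]; lra.
have dG s : 0 <= s <= t -> is_derive s (1 : R) G (1 - s ^+ 2)^-1.
  move=> /st/pos[p1 p2].
  have l1 : is_derive s (1 : R) (fun s => 1 + s) 1.
    by apply: is_derive_eq; ring.
  have l2 : is_derive s (1 : R) (fun s => 1 - s) (-1).
    by apply: is_derive_eq; ring.
  have d1 := @is_derive1_comp R (@ln R) (fun s => 1 + s) s _ _ (is_derive1_ln p1) l1.
  have d2 := @is_derive1_comp R (@ln R) (fun s => 1 - s) s _ _ (is_derive1_ln p2) l2.
  have d3 := is_deriveZ 2^-1 (is_deriveB d1 d2).
  rewrite (_ : G = 2^-1 \*: ((@ln R \o (fun s => 1 + s)) - (@ln R \o (fun s => 1 - s)))); last first.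
    apply/funext => x; rewrite [RHS](_ : _ = 2^-1 * (ln (1 + x) - ln (1 - x)))//.
    by rewrite /G mulrC.
  apply: (is_derive_eq d3); rewrite /GRing.scale/=.
  have -> : 1 - s ^+ 2 = (1 + s) * (1 - s) by ring.
  by field; rewrite !gt_eqF.
have cg s : 0 <= s <= t -> {for s, continuous (fun s : R => (1 - s ^+ 2)^-1)}.
  move=> /st/pos[p1 p2]; apply: cvgV.
    have -> : 1 - s ^+ 2 = (1 + s) * (1 - s) by ring.
    by rewrite mulf_neq0// gt_eqF.
  by apply: cvgB; [exact: cvg_cst|exact: exprn_continuous].
have E := sint_FTC t0 cg dG.
have len : (kobayashi_length Om 0 t sg <= (G t)%:E)%E.
  have gi := sint_integrable (within_pointwise cg).
  have -> : (G t)%:E = (\int[mu]_(s in `[0%R, t]) ((1 - s ^+ 2)^-1)%:E)%E.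
    have -> : G t = sint (fun s : R => (1 - s ^+ 2)^-1) 0 t.
      by rewrite E /G addr0 subr0 subrr mul0r subr0.
    by rewrite /sint /Rintegral fineK//; exact: (integrable_fin_num _ gi).
  apply: ge0_le_integral_majorant => s; rewrite /= in_itv/= => s0t.
    by rewrite lee_fin kobayashi_metric_ge0.
  by rewrite lee_fin velocity_sg ?st// metric_sg// st.
have ac : absolutely_continuous 0 t sg.
  have q0 : 0 < 1 - `|q| by rewrite subr_gt0.
  set K := (2 * `|k| / (1 - `|q|) ^+ 2) * enorm N + enorm u.
  apply: (@lipschitz_absolutely_continuous _ _ _ _ K) => s s' s0 ss' s't.
  have s1 : `|s| < 1 by apply: st; rewrite s0 (le_trans ss').
  have s'1 : `|s'| < 1 by apply: st; rewrite (le_trans s0).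
  have := den_gt0 s1; have := den_gt0 s'1 => p' p.
  have -> : sg s' - sg s = (phi s' - phi s)%:C *: N + (s' - s)%:C *: u.
    rewrite /sg !rcB !scalerBl opprD addrACA; congr (_ + _).
    by rewrite opprD addrACA subrr add0r.
  apply: le_trans (enormD _ _) _; rewrite !enormZ !cmod_real [`|s' - s|]ger0_norm ?subr_ge0//.
  have -> : K * (s' - s) = 2 * `|k| / (1 - `|q|) ^+ 2 * (s' - s) * enorm N + (s' - s) * enorm u.
    by rewrite /K; field; rewrite gt_eqF.
  rewrite lerD2r ler_wpM2r ?enorm_ge0//.
  have den r : `|r| < 1 -> 1 - `|q| <= 1 - q * r.
    move=> r1; rewrite lerB//; apply: le_trans (ler_norm _) _.
    by rewrite normrM ler_piMr// ltW.
  have -> : phi s' - phi s = 2 * k * q * (s' - s) / ((1 - q * s') * (1 - q * s)).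
    by rewrite /phi; field; rewrite !gt_eqF.
  rewrite !normrM normfV normrM [`|2|]ger0_norm// [`|s' - s|]ger0_norm ?subr_ge0//.
  rewrite [`|1 - q * s'|]gtr0_norm// [`|1 - q * s|]gtr0_norm// [X in _ <= X]mulrAC.
  apply: ler_pM.
  - by rewrite !mulr_ge0// subr_ge0.
  - by rewrite invr_ge0 mulr_ge0// ltW.
  - by rewrite ler_wpM2r ?subr_ge0// ler_piMr ?mulr_ge0// ltW.
  - rewrite lef_pV2 ?posrE ?mulr_gt0 ?exprn_gt0// expr2.
    by rewrite ler_pM ?den// ltW.
have sO s : 0 <= s <= t -> Om (sg s).
  by move=> /st s1; rewrite sgF; apply: FOm; rewrite cmod_real.
have e0 : sg 0 = F 0 by rewrite sgF.
have [_ h] := kobayashi_dist_le (ltW t0) ac sO e0 (sgF t) len.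
exact: h.
Qed.

End DiskUpperBound.

(** * Midpoints in CAT(0) spaces *)

Section ComparisonPlane.
Variable R : realType.

Definition plane_point (a b : R) : 'rV[R]_2 := \row_(j < 2) (if j == ord0 then a else b).

Lemma plane_dist_point a b c e :
  plane_dist (plane_point a b) (plane_point c e) = Num.sqrt ((a - c) ^+ 2 + (b - e) ^+ 2).
Proof. by rewrite /plane_dist !big_ord_recl big_ord0 addr0 !mxE. Qed.

Lemma plane_segment_end (u v : 'rV[R]_2) : plane_segment u v v.
Proof. by exists 1; rewrite ?ler01 ?lexx// subrr scale0r scale1r add0r. Qed.

End ComparisonPlane.

Section Midpoint.
Variables (R : realType) (T : Type) (X : set T) (dist : T -> T -> R).
Hypothesis cat0 : CAT0 X dist.

(** The comparison is applied to the midpoint of one side and to the opposite vertex z, an end point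
    of the other side; the Euclidean median formula then gives the inequality of Bruhat and Tits. *)
Lemma CAT0_midpoint x y : X x -> X y -> 0 < dist x y -> exists m, X m /\
  forall z, X z -> dist m z ^+ 2 <= (dist x z ^+ 2 + dist y z ^+ 2) / 2 - dist x y ^+ 2 / 4.
Proof.
move=> Xx Xy D0; have [[[d0 deq dsym dtri] geo] comp] := cat0.
have [S hS] := geo x y Xx Xy; have [l [u [g [lu gX gd [gl gu] SE]]]] := hS.
set D := dist x y in D0 *.
have DE : D = u - l.
  by rewrite /D -gl -gu gd ?lexx ?lu// distrC ger0_norm// subr_ge0.
set c := (l + u) / 2.
have cI : l <= c <= u by rewrite /c; apply/andP; split; lra.
exists (g c); split; first exact: gX.
have xm : dist x (g c) = D / 2.
  by rewrite -gl gd ?lexx ?lu// distrC ger0_norm ?DE /c; lra.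
move=> z Xz.
have [Syz hyz] := geo y z Xy Xz; have [Szx hzx] := geo z x Xz Xx.
set A := dist x z; set B := dist y z.
have A0 : 0 <= A by exact: d0.
have B0 : 0 <= B by exact: d0.
have t1 : D <= A + B by rewrite /B [dist y z]dsym//; exact: dtri.
have t2 : A <= D + B by exact: dtri.
have t3 : B <= D + A by rewrite /D [dist x y]dsym//; exact: dtri.
(* The comparison triangle has vertices (0, 0), (D, 0) and (p, h), with p from the law of
   cosines. *)
pose p := (A ^+ 2 + D ^+ 2 - B ^+ 2) / (2 * D).
have pD : 2 * D * p = A ^+ 2 + D ^+ 2 - B ^+ 2 by rewrite /p mulrC divfK// mulf_neq0// gt_eqF.
have D2 : 0 < 2 * D by rewrite mulr_gt0.
have pA : p ^+ 2 <= A ^+ 2.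
  have h1 : p <= A by rewrite -(ler_pM2l D2) pD; nra.
  have h2 : - A <= p by rewrite -(ler_pM2l D2) pD; nra.
  by nra.
pose h := Num.sqrt (A ^+ 2 - p ^+ 2).
have h2 : h ^+ 2 = A ^+ 2 - p ^+ 2 by rewrite sqr_sqrtr// subr_ge0.
pose a' := plane_point (0 : R) 0; pose b' := plane_point D 0; pose c' := plane_point p h.
have e1 : plane_dist a' b' = D.
  by rewrite plane_dist_point subrr sub0r sqrrN expr0n addr0 sqrtr_sqr gtr0_norm.
have e2 : plane_dist b' c' = B.
  rewrite plane_dist_point sub0r sqrrN h2 (_ : _ + _ = B ^+ 2); last by lra.
  by rewrite sqrtr_sqr ger0_norm.
have e3 : plane_dist c' a' = A.
  rewrite plane_dist_point !subr0 h2 addrC subrK.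
  by rewrite sqrtr_sqr ger0_norm.
have Sz : Szx z.
  have [l' [u' [g' [lu' _ _ [gl' _] ->]]]] := hzx.
  by exists l' => //=; rewrite in_itv/= lexx.
have Sm : S (g c) by rewrite SE; exists c => //=; rewrite in_itv.
have seg : plane_segment a' b' (plane_point (D / 2) 0).
  exists (1 / 2); first by apply/andP; split; lra.
  by apply/rowP => j; rewrite !mxE; case: ifP => _; lra.
have e4 : plane_dist a' (plane_point (D / 2) 0) = dist x (g c).
  by rewrite plane_dist_point subrr sub0r sqrrN expr0n addr0 sqrtr_sqr ger0_norm ?xm// divr_ge0// ltW.
have e5 : plane_dist a' c' = dist x z.
  by rewrite plane_dist_point !sub0r !sqrrN h2 addrC subrK sqrtr_sqr ger0_norm.
have e3' : plane_dist c' a' = dist z x by rewrite e3 /A dsym.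
have := comp x y z S Syz Szx Xx Xy Xz hS hyz hzx (g c) z Sm Sz a' b' c' _ c'
  e1 e2 e3' seg (plane_segment_end _ _) e4 e5.
rewrite plane_dist_point sub0r sqrrN h2 => le.
have nn : 0 <= (D / 2 - p) ^+ 2 + (A ^+ 2 - p ^+ 2) by rewrite addr_ge0 ?sqr_ge0// subr_ge0.
have : dist (g c) z ^+ 2 <= Num.sqrt ((D / 2 - p) ^+ 2 + (A ^+ 2 - p ^+ 2)) ^+ 2.
  by rewrite ler_pXn2r ?nnegrE ?sqrtr_ge0// d0//; exact: gX.
rewrite sqr_sqrtr//; lra.
Qed.

(* Both points are close to the midpoint of x and y, by the comparison with the
   Euclidean median. *)
Lemma CAT0_approximate_midpoints x y m1 m2 (L L' : R) : X x -> X y -> X m1 -> X m2 ->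
  0 < L' -> 2 * L' <= dist x y ->
  dist x m1 <= L -> dist y m1 <= L -> dist x m2 <= L -> dist y m2 <= L ->
  dist m1 m2 <= 2 * Num.sqrt (L ^+ 2 - L' ^+ 2).
Proof.
move=> Xx Xy X1 X2 L0 LD x1 y1 x2 y2.
have [[[d0 deq dsym dtri] _] _] := cat0.
have D0 : 0 < dist x y by apply: lt_le_trans LD; rewrite mulr_gt0.
have [m [Xm hm]] := CAT0_midpoint Xx Xy D0.
have key z : X z -> dist x z <= L -> dist y z <= L -> dist m z <= Num.sqrt (L ^+ 2 - L' ^+ 2).
  move=> Xz xz yz; have h := hm z Xz.
  have hx : dist x z ^+ 2 <= L ^+ 2.
    by rewrite ler_pXn2r ?nnegrE ?d0// (le_trans (d0 _ _ Xx Xz) xz).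
  have hy : dist y z ^+ 2 <= L ^+ 2.
    by rewrite ler_pXn2r ?nnegrE ?d0// (le_trans (d0 _ _ Xy Xz) yz).
  have hD : 4 * L' ^+ 2 <= dist x y ^+ 2.
    have -> : 4 * L' ^+ 2 = (2 * L') ^+ 2 by ring.
    by rewrite ler_pXn2r ?nnegrE ?d0// mulr_ge0// ltW.
  rewrite -(ler_pXn2r (ltn0Sn 1)) ?nnegrE ?d0 ?sqrtr_ge0//.
  have mz : 0 <= dist m z ^+ 2 by exact: sqr_ge0.
  by rewrite sqr_sqrtr; lra.
have := dtri m1 m m2 X1 Xm X2; have := key m1 X1 x1 y1; have := key m2 X2 x2 y2.
by rewrite [dist m1 m]dsym//; lra.
Qed.

End Midpoint.

(** * Separation and non-flatness *)

Section EuclideanTopology.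
Variable R : realType.
Variable d : nat.
Implicit Types (A Om : set (Cvec R d)) (x y z w : Cvec R d).

Lemma nbhs_enorm_ball x (e : R) : 0 < e -> nbhs x [set y : Cvec R d | enorm (y - x) < e].
Proof.
move=> e0; apply: open_nbhs_nbhs; split; last by rewrite /= subrr enorm0.
apply/open_enormP => y /= ye; exists (e - enorm (y - x)); first by rewrite subr_gt0.
move=> z; rewrite ltrBrDr => zy; apply: le_lt_trans zy.
by apply: le_trans (enormD _ _); rewrite addrA subrK.
Qed.

Lemma closure_enormP A x :
  closure A x <-> forall e : R, 0 < e -> exists2 y, A y & enorm (y - x) < e.
Proof.
split=> [cx e e0|h B].
  by have [y [Ay By]] := cx _ (nbhs_enorm_ball x e0); exists y.
rewrite nbhsE => -[U [oU Ux] UB].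
have [e e0 he] := (open_enormP U).1 oU x Ux.
by have [y Ay ye] := h e e0; exists y; split => //; exact/UB/he.
Qed.

Lemma lipschitz_enorm_continuous (f : Cvec R d -> R) (K : R) :
  (forall x y, `|f y - f x| <= K * enorm (y - x)) -> continuous f.
Proof.
move=> lip x; apply/(@cvgrPdist_lt _ _ _ (nbhs x) (nbhs_filter x)) => e e0.
have K0 : 0 < `|K| + 1 by rewrite ltr_wpDl.
have nB := nbhs_enorm_ball x (divr_gt0 e0 K0).
suff S : [set y : Cvec R d | enorm (y - x) < e / (`|K| + 1)] `<=` [set y | `|f x - f y| < e].
  exact: (@filterS _ (nbhs x) (nbhs_filter x) _ _ S nB).
move=> y /=; rewrite ltr_pdivlMr// distrC => ye.
apply: le_lt_trans (lip x y) _; apply: le_lt_trans ye; rewrite mulrC ler_wpM2l ?enorm_ge0//.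
by rewrite (le_trans (ler_norm K))// lerDl.
Qed.

Lemma enorm_dist_lipschitz x y : `|enorm y - enorm x| <= enorm (y - x).
Proof.
rewrite ler_norml; apply/andP; split.
  have := enormD (x - y) y; rewrite subrK (enormB x); lra.
have := enormD (y - x) x; rewrite subrK; lra.
Qed.

Lemma ReIm_box_compact (M : R) :
  compact [set z : Cplane R | `|complex.Re z| <= M /\ `|complex.Im z| <= M].
Proof.
have -> : [set z : Cplane R | `|complex.Re z| <= M /\ `|complex.Im z| <= M] =
    (fun p : R * R => p.1 +i* p.2 : Cplane R) @` (`[- M, M] `*` `[- M, M]).
  apply/seteqP; split => [z /= [z1 z2]|_ [[p q] /= [p1 p2] <-]].
    exists (complex.Re z, complex.Im z); last by case: z {z1 z2}.
    by rewrite /= !in_itv/= -!ler_norml.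
  by move: p1 p2; rewrite !in_itv/= -!ler_norml.
apply: continuous_compact; last by apply: compact_setX; exact: segment_compact.
apply: continuous_subspaceT => -[p q].
apply/cvgrPdist_lt => e' e'0; have [e e0 ->] := posC_real e'0.
have e2 : 0 < e / 2 by rewrite divr_gt0.
exists (ball p (e / 2), ball q (e / 2)) => /=; first by split; apply: nbhsx_ballx.
move=> [p' q'] /= []; rewrite -!ball_normE/= => h1 h2.
rewrite normC_cmod ltcR; apply: le_lt_trans (cmod_le_ReIm _) _ => /=; lra.
Qed.

Lemma coord_box_compact (M : R) : compact [set y : Cvec R d | forall j, 
  [set z : Cplane R | `|complex.Re z| <= M /\ `|complex.Im z| <= M] (y ord0 j)].
Proof. exact: (@rV_compact (Cplane R) d (fun=> _) (fun=> @ReIm_box_compact M)). Qed.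

(** K may be unbounded, but only its part in a box containing all points at least as close to c as
    [k0] matters, and that part is compact. *)
Lemma nearest_point (K : set (Cvec R d)) c : closed K -> K !=set0 ->
  exists2 b, K b & forall y, K y -> enorm (c - b) <= enorm (c - y).
Proof.
move=> cK [k0 Kk0].
pose M := enorm c + enorm (c - k0).
pose Box := [set y : Cvec R d | forall j, 
  [set z : Cplane R | `|complex.Re z| <= M /\ `|complex.Im z| <= M] (y ord0 j)].
have inBox y : enorm (c - y) <= enorm (c - k0) -> Box y.
  move=> h j; have yM : cmod (y ord0 j) <= M.
    apply: le_trans (coord_le_enorm y j) _; rewrite -(subrK c y) addrC.
    by apply: le_trans (enormD _ _) _; rewrite lerD2l enormB.
  by split; apply: le_trans yM; [exact: Re_le_cmod|exact: Im_le_cmod].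
have cB : compact (K `&` Box).
  by apply: (@subclosed_compact _ _ Box); [exact: closedI cK (compact_closed _ (@coord_box_compact M))|exact: coord_box_compact|].
have ne : K `&` Box !=set0 by exists k0; split => //; exact: inBox.
have cf : continuous (fun y : Cvec R d => enorm (c - y)).
  apply: (@lipschitz_enorm_continuous _ 1) => x y; rewrite mul1r.
  apply: le_trans (enorm_dist_lipschitz _ _) _.
  by rewrite opprB addrC addrA subrK enormB.
have [b /set_mem[Kb _] hb] := compact_EVT_min ne cB (continuous_subspaceT cf).
exists b => // y Ky; have [h|/ltW h] := leP (enorm (c - y)) (enorm (c - k0)).
  by apply: hb; rewrite inE; split => //; exact: inBox.
by apply: le_trans h; apply: hb; rewrite inE; split => //; exact: inBox.
Qed.

End EuclideanTopology.

Section Separation.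
Variable R : realType.
Variable d : nat.
Implicit Types (Om : set (Cvec R d)) (x y z w b c n u v N : Cvec R d).

(** Turns a real normal vector into the coefficients of the complex functional whose real part is
    the inner product with it. *)
Definition conjv n : Cvec R d := \row_j (complex.Re (n 0 j) -i* complex.Im (n 0 j)).

Lemma Re_cdot_conjv y n : complex.Re (cdot y (conjv n)) = ipr y n.
Proof.
rewrite /cdot /ipr (big_morph (@complex.Re R) (id1 := 0) (op1 := +%R))//; last exact: ReD.
by apply: eq_bigr => j _; rewrite mxE; case: (y 0 j) (n 0 j) => [p q] [p' q'] /=; ring.
Qed.

(** The closure point is replaced by a nearby point of Om, and the error is absorbed by the ball
    around y. *)
Lemma closure_convexE Om e y (rho t : R) : convex_set Om -> closure Om e -> 0 < rho ->
  (forall w, enorm w < rho -> Om (y + w)) -> 0 < t < 1 ->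
  Om ((1 - t)%:C *: y + t%:C *: e).
Proof.
move=> cOm /closure_enormP ce rho0 hy /andP[t0 t1].
have t1' : 0 < 1 - t by rewrite subr_gt0.
have [e2 Oe2 e2e] := ce _ (divr_gt0 (mulr_gt0 rho0 t1') t0).
have Oy : Om (y + (t / (1 - t))%:C *: (e - e2)).
  apply: hy; rewrite enormZ cmod_real gtr0_norm ?divr_gt0// enormB.
  by move: e2e; rewrite ltr_pdivlMr// => h; rewrite mulrAC ltr_pdivrMr// mulrC.
have := convexE cOm Oy Oe2 (t := t); rewrite !ltW// => /(_ isT).
congr Om; apply/rowP => j; rewrite !mxE; field.
by rewrite -rcB (inj_eq (@complexI R)) gt_eqF.
Qed.

Lemma linear_coef_ge0 (a q : R) : 0 <= q ->
  (forall t, 0 < t < 1 -> 0 <= 2 * a + t * q) -> 0 <= a.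
Proof.
move=> q0 h; rewrite leNgt; apply/negP => a0.
have den : 0 < q + 1 - a by lra.
have t0 : 0 < - a / (q + 1 - a) by rewrite divr_gt0 ?oppr_gt0.
have E : - a / (q + 1 - a) * (q + 1 - a) = - a by rewrite divfK// gt_eqF.
have := h (- a / (q + 1 - a)); rewrite t0 ltr_pdivrMr//= => /(_ ltac:(lra)).
by move: t0 E; set t := _ / _ => t0 E; nra.
Qed.

Lemma ipr_le_enorm x y : enorm x <= enorm y -> ipr x x <= ipr y y.
Proof. by move=> h; rewrite !ipr_enorm ler_pXn2r ?nnegrE ?enorm_ge0. Qed.

(** The functional is the inner product with b - e, where b is the point of the closure nearest to
    e; its sign on y - b is the first-order condition along the segment from b to y. *)
Lemma separation Om e : convex_set Om -> Om !=set0 -> ~ closure Om e ->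
  exists v, forall y, Om y -> 0 < complex.Re (cdot (y - e) v).
Proof.
move=> cOm [y0 Oy0] ne.
have [b cb hb] := @nearest_point _ _ (closure Om) e (@topology_structure.closed_closure _ _)
  (ex_intro _ y0 (@subset_closure _ Om y0 Oy0)).
exists (conjv (b - e)) => y Oy; rewrite Re_cdot_conjv.
have be : 0 < enorm (b - e) ^+ 2.
  have bne : b - e != 0.
    by apply: contra_notN ne => /eqP E; have <- : b = e by exact: subr0_eq.
  by apply: exprn_gt0; rewrite lt_def enorm_ge0 andbT enorm_eq0.
have key (t : R) : 0 < t < 1 -> enorm (b - e) <= enorm (b - e + t%:C *: (y - b)).
  move=> /andP[t0 t1]; apply/ler_addgt0Pr => eps eps0.
  have [b' Ob' b'b] := (closure_enormP Om b).1 cb eps eps0.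
  have /subset_closure/hb h : Om ((1 - t)%:C *: b' + t%:C *: y).
    by apply: (convexE cOm Ob' Oy); rewrite (ltW t0) (ltW t1).
  rewrite enormB; apply: le_trans h _; rewrite enormB.
  have -> : (1 - t)%:C *: b' + t%:C *: y - e =
    b - e + t%:C *: (y - b) + (1 - t)%:C *: (b' - b).
    by apply/rowP => j; rewrite !mxE; ring.
  apply: (le_trans (enormD (b - e + t%:C *: (y - b)) _)).
  have t1' : 0 < 1 - t by rewrite subr_gt0.
  rewrite lerD2l enormZ cmod_real (gtr0_norm t1'); apply: le_trans (ltW b'b).
  have t1'' : 1 - t <= 1 by rewrite gerBl ltW.
  exact: (ler_piMl (enorm_ge0 _) t1'').
clear hb; have pos : 0 <= ipr (y - b) (b - e).
  apply: (linear_coef_ge0 (sqr_ge0 (enorm (y - b)))) => t t01.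
  have t0 : 0 < t by case/andP: t01.
  rewrite -(pmulr_rge0 _ t0); move: (ipr_le_enorm (key t t01)); rewrite -ipr_enorm.
  rewrite !(iprDl _ (_ *: _)) !(iprDr _ (_ *: _)) !iprZl !iprZr [ipr (b - e) (y - b)]iprC; lra.
have -> : y - e = (y - b) + (b - e) by rewrite addrA subrK.
by rewrite iprDl ipr_enorm ltr_wpDl.
Qed.

(** If some z in Om were on the wrong side of the tangent hyperplane at b, the line from z through b
    would enter the ball just beyond b, and convexity would put b in Om. Openness makes the
    inequality strict. *)
Lemma ball_tangent Om b N : convex_domain Om -> ~ Om b -> N != 0 ->
  (forall w, enorm w < enorm N -> Om (b + N + w)) ->
  forall w, Om w -> 0 < complex.Re (cdot (w - b) (conjv N)).
Proof.
move=> [_ oOm cOm] nb N0 hN w Ow; rewrite Re_cdot_conjv.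
have neg z : Om z -> 0 <= ipr (z - b) N.
  move=> Oz; rewrite leNgt; apply/negP => neg; set a := ipr _ _ in neg; apply: nb.
  set q := enorm (z - b) ^+ 2; have q0 : 0 <= q by rewrite exprn_ge0// enorm_ge0.
  (* From b to b - s (z - b), the squared distance to the centre b + N changes by s (2 a + s q) = s
     (a - s) < 0. *)
  pose s := - a / (q + 1); have q1 : 0 < q + 1 by lra.
  have s0 : 0 < s by rewrite divr_gt0// oppr_gt0.
  have sE : s * (q + 1) = - a by rewrite divfK// gt_eqF.
  have Oc : Om (b + N + (- N - s%:C *: (z - b))).
    apply: hN; rewrite -(ltr_pXn2r (ltn0Sn 1)) ?nnegrE ?enorm_ge0//.
    rewrite -opprD enormN -!ipr_enorm !iprDl !iprDr !iprZl !iprZr [ipr N (z - b)]iprC.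
    by rewrite [ipr (z - b) (z - b)]ipr_enorm -/a -/q; nra.
  have s1 : 0 < 1 + s by lra.
  have := convexE cOm Oz Oc (t := (1 + s)^-1).
  rewrite invr_ge0 ltW//= invf_le1// lerDl ltW// => /(_ isT); congr Om.
  apply/rowP => j; rewrite !mxE; field.
  by rewrite -rc1 -rcD (inj_eq (@complexI R)) gt_eqF.
have [e e0 he] := (open_enormP Om).1 oOm w Ow.
have N1 : 0 < enorm N by rewrite lt_def enorm_ge0 andbT enorm_eq0.
pose t := e / (2 * enorm N).
have t0 : 0 < t by rewrite divr_gt0// mulr_gt0.
have /neg : Om (w - t%:C *: N).
  apply: he; rewrite addrAC subrr add0r enormN enormZ cmod_real gtr0_norm// /t.
  by rewrite invfM mulrA divfK ?gt_eqF//; lra.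
have -> : w - t%:C *: N - b = w - b + (- t)%:C *: N by apply/rowP => j; rewrite !mxE; ring.
rewrite iprDl iprZl ipr_enorm => h.
by apply: lt_le_trans (_ : t * enorm N ^+ 2 <= _); [rewrite mulr_gt0// exprn_gt0|lra].
Qed.

End Separation.

(** * Exclusion of large slices in CAT(0) domains *)

Section MobiusBounds.
Variable R : realType.

(** The real part is (1 - |w|^2) / |1 - w|^2, which is at least (1 - r) / (1 + r). *)
Lemma cayley_bounds (w : R[i]) (r : R) : 0 <= r -> r < 1 -> cmod w <= r ->
  (1 - r) / 2 <= complex.Re ((1 + w) / (1 - w)) /\ cmod ((1 + w) / (1 - w)) <= 2 / (1 - r).
Proof.
move=> r0 r1 wr.
have r1' : 0 < 1 - r by rewrite subr_gt0.
have den : 1 - r <= cmod (1 - w).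
  have := cmodD (1 - w) w; rewrite subrK cmod1; lra.
have nz : 1 - w != 0 by rewrite -cmod_gt0; lra.
have up : cmod (1 - w) <= 1 + r by have := cmodD 1 (- w); rewrite cmodN cmod1; lra.
split; last first.
  rewrite cmodM cmodV; apply: ler_pM; rewrite ?invr_ge0 ?cmod_ge0//.
    by have := cmodD 1 w; rewrite cmod1; lra.
  by rewrite lef_pV2 ?posrE//; lra.
have E : (1 + w) / (1 - w) * (1 - w) = 1 + w by rewrite divfK.
move: E; move: ((1 + w) / (1 - w)) => z E.
have D : cmod (1 - w) ^+ 2 <= (1 + r) ^+ 2 by rewrite ler_pXn2r ?nnegrE ?cmod_ge0//; lra.
have W : cmod w ^+ 2 <= r ^+ 2 by rewrite ler_pXn2r ?nnegrE ?cmod_ge0//.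
have D0 : 0 < cmod (1 - w) ^+ 2 by rewrite exprn_gt0//; lra.
move: D W D0 E; rewrite !cmod_sq; case: w {wr den nz up} => a b; case: z => x y /=.
rewrite !expr2 => D W D0 [E1 E2].
set K := _ + _ in D D0.
have xK : x * K = 1 - (a * a + b * b).
  transitivity ((1 - a) * (x * (1 - a) - y * (0 - b)) + (0 - b) * (x * (0 - b) + y * (1 - a))).
    by rewrite /K; ring.
  by rewrite E1 E2; ring.
rewrite leNgt; apply/negP => xr.
have : x * K <= (1 - r) / 2 * ((1 + r) * (1 + r)) by apply: ler_pM => //; nra.
rewrite xK; nra.
Qed.

(** The Moebius value zeta satisfies Re zeta >= s^5 and |zeta|^2 <= s^6; in the expansion of |2 zeta
    - s^6 - 1|^2 the term - 4 Re zeta outweighs 4 |zeta|^2 and the contributions of s^6. *)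
Lemma mobius_in_disk (s k q : R) (z : R[i]) : 0 < s -> s <= 12^-1 ->
  s ^+ 4 / 3 <= k -> k <= 3 * s ^+ 4 -> `|q| <= 1 - 6 * s -> cmod z < 1 ->
  cmod (2 * (k%:C * (1 + q%:C * z) / (1 - q%:C * z)) - (s ^+ 6)%:C - 1) < 1.
Proof.
move=> s0 s1 k1 k2 q1 z1.
have k0 : 0 < k by apply: lt_le_trans k1; rewrite divr_gt0// exprn_gt0.
have qz : cmod (q%:C * z) <= 1 - 6 * s.
  rewrite cmodM cmod_real; apply: le_trans q1; rewrite ler_piMr// ltW//.
have [||A B] := cayley_bounds _ _ qz; [lra|lra|].
rewrite -mulrA; move: A B; move: ((1 + q%:C * z) / (1 - q%:C * z)) => Z A B.
have x1 : s ^+ 5 <= complex.Re (k%:C * Z).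
  have -> : complex.Re (k%:C * Z) = k * complex.Re Z by case: (Z) => a b /=; ring.
  apply: (@le_trans _ _ (s ^+ 4 / 3 * (3 * s))); first by rewrite exprSr; lra.
  by apply: ler_pM => //; [rewrite divr_ge0// exprn_ge0// ltW|lra|lra].
have m1 : cmod (k%:C * Z) <= s ^+ 3.
  rewrite cmodM cmod_real gtr0_norm//.
  have -> : s ^+ 3 = 3 * s ^+ 4 * (2 / (6 * s)) by field; rewrite gt_eqF.
  apply: ler_pM => //; [exact: ltW|exact: cmod_ge0|].
  by rewrite [X in 2 / X](_ : _ = 1 - (1 - 6 * s))//; ring.
have m2 : cmod (k%:C * Z) ^+ 2 <= s ^+ 6.
  by rewrite (_ : 6 = 3 * 2)%N// exprM ler_pXn2r ?nnegrE ?cmod_ge0// exprn_ge0// ltW.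
rewrite -(ltr_pXn2r (ltn0Sn 1)) ?nnegrE ?cmod_ge0// expr1n.
move: x1 m2; rewrite !cmod_sq; case: (k%:C * Z) => x y /= x1 m2.
have p5 : 0 < s ^+ 5 by rewrite exprn_gt0.
have E6 : s ^+ 6 = s * s ^+ 5 by rewrite exprS.
move: m2; rewrite E6; set p := s ^+ 5 in x1 p5 *; move=> m2.
have p1 : p <= 1 by rewrite exprn_ile1//; lra.
have sp : s * p <= 12^-1 * 1 by apply: ler_pM => //; exact: ltW.
nra.
Qed.

End MobiusBounds.

Section Flatness.
Variable R : realType.
Variable d : nat.
Implicit Types (Om : set (Cvec R d)) (b N u : Cvec R d).

(** The point is the midpoint of b + e N + 2 om u, in the given disc, and of b + (2 zeta - e) N, in
    the ball about b + N. *)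
Lemma half_average Om b N u (e : R) (zeta om : R[i]) : convex_set Om ->
  (forall w, enorm w < enorm N -> Om (b + N + w)) -> N != 0 ->
  (forall om, cmod om < 4^-1 -> Om (b + e%:C *: N + om *: u)) ->
  cmod (2 * zeta - e%:C - 1) < 1 -> cmod om < 8^-1 ->
  Om (b + zeta *: N + om *: u).
Proof.
move=> cOm hN N0 hu hz ho.
have O1 : Om (b + e%:C *: N + (2 * om) *: u).
  by apply: hu; rewrite cmodM (_ : 2 = (2 : R)%:C) ?cmod_real ?ger0_norm ?rmorph_nat//; lra.
have O2 : Om (b + N + (2 * zeta - e%:C - 1) *: N).
  apply: hN; rewrite enormZ; apply: (lt_le_trans _ (lexx _)).
  have : 0 < enorm N by rewrite lt_def enorm_ge0 andbT enorm_eq0.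
  by move=> N1; rewrite gtr_pMl.
have := convexE cOm O1 O2 (t := 2^-1); rewrite invr_ge0 ler0n invf_le1// ler1n => /(_ isT).
congr Om; apply/rowP => j; rewrite !mxE; field.
by [].
Qed.

(** [L] is artanh (1 / 2), the bound for the distances from x and y to the almost-midpoints; [c0]
    bounds from below the distance between these, with 64 / 63 = 4 / (4 - 1 / 16). *)
Let L : R := (ln (1 + 2^-1) - ln (1 - 2^-1)) / 2.
Let c0 : R := ln (64 / 63) / 2.

Lemma artanh_gap (r : R) : 2^-1 <= r -> r <= 1 ->
  let Lr := (ln (1 + r / 2) - ln (1 - r / 2)) / 2 in
  [/\ 0 < Lr, Lr <= L & L - Lr <= 1 - r].
Proof.
move=> r0 r1 Lr; rewrite /Lr /L.
have lip (p q : R) : 2^-1 <= p -> q <= p -> 2^-1 <= q -> ln p - ln q <= 2 * (p - q).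
  move=> p1 qp q1; apply: (le_trans (ler_norm _)).
  have h2 : (0 : R) < 2^-1 by rewrite invr_gt0.
  by have := ln_lipschitz h2 p1 q1; rewrite invrK (ger0_norm (_ : 0 <= p - q)) ?subr_ge0.
have A : ln (1 + 2^-1) - ln (1 + r / 2) <= 2 * (1 + 2^-1 - (1 + r / 2)) by apply: lip; lra.
have B : ln (1 - r / 2) - ln (1 - 2^-1) <= 2 * (1 - r / 2 - (1 - 2^-1)) by apply: lip; lra.
have C : ln (1 - r / 2) < ln (1 + r / 2) by rewrite ltr_ln ?posrE; lra.
have A' : ln (1 + r / 2) <= ln (1 + 2^-1) by rewrite ler_ln ?posrE; lra.
have B' : ln (1 - 2^-1) <= ln (1 - r / 2) by rewrite ler_ln ?posrE; lra.
by split; lra.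
Qed.

Lemma ln_dist_ge (m A t X Y : R) : 0 < m -> 0 < A -> 0 < t ->
  X = m * t * A -> Y = m / t * A -> - ln t <= `|ln X - ln Y| / 2.
Proof.
move=> m0 A0 t0 -> ->; rewrite !lnM ?posrE ?mulr_gt0 ?invr_gt0// lnV ?posrE//.
rewrite -normrN ler_pdivlMr//; apply: le_trans (ler_norm _); lra.
Qed.

Lemma ln_dist_64_63 (a : R) : 0 < a -> c0 <= `|ln (4 * a) - ln (63 / 16 * a)| / 2.
Proof.
move=> a0; rewrite ler_pM2r ?invr_gt0//; apply: le_trans (ler_norm _).
by rewrite -ln_div ?posrE ?mulr_gt0// -mulf_div divff ?gt_eqF// mulr1 invf_div mulrA -natrM.
Qed.

Lemma half_ln_64_63_gt0 : 0 < c0.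
Proof.
apply: divr_gt0 => //; apply: ln_gt0.
by rewrite ltr_pdivlMr// mul1r ltr_nat.
Qed.

(** As L^2 - Lr^2 <= 6 s * 2 L, the square of the right-hand side is at most 48 L s, hence at most
    half of c0^2. *)
Lemma artanh_sqrt_gap (Lr s : R) : 0 < s -> 96 * L * s <= c0 ^+ 2 -> 0 < Lr -> Lr <= L ->
  L - Lr <= 6 * s -> ~ c0 <= 2 * Num.sqrt (L ^+ 2 - Lr ^+ 2).
Proof.
move: half_ln_64_63_gt0; move: L c0 => l c c00 s0 ls Lr0 LrL gap.
have D0 : 0 <= l ^+ 2 - Lr ^+ 2 by rewrite subr_ge0 ler_pXn2r ?nnegrE//; lra.
have l0 : 0 < l by apply: lt_le_trans LrL.
rewrite -(ler_pXn2r (ltn0Sn 1)) ?nnegrE ?mulr_ge0 ?sqrtr_ge0 ?(ltW c00)//.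
rewrite exprMn sqr_sqrtr// => h.
have : (l - Lr) * (l + Lr) <= 6 * s * (2 * l) by apply: ler_pM; lra.
have : 0 < l * s by rewrite mulr_gt0.
move: h ls; rewrite !expr2; lra.
Qed.

(* If b + e N were the centre of such a disc, the points x and y below would have
   the two almost-midpoints m1 = b + s^4 N and m2 = m1 + u / 16, both at distance
   at most L = artanh (1/2) from x and from y: the discs through them stay in the
   half-way average of the given disc and the given ball.  The functional
   tangent to the ball at b gives 2 artanh (r/2) <= d(x, y), and a functional
   separating m1 + 4 u from Om keeps m1 and m2 at distance ln (64/63) / 2. *)
Lemma not_flat Om b N u (s : R) : 0 < s -> s <= 12^-1 -> 96 * L * s <= c0 ^+ 2 -> 
  convex_domain Om -> CAT0 Om (kobayashi_dist Om) -> ~ Om b -> N != 0 ->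
  (forall w, enorm w < enorm N -> Om (b + N + w)) -> ~ Om (b + N + u) ->
  ~ (forall om, cmod om < 4^-1 -> Om (b + (s ^+ 6)%:C *: N + om *: u)).
Proof.
move=> s0 s1 sL cdOm cat0 nb N0 hN nu hu; have [neOm oOm cOm] := cdOm.
have En : 0 < enorm N by rewrite lt_def enorm_ge0 andbT enorm_eq0.
have s11 : s <= 1 by lra.
pose r := 1 - 6 * s; pose m := s ^+ 4.
have m0 : 0 < m by rewrite exprn_gt0.
have mle : m <= 12^-1.
  by apply: le_trans s1; rewrite /m exprSr ler_piMl ?(ltW s0)// exprn_ile1 ?(ltW s0).
have r0 : 2^-1 <= r by rewrite /r; lra.
have r1 : r < 1 by rewrite /r; lra.
pose Lr : R := (ln (1 + r / 2) - ln (1 - r / 2)) / 2.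
have [Lr0 LrL LLr] : [/\ 0 < Lr, Lr <= L & L - Lr <= 1 - r] := artanh_gap r0 (ltW r1).
have gap : L - Lr <= 6 * s by move: LLr; rewrite /r subKr.
have p1 : 0 < 1 - r / 2 by lra.
have p2 : 0 < 1 + r / 2 by lra.
have mm : 0 < 3 / 2 - m by lra.
(* On the segment from b + 3 / 2 N to m1 + 4 u, the coefficient of N equals 1 at the parameter t,
   and that of u is then 4 t >= 1. *)
pose t := 2^-1 / (3 / 2 - m).
have tE : t * (3 / 2 - m) = 2^-1 by rewrite /t divfK// gt_eqF.
have t0 : 0 < t by rewrite divr_gt0.
have tlo : 3^-1 <= t by rewrite /t ler_pdivlMr//; lra.
have thi : t < 1 by rewrite /t ltr_pdivrMr//; lra.
have t4 : 0 <= (4 * t)^-1 <= 1 by rewrite invr_ge0 invf_le1; lra.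
(* From the heights m x1 and m / x1, the discs with q = r and q = - r respectively reach the height
   m at the parameter 1 / 2. *)
pose x1 := (1 - r / 2) / (1 + r / 2).
have lnx1 : - ln x1 = 2 * Lr.
  by rewrite /x1 /Lr (ln_div p1 p2); field.
have x1lo : 3^-1 <= x1 by rewrite /x1 ler_pdivlMr; lra.
have x1hi : x1 <= 1 by rewrite /x1 ler_pdivrMr; lra.
have x10 : 0 < x1 by apply: lt_le_trans x1lo; rewrite invr_gt0.
(* v = 0 leads to m1 and v = u / 8 to m2, displaced by u / 16 at the parameter 1 / 2. *)
have disc k q (v : Cvec R d) (z : Cplane R) : m / 3 <= k -> k <= 3 * m -> `|q| = r -> cmod z < 1 ->
    v = 0 \/ v = (8^-1)%:C *: u ->
    Om (b + (k%:C * (1 + q%:C * z) / (1 - q%:C * z)) *: N + z *: v).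
  move=> k1 k2 qr z1 hv.
  have qr' : `|q| <= 1 - 6 * s by rewrite qr.
  have hz := mobius_in_disk s0 s1 k1 k2 qr' z1.
  case: hv => ->.
    rewrite scaler0 -(scale0r u); apply: (half_average cOm hN N0 hu hz).
    by rewrite cmod0 invr_gt0.
  rewrite scalerA; apply: (half_average cOm hN N0 hu hz).
  rewrite cmodM cmod_real gtr0_norm ?invr_gt0//; lra.
pose P k : Cvec R d := b + k%:C *: N.
have OP k : m / 3 <= k -> k <= 3 * m -> Om (P k).
  move=> k1 k2; have := @disc k r 0 0 k1 k2; rewrite cmod0 ger0_norm; last lra.
  move=> /(_ erefl ltr01 (or_introl erefl)); congr Om.
  by rewrite !mulr0 addr0 subr0 divr1 mulr1 scaler0 addr0.
have upper k q v : m / 3 <= k -> k <= 3 * m -> `|q| = r -> v = 0 \/ v = (8^-1)%:C *: u ->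
   kobayashi_dist Om (P k) (P (k * (1 + q / 2) / (1 - q / 2)) + (2^-1)%:C *: v) <= L.
  move=> k1 k2 qr hv; have q1 : `|q| < 1 by rewrite qr.
  have FO z : cmod z < 1 -> Om (b + (k%:C * (1 + q%:C * z) / (1 - q%:C * z)) *: N + z *: v).
    by move=> z1; exact: disc.
  have h0 : (0 : R) < 2^-1 by rewrite invr_gt0.
  have h1 : (2^-1 : R) < 1 by rewrite invf_lt1// ltr1n.
  have h := kobayashi_dist_le_disk q1 FO h0 h1.
  have E0 : P k = b + (k%:C * (1 + q%:C * 0) / (1 - q%:C * 0)) *: N + 0 *: v.
    by rewrite /P !mulr0 addr0 subr0 divr1 mulr1 scale0r addr0.
  have E1 : (k * (1 + q / 2) / (1 - q / 2))%:C =
      k%:C * (1 + q%:C * (2^-1)%:C) / (1 - q%:C * (2^-1)%:C) :> R[i].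
    by rewrite -!rcM -rc1 -rcD -rcB -rcV -!rcM.
  by rewrite E0 /P E1; exact: h.
pose x := P (m * x1); pose y := P (m / x1); pose m1 := P m; pose m2 := m1 + (16^-1)%:C *: u.
have kx : m / 3 <= m * x1 /\ m * x1 <= 3 * m by split; nra.
have ky : m / 3 <= m / x1 /\ m / x1 <= 3 * m.
  rewrite ler_pM2l// -[3 * m]mulrC ler_pM2l//; split.
    by rewrite lef_pV2 ?posrE//; lra.
  by rewrite -[leRHS]invrK lef_pV2 ?posrE ?invr_gt0.
have Ox : Om x by apply: OP; case: kx.
have Oy : Om y by apply: OP; case: ky.
have Om1 : Om m1 by apply: OP; lra.
have rn : `|r| = r by rewrite ger0_norm//; lra.
have rn' : `|- r| = r by rewrite normrN.
have u2 : m2 = m1 + (2^-1)%:C *: ((8^-1)%:C *: u).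
  by rewrite scalerA -rcM /m2; congr (_ + _%:C *: _); field.
have xm : P (m * x1 * (1 + r / 2) / (1 - r / 2)) = m1.
  by rewrite /m1; congr P; rewrite /x1; field; rewrite !gt_eqF//; lra.
have ym : P (m / x1 * (1 + - r / 2) / (1 - - r / 2)) = m1.
  by rewrite /m1; congr P; rewrite /x1; field; rewrite !gt_eqF//; lra.
have Om2 : Om m2.
  have := @disc (m * x1) r ((8^-1)%:C *: u) (2^-1)%:C kx.1 kx.2 rn.
  rewrite cmod_real ger0_norm ?invr_ge0// invf_lt1// ltr1n => /(_ isT (or_intror erefl)).
  rewrite -rc1 -!rcM -rcD -rcB -rcV -!rcM u2 -xm; congr Om.
have lower : 2 * Lr <= kobayashi_dist Om x y.
  apply: le_trans (kobayashi_dist_ge cdOm Ox Oy (ball_tangent cdOm nb N0 hN)).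
  have P_ k : complex.Re (cdot (P k - b) (conjv N)) = k * enorm N ^+ 2.
    by rewrite /P addrC addKr Re_cdot_conjv iprZl ipr_enorm.
  have E2 : 0 < enorm N ^+ 2 by rewrite exprn_gt0.
  have Ex : complex.Re (cdot (x - b) (conjv N)) = m * x1 * enorm N ^+ 2 by exact: P_.
  have Ey : complex.Re (cdot (y - b) (conjv N)) = m / x1 * enorm N ^+ 2 by exact: P_.
  by rewrite -lnx1; exact: (ln_dist_ge m0 E2 x10 Ex Ey).
(* Otherwise b + N + 4 t u would be in Om, and so would b + N + u, on the segment from b + N to
   it. *)
have far : ~ closure Om (m1 + 4%:C *: u).
  move=> ce.
  have hb w : enorm w < enorm N / 2 -> Om (b + (3 / 2)%:C *: N + w).
    move=> wN; have -> : b + (3 / 2)%:C *: N + w = b + N + ((2^-1)%:C *: N + w).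
      by apply/rowP => j; rewrite !mxE; field.
    apply: hN; apply: le_lt_trans (enormD _ _) _.
    by rewrite enormZ cmod_real ger0_norm ?invr_ge0//; lra.
  have := closure_convexE cOm ce (divr_gt0 En (ltr0Sn _ 1)) hb (t := t); rewrite t0 thi => /(_ isT).
  have -> : (1 - t)%:C *: (b + (3 / 2)%:C *: N) + t%:C *: (m1 + 4%:C *: u) =
      b + N + (4 * t)%:C *: u.
    rewrite /m1 /P; have -> : m = 3 / 2 - 2^-1 / t by rewrite /t invfM mulrA !invrK mulVf ?mul1r ?opprB 1?addrC ?subrK ?gt_eqF.
    by apply/rowP => j; rewrite !mxE; field; rewrite (inj_eq (@complexI R)) gt_eqF.
  move=> Oq; have O1 : Om (b + N) by rewrite -[b + N]addr0; apply: hN; rewrite enorm0.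
  apply: nu; have := convexE cOm O1 Oq t4; congr Om.
  by apply/rowP => j; rewrite !mxE; field; rewrite (inj_eq (@complexI R)) gt_eqF.
have [v hv] := separation cOm neOm far.
have c0le : c0 <= kobayashi_dist Om m1 m2.
  apply: le_trans (kobayashi_dist_ge cdOm Om1 Om2 hv).
  set a := complex.Re (cdot u v).
  have E1 : complex.Re (cdot (m1 - (m1 + 4%:C *: u)) v) = 4 * - a.
    by rewrite opprD addrA subrr add0r cdotN cdotZ /a; case: (cdot u v) => p q /=; ring.
  have E2 : complex.Re (cdot (m2 - (m1 + 4%:C *: u)) v) = 63 / 16 * - a.
    have -> : m2 - (m1 + 4%:C *: u) = (- (63 / 16))%:C *: u.
      by apply/rowP => j; rewrite !mxE; field.
    by rewrite cdotZ /a; case: (cdot u v) => p q /=; ring.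
  have a0 : 0 < - a by have := hv _ Om1; rewrite E1 pmulr_rgt0.
  rewrite E1 E2; exact: ln_dist_64_63.
have dist0 k q : m / 3 <= k -> k <= 3 * m -> `|q| = r ->
    P (k * (1 + q / 2) / (1 - q / 2)) = m1 ->
    kobayashi_dist Om (P k) m1 <= L /\ kobayashi_dist Om (P k) m2 <= L.
  move=> k1 k2 qr E; split.
    have := upper k q 0 k1 k2 qr (or_introl erefl); rewrite E.
    suff -> : m1 + (2^-1)%:C *: 0 = m1 by move=> H; exact: H.
    exact: (etrans (f_equal (+%R m1) (scaler0 _ _)) (addr0 m1)).
  by have := upper k q _ k1 k2 qr (or_intror erefl); rewrite E -u2.
have [xm1 xm2] := dist0 _ _ kx.1 kx.2 rn xm.
have [ym1 ym2] := dist0 _ _ ky.1 ky.2 rn' ym.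
have := CAT0_approximate_midpoints cat0 Ox Oy Om1 Om2 Lr0 lower xm1 ym1 xm2 ym2.
by move=> /(le_trans c0le); exact: (artanh_sqrt_gap s0 sL Lr0 LrL gap).
Qed.

End Flatness.

Lemma CAT0_not_flat (R : realType) : exists2 e : R, 0 < e < 1 &
  forall (d : nat) (Om : set (Cvec R d)) b N u,
  convex_domain Om -> CAT0 Om (kobayashi_dist Om) -> ~ Om b -> N != 0 ->
  (forall w, enorm w < enorm N -> Om (b + N + w)) -> ~ Om (b + N + u) ->
  ~ (forall om, cmod om < 4^-1 -> Om (b + e%:C *: N + om *: u)).
Proof.
pose L : R := (ln (1 + 2^-1) - ln (1 - 2^-1)) / 2.
pose c0 : R := ln (64 / 63) / 2.
have c00 : 0 < c0 := half_ln_64_63_gt0 R.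
have L0 : 0 < L by apply: divr_gt0 => //; rewrite subr_gt0 ltr_ln ?posrE; lra.
have L96 : 0 < 96 * L by rewrite pmulr_lgt0// ltr0n.
pose s := Num.min 12^-1 (c0 ^+ 2 / (96 * L)).
have s0 : 0 < s by rewrite lt_min invr_gt0 ltr0n divr_gt0 ?exprn_gt0.
have s1 : s <= 12^-1 by rewrite ge_min lexx.
have s2 : 96 * L * s <= c0 ^+ 2.
  have : s <= c0 ^+ 2 / (96 * L) by rewrite ge_min lexx orbT.
  by rewrite ler_pdivlMr// mulrC.
exists (s ^+ 6); first by rewrite exprn_gt0//= exprn_ilt1 ?ltW//; lra.
by move=> d Om b N u; exact: not_flat.
Qed.

(** * Distances to the boundary *)

Section BoundaryDistances.
Variable R : realType.
Variable d : nat.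
Variable Om : set (Cvec R d).
Hypothesis cdOm : convex_domain Om.
Hypothesis cpOm : C_proper Om.
Implicit Types (x y z w b c o p q u v N : Cvec R d).

Let oOm : open Om. Proof. by case: cdOm. Qed.
Let cOm : convex_set Om. Proof. by case: cdOm. Qed.

Lemma boundaryE x : boundary Om x <-> closure Om x /\ ~ Om x.
Proof. by rewrite /boundary (interior_id Om).1. Qed.

(** The parameter is the supremum of those at which the segment is still in Om. *)
Lemma boundary_crossing p q : Om p -> ~ Om q ->
  exists2 t : R, 0 <= t <= 1 & boundary Om (p + t%:C *: (q - p)).
Proof.
move=> Op nq; pose S := [set s : R | 0 <= s <= 1 /\ Om (p + s%:C *: (q - p))].
have S0 : S 0 by split; rewrite ?lexx ?ler01// scale0r addr0.
have hS : has_sup S by split; [exists 0|exists 1 => s [/andP[]]].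
have t0 : 0 <= sup S by exact: ub_le_sup hS.2 _ S0.
have t1 : sup S <= 1 by apply: ge_sup; [exists 0|move=> s [/andP[]]].
have K0 : 0 < enorm (q - p) + 1 by rewrite ltr_wpDl// enorm_ge0.
have dE s t : p + s%:C *: (q - p) - (p + t%:C *: (q - p)) = (s - t)%:C *: (q - p).
  by apply/rowP => j; rewrite !mxE; ring.
have near s t e : 0 < e -> `|s - t| < e / (enorm (q - p) + 1) ->
    enorm (p + s%:C *: (q - p) - (p + t%:C *: (q - p))) < e.
  move=> e0; rewrite ltr_pdivlMr// dE enormZ cmod_real; apply: le_lt_trans.
  by apply: ler_wpM2l => //; rewrite lerDl.
exists (sup S); first by rewrite t0.
apply/boundaryE; split.
  apply/closure_enormP => e e0.
  have [s Ss hs] := sup_adherent (divr_gt0 e0 K0) hS.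
  exists (p + s%:C *: (q - p)); first by case: Ss.
  apply: near => //; rewrite distrC ger0_norm; first lra.
  by rewrite subr_ge0; exact: ub_le_sup hS.2 _ Ss.
move=> Ot; have [e e0 he] := (open_enormP Om).1 oOm _ Ot.
have [E|ne] := eqVneq (sup S) 1.
  by apply: nq; move: Ot; rewrite E scale1r addrC subrK.
have lt1 : sup S < 1 by rewrite lt_neqAle ne.
have e1 : 0 < e / (enorm (q - p) + 1) by exact: divr_gt0.
pose s := Num.min 1 (sup S + e / (enorm (q - p) + 1) / 2).
have ss : sup S < s by rewrite lt_min lt1; lra.
have Ss : S s.
  split; first by rewrite (le_trans t0 (ltW ss)) ge_min lexx.
  apply: he; apply: near => //; rewrite gtr0_norm ?subr_gt0//.
  have : s <= sup S + e / (enorm (q - p) + 1) / 2 by rewrite ge_min lexx orbT.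
  lra.
by have := ub_le_sup hS.2 Ss; rewrite leNgt ss.
Qed.

(** With [bdist_dir_disc] and [bdist_dir_ge], this replaces the infimum over boundary points by
    discs: [bdist_dir] is the radius of the largest open disc about p in the slice. *)
Lemma bdist_dir_le p v zeta : Om p -> ~ Om (p + zeta *: v) -> bdist_dir Om p v <= cmod zeta * enorm v.
Proof.
move=> Op nz; have [t /andP[t0 t1]] := boundary_crossing Op nz.
rewrite [p + zeta *: v]addrC addrK scalerA => bt.
have h : bdist_dir Om p v <= enorm (p - (p + (t%:C * zeta) *: v)).
  apply: ge_inf; first by exists 0 => _ [y _ <-]; exact: enorm_ge0.
  by exists (p + (t%:C * zeta) *: v) => //; split => //; exists (t%:C * zeta).
apply: (le_trans h); rewrite enormB addrC addKr enormZ cmodM cmod_real ger0_norm//.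
by apply: ler_wpM2r; rewrite ?enorm_ge0// ler_piMl ?cmod_ge0.
Qed.

Lemma bdist_dir_disc p v zeta : Om p -> cmod zeta * enorm v < bdist_dir Om p v -> Om (p + zeta *: v).
Proof.
by move=> Op h; apply: contrapT => nz; have := bdist_dir_le Op nz; rewrite leNgt h.
Qed.

(** A slice without boundary points would be a complex line in Om; so the infimum is not the default
    value 0. *)
Let dir_ne p v : Om p -> v != 0 -> [set enorm (p - x) | x in
  boundary Om `&` [set p + zeta *: v | zeta in [set: R[i]]]] !=set0.
Proof.
move=> Op v0; apply: contrapT => E; apply: cpOm; exists p, v; split => // zeta.
apply: contrapT => nz; have [t _] := boundary_crossing Op nz.
rewrite [p + zeta *: v]addrC addrK scalerA => bt; apply: E.
exists (enorm (p - (p + (t%:C * zeta) *: v))), (p + (t%:C * zeta) *: v); last by [].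
by split; [|exists (t%:C * zeta)].
Qed.

Lemma bdist_dir_ge p v a : Om p -> v != 0 ->
  (forall zeta, cmod zeta * enorm v < a -> Om (p + zeta *: v)) -> a <= bdist_dir Om p v.
Proof.
move=> Op v0 h; apply: lb_le_inf; first exact: dir_ne.
move=> _ [y [/boundaryE[_ ny] [zeta _ yE]] <-]; rewrite leNgt; apply/negP => lt_a.
apply: ny; rewrite -yE; apply: h; move: lt_a.
by rewrite -yE enormB addrC addKr enormZ.
Qed.

Lemma bdist_dir_exit p v a : Om p -> v != 0 -> bdist_dir Om p v < a ->
  exists2 zeta, cmod zeta * enorm v < a & ~ Om (p + zeta *: v).
Proof.
move=> Op v0 lta; apply: contrapT => E.
suff : a <= bdist_dir Om p v by rewrite leNgt lta.
apply: bdist_dir_ge => // zeta za; apply: contrapT => nz; apply: E.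
by exists zeta.
Qed.

Lemma bdist_dir_gt0 p v : Om p -> v != 0 -> 0 < bdist_dir Om p v.
Proof.
move=> Op v0; have [e e0 he] := (open_enormP Om).1 oOm p Op.
apply: (lt_le_trans e0); apply: bdist_dir_ge => // zeta ze.
by apply: he; rewrite addrC addKr enormZ.
Qed.

(** A nearest point of the complement exists by compactness; it is a boundary point because the open
    ball up to it lies in Om. *)
Lemma bdist_nearest p q : Om p -> ~ Om q -> exists2 b, boundary Om b &
  bdist Om p = enorm (p - b) /\ forall w, enorm w < enorm (p - b) -> Om (p + w).
Proof.
move=> Op nq.
have cK : closed (~` Om) by exact: open_closedC.
have [b nb hb] := @nearest_point _ _ (~` Om) p cK (ex_intro _ q nq).
have ball w : enorm w < enorm (p - b) -> Om (p + w).
  move=> wb; apply: contrapT => nw; have := hb _ nw.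
  by rewrite opprD addrA subrr add0r enormN leNgt wb.
clear hb; have bb : boundary Om b.
  have [t /andP[t0 t1] /boundaryE[ct nt]] := boundary_crossing Op nb.
  apply/boundaryE; split; [|exact: nb].
  have [E|ne] := eqVneq t 1; first by move: ct; rewrite E scale1r addrC subrK.
  have lt1 : t < 1 by rewrite lt_neqAle ne.
  exfalso; apply: nt; apply: ball.
  rewrite enormZ cmod_real ger0_norm// [enorm (b - p)]enormB gtr_pMl//.
  rewrite lt_def enorm_ge0 andbT enorm_eq0; apply: contra_notN nb => /eqP E.
  by have <- : p = b by exact: subr0_eq.
exists b => //; split=> //; apply/eqP; rewrite eq_le; apply/andP; split.
  apply: ge_inf; first by exists 0 => _ [y _ <-]; exact: enorm_ge0.
  by exists b.
apply: lb_le_inf; first by exists (enorm (p - b)), b.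
move=> _ [y /boundaryE[_ ny] <-]; rewrite leNgt; apply/negP.
by rewrite [enorm (p - y)]enormB => /ball; rewrite addrC subrK.
Qed.

Lemma bdist_gt0 p q : Om p -> ~ Om q -> 0 < bdist Om p.
Proof.
move=> Op nq; have [b /boundaryE[_ nb] [-> _]] := bdist_nearest Op nq.
rewrite lt_def enorm_ge0 andbT enorm_eq0; apply: contra_notN nb => /eqP E.
by have <- : p = b by exact: subr0_eq.
Qed.

Lemma bdist_ball p q w : Om p -> ~ Om q -> enorm w < bdist Om p -> Om (p + w).
Proof. by move=> Op nq; have [b _ [-> h]] := bdist_nearest Op nq; exact: h. Qed.

Lemma bdist_le p q : Om p -> ~ Om q -> bdist Om p <= enorm (p - q).
Proof.
move=> Op nq; rewrite leNgt; apply/negP; rewrite enormB => /(bdist_ball Op nq).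
by rewrite addrC subrK.
Qed.

Lemma bdist_ge p q a : Om p -> ~ Om q -> (forall w, enorm w < a -> Om (p + w)) -> a <= bdist Om p.
Proof.
move=> Op nq h; have [b /boundaryE[_ nb] [-> _]] := bdist_nearest Op nq.
rewrite leNgt; apply/negP; rewrite enormB => /h; rewrite addrC subrK.
exact: nb.
Qed.

Lemma C_proper_exit p v : v != 0 -> exists q, ~ Om q.
Proof.
move=> v0; apply: contrapT => E; apply: cpOm; exists p, v; split => // zeta.
by apply: contrapT => nz; apply: E; exists (p + zeta *: v).
Qed.

End BoundaryDistances.

Section UniformBound.
Variable R : realType.
Variable d : nat.
Variable Om : set (Cvec R d).
Hypothesis cdOm : convex_domain Om.
Hypothesis cpOm : C_proper Om.
Implicit Types (x y z w b c o p q u v N : Cvec R d).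

Let oOm : open Om. Proof. by case: cdOm. Qed.
Let cOm : convex_set Om. Proof. by case: cdOm. Qed.

Lemma unit_sphere_compact : compact [set v : Cvec R d | enorm v = 1].
Proof.
apply: (@subclosed_compact _ _ _ _ (@coord_box_compact R d 1)).
  move=> v /closure_enormP cv; apply/eqP; rewrite eq_le; apply/andP; split.
    apply/ler_addgt0Pr => e /cv[y y1 ye].
    have := enormD (v - y) y; rewrite subrK y1 [enorm (v - y)]enormB; lra.
  apply/ler_addgt0Pr => e /cv[y y1 ye].
  have := enormD (y - v) v; rewrite subrK y1; lra.
move=> v v1 j; have vj : cmod (v ord0 j) <= 1 by rewrite -v1 coord_le_enorm.
by split; apply: le_trans vj; [exact: Re_le_cmod|exact: Im_le_cmod].
Qed.

(** If there were arbitrarily large discs about o, a cluster point of their unit directions would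
    give a complex line in the closure of Om; contracting it by half towards o gives a line in
    Om. *)
Lemma bdist_dir_bounded o : Om o ->
  exists B : R, forall v, v != 0 -> bdist_dir Om o v <= B.
Proof.
move=> Oo; apply: contrapT => E.
have ex (n : nat) : exists v, enorm v = 1 /\ forall zeta, cmod zeta < n%:R -> Om (o + zeta *: v).
  apply: contrapT => nE; apply: E; exists n%:R => v v0.
  rewrite leNgt; apply/negP => lt_n; apply: nE.
  have ev : 0 < enorm v by rewrite lt_def enorm_ge0 andbT enorm_eq0.
  exists ((enorm v)^-1%:C *: v); split.
    by rewrite enormZ cmod_real gtr0_norm ?invr_gt0// mulVf// gt_eqF.
  move=> zeta zn; rewrite scalerA; apply: (bdist_dir_disc cdOm Oo).
  by rewrite cmodM cmod_real gtr0_norm ?invr_gt0// divfK ?gt_eqF//; exact: lt_trans lt_n.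
have [v hv] := choice ex.
have Fv : (v @ \oo) [set v | enorm v = 1] by exists 0%N => // n _ /=; case: (hv n).
have [w [/= w1 cw]] := unit_sphere_compact _ Fv.
apply: cpOm; exists o, w; split.
  by rewrite -enorm_eq0 w1 oner_eq0.
move=> zeta.
have c2 : closure Om (o + (2 * zeta) *: w).
  apply/closure_enormP => e e0.
  have k0 : 0 < cmod (2 * zeta) + 1 by rewrite ltr_wpDl// cmod_ge0.
  pose n := (Num.truncn (cmod (2 * zeta))).+1.
  have zn : cmod (2 * zeta) < n%:R by exact: truncnS_gt.
  have FA : (v @ \oo) [set u | Om (o + (2 * zeta) *: u)].
    exists n => // k /= nk; have [_] := hv k; apply.
    by apply: lt_le_trans zn _; rewrite ler_nat.
  have [u [/= Ou uw]] := cw _ _ FA (nbhs_enorm_ball w (divr_gt0 e0 k0)).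
  exists (o + (2 * zeta) *: u) => //.
  rewrite opprD addrACA subrr add0r -scalerBr enormZ.
  move: uw; rewrite ltr_pdivlMr//; apply: le_lt_trans; rewrite mulrC.
  by apply: ler_wpM2l; [exact: enorm_ge0|rewrite lerDl].
have [e e0 he] := (open_enormP Om).1 oOm o Oo.
have hB w' : enorm w' < e -> Om (o + w') by move=> we; apply: he; rewrite addrC addKr.
have h01 : 0 < (2^-1 : R) < 1 by rewrite invr_gt0 ltr0n invf_lt1// ltr1n.
have := closure_convexE cOm c2 e0 hB h01; congr Om.
by apply/rowP => j; rewrite !mxE; field.
Qed.

(** o is a convex combination of z and of a point slightly beyond o, so a disc about z gives one
    about o, smaller by the fixed factor 1 + 2 rho / e. *)
Lemma bdist_dir_uniform o (rho : R) : Om o -> 0 < rho -> exists2 B : R, 0 < B &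
  forall z v, Om z -> enorm (z - o) <= rho -> v != 0 -> bdist_dir Om z v <= B.
Proof.
move=> Oo rho0; have [B hB] := bdist_dir_bounded Oo.
have [e e0 he] := (open_enormP Om).1 oOm o Oo.
have K0 : 0 < 1 + 2 * rho / e by rewrite ltr_wpDr ?divr_ge0 ?mulr_ge0 ?ltW.
have B0 : 0 < `|B| + 1 by rewrite ltr_wpDl.
exists ((`|B| + 1) * (1 + 2 * rho / e)); first exact: mulr_gt0.
move=> z v Oz zo v0; rewrite -ler_pdivrMr//.
apply: (@le_trans _ _ (bdist_dir Om o v)); last first.
  by rewrite (le_trans (hB v v0))// (le_trans (ler_norm B))// lerDl.
apply: (bdist_dir_ge cdOm cpOm Oo v0) => zeta hz.
pose t := rho / (rho + e / 2).
have t0 : 0 <= t <= 1.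
  rewrite /t divr_ge0 ?addr_ge0 ?divr_ge0 ?(ltW rho0) ?(ltW e0)//= ler_pdivrMr ?mul1r ?lerDl ?divr_ge0 ?(ltW e0)//.
  by rewrite addr_gt0 ?divr_gt0.
have re0 : e + 2 * rho != 0 by rewrite gt_eqF// addr_gt0// mulr_gt0.
have Oy : Om (o + (e / (2 * rho))%:C *: (o - z)).
  apply: he; rewrite addrC addKr enormZ cmod_real gtr0_norm ?divr_gt0 ?mulr_gt0// enormB.
  apply: (@le_lt_trans _ _ (e / (2 * rho) * rho)).
    by apply: ler_wpM2l => //; rewrite divr_ge0 ?mulr_ge0 ?(ltW rho0) ?(ltW e0).
  rewrite (_ : _ * _ = e / 2); first lra.
  by field; rewrite gt_eqF.
have Ozz : Om (z + ((1 + 2 * rho / e)%:C * zeta) *: v).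
  apply: (bdist_dir_disc cdOm Oz); rewrite cmodM cmod_real gtr0_norm// -mulrA mulrC.
  by rewrite -ltr_pdivlMr.
have := convexE cOm Ozz Oy t0; congr Om.
have re1 : rho%:C * 2 + e%:C != 0 :> R[i].
  have -> : rho%:C * 2 + e%:C = (e + 2 * rho)%:C :> R[i] by ring.
  by rewrite (inj_eq (@complexI R)).
rewrite /t; apply/rowP => j; rewrite !mxE; field.
by apply/and3P; split; [|exact: re1|]; rewrite (inj_eq (@complexI R)) gt_eqF.
Qed.

End UniformBound.

(** h, h4 and h1 are the boundary distances at the parameters s, 4 s and s (4 - 3 e / 4); the claim
    rests on (1 + e / 4) (1 - e) < 1 - 3 e / 16. *)
Lemma bdist_step_lt (R : realType) (e s h h4 h1 : R) : 0 < e -> 0 < s -> 0 < h ->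
  4 * h <= (1 + e / 4) * h4 -> h4 * (s * (4 - 3 * e / 4)) <= h1 * (4 * s) ->
  e < 1 -> 4 * (1 - e) * h < h1.
Proof.
move=> e0 s0 h0 hyp A e1.
have q : 0 < 1 + e / 4 by lra.
have p3 : 0 < 4 - 3 * e / 4 by lra.
have B : h4 * (4 - 3 * e / 4) <= h1 * 4.
  by rewrite -(ler_pM2r s0) -[_ * 4 * s]mulrA -[_ * _ * s]mulrA [_ * s]mulrC.
rewrite -(ltr_pM2l q).
have : (1 + e / 4) * (h4 * (4 - 3 * e / 4)) <= (1 + e / 4) * (h1 * 4) by rewrite ler_pM2l.
have : 4 * h * (4 - 3 * e / 4) <= (1 + e / 4) * h4 * (4 - 3 * e / 4) by rewrite ler_pM2r.
have : 0 < h * e by rewrite mulr_gt0.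
have : 0 < h * e * e by rewrite !mulr_gt0.
lra.
Qed.

Lemma four_thirds_lt (R : realType) (a g k : R) : a < 2 * g -> k <= 4^-1 * a -> 4 / 3 * k < 2 / 3 * g.
Proof. lra. Qed.

(** * One step along a radius towards a boundary point *)

Section Step.
Variable R : realType.
Variable d : nat.
Variable Om : set (Cvec R d).
Hypothesis cdOm : convex_domain Om.
Hypothesis cpOm : C_proper Om.
Implicit Types (y z w b p q u N : Cvec R d).

Let oOm : open Om. Proof. by case: cdOm. Qed.
Let cOm : convex_set Om. Proof. by case: cdOm. Qed.

Variables (x o : Cvec R d).
Hypothesis bx : boundary Om x.
Hypothesis Oo : Om o.

Let nx : ~ Om x. Proof. by case/(boundaryE cdOm): bx. Qed.

Let c (s : R) : Cvec R d := x + s%:C *: (o - x).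

Lemma radial_point_in s : 0 < s <= 1 -> Om (c s).
Proof.
move=> /andP[s0 s1]; have [->|ne] := eqVneq s 1; first by rewrite /c scale1r addrC subrK.
have [e e0 he] := (open_enormP Om).1 oOm o Oo.
have [cx _] := (boundaryE cdOm x).1 bx.
have hB w : enorm w < e -> Om (o + w) by move=> we; apply: he; rewrite addrC addKr.
have t01 : 0 < 1 - s < 1 by rewrite subr_gt0 lt_neqAle ne s1 gtrBl.
have := closure_convexE cOm cx e0 hB t01; congr Om.
by apply/rowP => j; rewrite /c !mxE; ring.
Qed.

(** The homothety of centre x and ratio s / s' carries a ball about c s' to one about c s: the ratio
    of the boundary distance to the parameter does not decrease towards x. *)
Lemma bdist_radial s s' : 0 < s -> s <= s' -> s' <= 1 ->
  bdist Om (c s') * s <= bdist Om (c s) * s'.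
Proof.
move=> s0 ss' s'1; have s'0 : 0 < s' by exact: lt_le_trans ss'.
have [->//|ne] := eqVneq s s'.
have lt_ss' : s < s' by rewrite lt_neqAle ne.
have Os : Om (c s) by apply: radial_point_in; rewrite s0 (le_trans ss').
have Os' : Om (c s') by apply: radial_point_in; rewrite s'0.
rewrite -ler_pdivrMr//; apply: (bdist_ge cdOm Os nx) => w hw.
have Oy : Om (c s' + (s' / s)%:C *: w).
  apply: (bdist_ball cdOm Os' nx).
  by rewrite enormZ cmod_real gtr0_norm ?divr_gt0// mulrC -ltr_pdivlMr ?divr_gt0// invf_div mulrA.
have [e e0 he] := (open_enormP Om).1 oOm _ Oy.
have [cx _] := (boundaryE cdOm x).1 bx.
have hB w' : enorm w' < e -> Om (c s' + (s' / s)%:C *: w + w').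
  by move=> we; apply: he; rewrite addrC addKr.
have t01 : 0 < 1 - s / s' < 1.
  by rewrite subr_gt0 ltr_pdivrMr// mul1r lt_ss' gtrBl divr_gt0.
have := closure_convexE cOm cx e0 hB t01; congr Om.
apply/rowP => j; rewrite /c !mxE; field.
by rewrite !(inj_eq (@complexI R)) !gt_eqF.
Qed.

(** Here the homothety has centre o: it contracts a disc about c s', the point nearer to x, by (1 -
    s) / (1 - s') to a disc about c s. *)
Lemma bdist_dir_radial v s s' : v != 0 -> 0 < s' -> s' <= s -> s < 1 ->
  (1 - s) * bdist_dir Om (c s') v <= (1 - s') * bdist_dir Om (c s) v.
Proof.
move=> v0 s'0 s's s1; have s0 : 0 < s by exact: lt_le_trans s's.
have s'1 : s' < 1 by exact: le_lt_trans s1.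
have p : 0 < 1 - s by rewrite subr_gt0.
have p' : 0 < 1 - s' by rewrite subr_gt0.
have Os : Om (c s) by apply: radial_point_in; rewrite s0 ltW.
have Os' : Om (c s') by apply: radial_point_in; rewrite s'0 ltW.
rewrite -ler_pdivrMl//; apply: (bdist_dir_ge cdOm cpOm Os v0) => zeta hz.
have Oy : Om (c s' + (((1 - s') / (1 - s))%:C * zeta) *: v).
  apply: (bdist_dir_disc cdOm Os').
  rewrite cmodM cmod_real gtr0_norm ?divr_gt0// -mulrA.
  by rewrite mulrAC ltr_pdivrMr// [X in _ < X]mulrC -ltr_pdivlMl.
have t01 : 0 <= 1 - (1 - s) / (1 - s') <= 1.
  rewrite subr_ge0 ler_pdivrMr// mul1r lerD2l lerN2 s's gerBl divr_ge0// ltW//.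
have := convexE cOm Oy Oo t01; congr Om.
apply/rowP => j; rewrite /c !mxE; field.
by rewrite -!rc1 -!rcB !(inj_eq (@complexI R)) !gt_eqF.
Qed.

Variable e : R.
Hypothesis e01 : 0 < e < 1.
Hypothesis not_flat : forall b N u, ~ Om b -> N != 0 ->
  (forall w, enorm w < enorm N -> Om (b + N + w)) -> ~ Om (b + N + u) ->
  ~ (forall om, cmod om < 4^-1 -> Om (b + e%:C *: N + om *: u)).

(* The point b + e (c s - b) of the non-flatness lemma is a convex combination
   of c (e s / 4) and of a point near c (4 s - 3 e s / 4). *)
Lemma bdist_dir_decrease v s : v != 0 -> 0 < s -> 4 * s <= 1 ->
  4 * bdist Om (c s) <= (1 + e / 4) * bdist Om (c (4 * s)) ->
  bdist_dir Om (c (e / 4 * s)) v < 2 / 3 * bdist_dir Om (c s) v.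
Proof.
move=> v0 s0 s4; have [e0 e1] := andP e01.
have s1_ : s <= 1 by lra.
have e4 : 0 < e / 4 * s by rewrite mulr_gt0 ?divr_gt0.
have e4' : e / 4 * s <= 1 by apply: le_trans s4; rewrite ler_pM2r//; lra.
have p3 : 0 < 4 - 3 * e / 4 by lra.
have q : 0 < 1 + e / 4 by lra.
pose s1 := s * (4 - 3 * e / 4).
have s10 : 0 < s1 by rewrite mulr_gt0.
have s14 : s1 <= 4 * s by rewrite [4 * s]mulrC ler_pM2l//; lra.
have s11 : s1 <= 1 by exact: le_trans s4.
have Os : Om (c s) by apply: radial_point_in; rewrite s0.
have Ob : Om (c (e / 4 * s)) by apply: radial_point_in; rewrite e4.
move=> hyp; rewrite ltNge; apply/negP => ge_g.
have Os1 : Om (c s1) by apply: radial_point_in; rewrite s10.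
have h0 : 0 < bdist Om (c s) by exact: bdist_gt0 nx.
have hs1 : 4 * (1 - e) * bdist Om (c s) < bdist Om (c s1).
  exact: (bdist_step_lt e0 s0 h0 hyp (bdist_radial s10 s14 s4) e1).
have [b /(boundaryE cdOm)[_ nb] [hb ball]] := bdist_nearest cdOm Os nx.
have g0 := bdist_dir_gt0 cdOm cpOm Os v0.
have lt2 : bdist_dir Om (c s) v < 2 * bdist_dir Om (c s) v by rewrite ltr_pMl// ltr1n.
(* An exit point at less than twice the slice radius is enough: 4 / 3 * 1 / 4 * 2 is the factor 2 /
   3. *)
have [zeta hz nz] := bdist_dir_exit cdOm cpOm Os v0 lt2.
have bN : b + (c s - b) = c s by rewrite addrC subrK.
apply: (@not_flat b (c s - b) (zeta *: v) nb).
- by rewrite -enorm_eq0 -hb (gt_eqF h0).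
- by move=> w hw; rewrite bN; exact: ball.
- by rewrite bN; exact: nz.
move=> om hom.
have O1 : Om (c (e / 4 * s) + ((4 / 3)%:C * (om * zeta)) *: v).
  apply: (bdist_dir_disc cdOm Ob); apply: lt_le_trans ge_g.
  have h43 : (0 : R) < 4 / 3 by rewrite divr_gt0.
  have hk : cmod om * (cmod zeta * enorm v) <= 4^-1 * (cmod zeta * enorm v).
    by apply: ler_wpM2r (ltW hom); rewrite mulr_ge0 ?cmod_ge0 ?enorm_ge0.
  rewrite !cmodM cmod_real (gtr0_norm h43).
  have -> : 4 / 3 * (cmod om * cmod zeta) * enorm v = 4 / 3 * (cmod om * (cmod zeta * enorm v)).
    by rewrite !mulrA.
  exact: (four_thirds_lt hz hk).
have O2 : Om (c s1 + (- (4 * (1 - e)))%:C *: (c s - b)).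
  apply: (bdist_ball cdOm Os1 nx); apply: le_lt_trans hs1.
  rewrite enormZ -hb cmod_real normrN (ger0_norm (_ : 0 <= 4 * (1 - e))); first exact: lexx.
  by apply: mulr_ge0 => //; rewrite subr_ge0 ltW.
(* The radial parameters add up: 3 / 4 * (e / 4 * s) + 1 / 4 * s (4 - 3 e / 4) = s, and a quarter of
   the displacement is - (1 - e) (c s - b). *)
have := convexE cOm O1 O2 (t := 4^-1); rewrite invr_ge0 ler0n invf_le1// ler1n => /(_ isT).
congr Om.
by apply/rowP => j; rewrite /c /s1 !mxE; field.
Qed.

End Step.

(** * Geometric decay of the slices and local convexity *)

Section GeometricDecay.
Variable R : realType.

Lemma expr_unbounded (a y : R) : 0 < a -> exists n, y <= (1 + a) ^+ n.
Proof.
move=> a0; exists (Num.truncn (`|y| / a)).+1; set n := _.+1.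
have B k : 1 + k%:R * a <= (1 + a) ^+ k.
  elim: k => [|k IH]; first by rewrite mul0r addr0 expr0.
  rewrite exprS; apply: (@le_trans _ _ ((1 + a) * (1 + k%:R * a))).
    have : 0 <= k%:R * a * a by rewrite !mulr_ge0// ltW.
    rewrite -natr1; lra.
  by rewrite ler_pM2l// addr_gt0.
apply: le_trans (B n); apply: le_trans (ler_norm y) _.
have : `|y| / a < n%:R by exact: truncnS_gt.
rewrite ltr_pdivrMr//; lra.
Qed.

(* In either case the potential G k / Q k.-1 ^+ A drops by the factor 2/3; Q is
   monotone and bounded in the application. *)
Lemma decay_dichotomy (Q G : nat -> R) (q : R) (A : nat) :
  (forall k, 0 < Q k) -> (forall k, Q k <= Q k.+1) ->
  (forall k, 0 <= G k) -> (forall k, G k.+1 <= G k) -> 0 < q -> 3 / 2 <= q ^+ A ->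
  (forall k, Q k.+1 <= q * Q k -> G k.+1 <= 2 / 3 * G k) ->
  forall k, G k * Q 0%N ^+ A <= G 0%N * (2 / 3) ^+ k * Q k ^+ A.
Proof.
move=> Q0 Qnd G0 Gni q0 qA step; elim=> [|k IH]; first by rewrite expr0 mulr1.
have QA : 0 < Q 0%N ^+ A by rewrite exprn_gt0.
have W : 0 <= G 0%N * (2 / 3) ^+ k by rewrite mulr_ge0// exprn_ge0// divr_ge0.
have Qk : Q k ^+ A <= Q k.+1 ^+ A by rewrite lerXn2r ?nnegrE// ltW.
have -> : G 0%N * (2 / 3) ^+ k.+1 * Q k.+1 ^+ A = 2 / 3 * (G 0%N * (2 / 3) ^+ k * Q k.+1 ^+ A).
  by rewrite exprS; ring.
have [/step h|h] := leP (Q k.+1) (q * Q k).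
  apply: (@le_trans _ _ (2 / 3 * (G k * Q 0%N ^+ A))); first by rewrite mulrA ler_pM2r.
  by rewrite ler_pM2l ?divr_gt0//; apply: le_trans IH _; rewrite ler_wpM2l.
apply: (@le_trans _ _ (G k * Q 0%N ^+ A)); first by rewrite ler_pM2r.
apply: le_trans IH _; rewrite [X in _ <= X]mulrCA ler_wpM2l//.
have qQ : q ^+ A * Q k ^+ A <= Q k.+1 ^+ A.
  by rewrite -exprMn lerXn2r ?nnegrE ?ltW// mulr_gt0.
have QkA : 0 < Q k ^+ A by rewrite exprn_gt0.
have : 3 / 2 * Q k ^+ A <= q ^+ A * Q k ^+ A by rewrite ler_pM2r.
by move=> /le_trans/(_ qQ); lra.
Qed.

Lemma ler_div_cross (a b x y : R) : 0 < x -> 0 < y -> y * a <= x * b -> a / x <= b / y.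
Proof. by move=> x0 y0 h; rewrite ler_pdivrMr// mulrAC ler_pdivlMr// mulrC [X in _ <= X]mulrC. Qed.

Lemma ler_div_crossr (a b x y : R) : 0 < x -> 0 < y -> a * y <= b * x -> a / x <= b / y.
Proof. by move=> x0 y0 h; rewrite ler_pdivrMr// mulrAC ler_pdivlMr. Qed.

Lemma mulr_divr_le (a g x y : R) : 0 <= a -> 0 <= g -> 0 < x -> x <= y -> a * g <= a * (g / x) * y.
Proof.
move=> a0 g0 x0 xy; rewrite -mulrA; apply: ler_wpM2l => //.
by rewrite mulrAC ler_pdivlMr// ler_wpM2l.
Qed.

Lemma powR_root (x : R) (m : nat) : 0 <= x -> (0 < m)%N -> (x ^+ m) `^ (m%:R^-1) = x.
Proof.
move=> x0 m0; rewrite -powR_mulrn// -powRrM divff ?powRr1//.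
by rewrite pnatr_eq0 -lt0n.
Qed.

(** k is determined by be^(k+2) < s <= be^(k+1). Then (2 / 3)^(k+2) <= s^(1/m), and 9 / 4 pays for
    the two extra factors. *)
Lemma root_scale (be s : R) (m : nat) : 0 < be -> be < 1 -> (0 < m)%N -> (2 / 3) ^+ m <= be ->
  0 < s -> s <= be -> exists k, s <= be ^+ k.+1 /\ (2 / 3) ^+ k <= 9 / 4 * s `^ (m%:R^-1).
Proof.
move=> b0 b1 m0 mb s0 sb.
have [n0 hn0] : exists n, be ^+ n < s.
  have bi : 0 < be^-1 - 1 by rewrite subr_gt0 invf_gt1.
  have [n hn] := expr_unbounded (2 / s) bi.
  exists n; move: hn; rewrite addrC subrK exprVn => hn.
  have bn : 0 < be ^+ n by rewrite exprn_gt0.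
  have : s^-1 < (be ^+ n)^-1 by apply: lt_le_trans hn; rewrite ltr_pMl ?invr_gt0// ltr1n.
  by rewrite ltf_pV2 ?posrE.
have ex : exists n, be ^+ n < s by exists n0.
case: (ex_minnP ex) => -[|[|k]] hk hmin.
- by move: hk; rewrite expr0 => h; have := lt_trans h (le_lt_trans sb b1); rewrite ltxx.
- by move: hk; rewrite expr1 ltNge sb.
exists k; split.
  by rewrite leNgt; apply/negP => /hmin; rewrite ltnn.
have r0 : (0 : R) <= 2 / 3 by rewrite divr_ge0.
have : ((2 / 3) ^+ k.+2) <= s `^ (m%:R^-1).
  rewrite -[X in X <= _](@powR_root _ m) ?exprn_ge0//.
  apply: ge0_ler_powR; rewrite ?nnegrE ?invr_ge0 ?exprn_ge0 ?(ltW s0)//.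
  apply: ltW; apply: le_lt_trans hk; rewrite -exprM mulnC exprM.
  by rewrite lerXn2r ?nnegrE ?exprn_ge0// ltW.
rewrite !exprS; lra.
Qed.

End GeometricDecay.

Section RadialDecay.
Variable R : realType.
Variable d : nat.
Variable Om : set (Cvec R d).
Hypothesis cdOm : convex_domain Om.
Hypothesis cpOm : C_proper Om.
Variables (x o : Cvec R d).
Hypothesis bx : boundary Om x.
Hypothesis Oo : Om o.
Let nx : ~ Om x. Proof. by case/(boundaryE cdOm): bx. Qed.
Variable e : R.
Hypothesis e01 : 0 < e < 1.
Hypothesis not_flat : forall b N u, ~ Om b -> N != 0 ->
  (forall w, enorm w < enorm N -> Om (b + N + w)) -> ~ Om (b + N + u) ->
  ~ (forall om, cmod om < 4^-1 -> Om (b + e%:C *: N + om *: u)).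
Variables (A m : nat).
Hypothesis hA : 3 / 2 <= (1 + e / 4) ^+ A.
Hypothesis m0 : (0 < m)%N.
Hypothesis hm : (2 / 3) ^+ m <= e / 4.

Lemma radial_decay v s : v != 0 -> 0 < s -> s <= e / 4 ->
  bdist_dir Om (x + s%:C *: (o - x)) v <=
  3 * bdist_dir Om (x + (e / 4)%:C *: (o - x)) v * (enorm (o - x) / bdist Om o) ^+ A * s `^ (m%:R^-1).
Proof.
move=> v0 s0 sb; pose c (s : R) := x + s%:C *: (o - x).
have [e0 e1] := andP e01.
pose be := e / 4; have b0 : 0 < be by rewrite divr_gt0.
have b14 : 4 * be <= 1 by rewrite /be; lra.
have b1 : be < 1 by rewrite /be; lra.
have q0 : 0 < 1 + e / 4 by rewrite addr_gt0// divr_gt0.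
have bk k : 0 < be ^+ k by rewrite exprn_gt0.
have bk1 k : be ^+ k.+1 < 1 by rewrite exprn_ilt1// ltW.
have bk1' k : 0 < 1 - be ^+ k.+1 by rewrite subr_gt0.
have bkle k : be ^+ k <= 1 by rewrite exprn_ile1 ?ltW.
have bkk k : be ^+ k.+1 <= be ^+ k by rewrite exprS ler_piMl// ltW.
have b4k k : 4 * be ^+ k.+1 <= be ^+ k by rewrite exprS mulrA ler_piMl// ltW.
have Oc s' : 0 < s' <= 1 -> Om (c s') by exact: radial_point_in.
have Ock k : Om (c (be ^+ k)) by apply: Oc; rewrite bk bkle.
(* Q is monotone by the homotheties of centre x and G by those of centre o, which accounts for the
   denominator of G; since it would vanish at the parameter 1, G is indexed from be^1. *)
pose Q k := bdist Om (c (be ^+ k)) / be ^+ k.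
pose G k := bdist_dir Om (c (be ^+ k.+1)) v / (1 - be ^+ k.+1).
have hQ0 k : 0 < Q k by apply: divr_gt0 (bk k); exact: (bdist_gt0 cdOm (Ock k) nx).
have rad := @bdist_radial _ _ _ cdOm x o bx Oo.
have hQ k : Q k <= Q k.+1.
  exact: (ler_div_crossr (bk k) (bk k.+1) (rad _ _ (bk k.+1) (bkk k) (bkle k))).
have drad := @bdist_dir_radial _ _ _ cdOm cpOm x o bx Oo v _ _ v0.
have hG k : G k.+1 <= G k.
  exact: (ler_div_cross (bk1' _) (bk1' _) (drad _ _ (bk _) (bkk _) (bk1 _))).
have hG0 k : 0 <= G k.
  by rewrite divr_ge0 ?(ltW (bk1' k)) ?(ltW (bdist_dir_gt0 cdOm cpOm (Ock _) v0)).
have step k : Q k.+1 <= (1 + e / 4) * Q k -> G k.+1 <= 2 / 3 * G k.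
  move=> hk.
  have s4 : 4 * be ^+ k.+1 <= 1 by apply: le_trans (bkle k).
  have dec := @bdist_dir_decrease _ _ _ cdOm cpOm x o bx Oo e e01 not_flat v _ v0 (bk k.+1) s4.
  (* As 4 be <= 1, the parameter 4 be^(k+1) is at most be^k, and monotonicity of the ratio transfers
     the hypothesis to it. *)
  have h4 : 4 * bdist Om (c (be ^+ k.+1)) <= (1 + e / 4) * bdist Om (c (4 * be ^+ k.+1)).
    have p4 : 0 < 4 * be ^+ k.+1 by rewrite mulr_gt0.
    have hh : bdist Om (c (be ^+ k.+1)) <= (1 + e / 4) * Q k * be ^+ k.+1 by rewrite -ler_pdivrMr.
    have HH : Q k * (4 * be ^+ k.+1) <= bdist Om (c (4 * be ^+ k.+1)).
      by rewrite /Q mulrAC ler_pdivrMr//; exact: rad p4 (b4k k) (bkle k).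
    apply: (@le_trans _ _ (4 * ((1 + e / 4) * Q k * be ^+ k.+1))); first by rewrite ler_pM2l.
    have -> : 4 * ((1 + e / 4) * Q k * be ^+ k.+1) = (1 + e / 4) * (Q k * (4 * be ^+ k.+1)) by ring.
    by rewrite ler_pM2l.
  have := dec h4; rewrite -/be -exprS => /ltW h.
  rewrite /G ler_pdivrMr//; apply: (le_trans h).
  apply: mulr_divr_le => //; first by rewrite ltW// (bdist_dir_gt0 cdOm cpOm (Ock _) v0).
  by rewrite lerD2l lerN2.
have [k [sk rk]] := root_scale b0 b1 m0 hm s0 sb.
have s1 : s < 1 by apply: le_lt_trans sb b1.
have gs : bdist_dir Om (c s) v <= G k.
  rewrite /G ler_pdivlMr// mulrC; apply: le_trans (drad _ _ s0 sk (bk1 k)) _.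
  by rewrite ler_piMl ?gerBl ?(ltW s0)// (ltW (bdist_dir_gt0 cdOm cpOm (Ock _) v0)).
have dk := decay_dichotomy hQ0 hQ hG0 hG q0 hA step k.
have QD : Q k <= enorm (o - x).
  rewrite /Q ler_pdivrMr//; apply: le_trans (bdist_le cdOm (Ock k) nx) _.
  by rewrite /c addrC addKr enormZ cmod_real gtr0_norm// mulrC.
have Q00 : Q 0%N = bdist Om o.
  by rewrite /Q expr0 divr1 /c scale1r addrC subrK.
have h1 : 0 < bdist Om o by rewrite -Q00.
have G00 : G 0%N <= 4 / 3 * bdist_dir Om (c be) v.
  rewrite /G expr1 mulrC; apply: ler_wpM2r.
    by rewrite ltW// -(expr1 be) (bdist_dir_gt0 cdOm cpOm (Ock _) v0).
  rewrite -[_^-1]mul1r ler_pdivrMr ?subr_gt0//; lra.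
apply: (le_trans gs); rewrite -/c -/be.
(* 3 = 4 / 3 * 9 / 4, from the denominator of G 0 and from the choice of k. *)
have -> : 3 * bdist_dir Om (c be) v * (enorm (o - x) / bdist Om o) ^+ A * s `^ (m%:R^-1) =
   4 / 3 * bdist_dir Om (c be) v * (9 / 4 * s `^ (m%:R^-1)) * enorm (o - x) ^+ A / bdist Om o ^+ A.
  by rewrite expr_div_n; field; rewrite expf_neq0 ?gt_eqF.
rewrite ler_pdivlMr ?exprn_gt0// -Q00; apply: (le_trans dk).
apply: ler_pM.
- by apply: mulr_ge0 (hG0 _) _; rewrite exprn_ge0// divr_ge0.
- by rewrite exprn_ge0 ?(ltW (hQ0 k)).
- by apply: ler_pM (hG0 _) _ G00 rk; rewrite exprn_ge0// divr_ge0.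
- by rewrite lerXn2r ?nnegrE ?enorm_ge0 ?(ltW (hQ0 k)).
Qed.

End RadialDecay.

Section NearBoundary.
Variable R : realType.
Variable d : nat.
Variable Om : set (Cvec R d).
Hypothesis cdOm : convex_domain Om.
Hypothesis cpOm : C_proper Om.

Let oOm : open Om. Proof. by case: cdOm. Qed.
Let cOm : convex_set Om. Proof. by case: cdOm. Qed.

(** x + s (o - x) is the midpoint of z and of 2 s y + (1 - 2 s) x, where y = o - (z - x) / (2 s) is
    still in Om; so a disc about z gives one of half its radius. *)
Lemma bdist_dir_le_radial (x o z v : Cvec R d) (s : R) : boundary Om x -> Om o -> Om z -> v != 0 ->
  0 < s -> 2 * s < 1 -> enorm (z - x) < 2 * s * bdist Om o ->
  bdist_dir Om z v <= 2 * bdist_dir Om (x + s%:C *: (o - x)) v.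
Proof.
move=> bx Oo Oz v0 s0 s1 zx; have [cx nx] := (boundaryE cdOm x).1 bx.
have s20 : 0 < 2 * s by rewrite mulr_gt0.
have Os : Om (x + s%:C *: (o - x)) by apply: (radial_point_in cdOm bx Oo); rewrite s0; lra.
have Oy : Om (o + (- (2 * s)^-1)%:C *: (z - x)).
  apply: (bdist_ball cdOm Oo nx).
  by rewrite enormZ cmod_real normrN gtr0_norm ?invr_gt0// mulrC ltr_pdivrMr// mulrC.
have [e e0 he] := (open_enormP Om).1 oOm _ Oy.
have hB w' : enorm w' < e -> Om (o + (- (2 * s)^-1)%:C *: (z - x) + w').
  by move=> we; apply: he; rewrite addrC addKr.
have t01 : 0 < 1 - 2 * s < 1 by rewrite subr_gt0 s1 gtrBl.
have O2 := closure_convexE cOm cx e0 hB t01.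
rewrite -ler_pdivrMl//; apply: (bdist_dir_ge cdOm cpOm Os v0) => zeta; rewrite ltr_pdivlMl// => hz.
have O1 : Om (z + (2%:C * zeta) *: v).
  by apply: (bdist_dir_disc cdOm Oz); rewrite cmodM cmod_real gtr0_norm// -mulrA.
have := convexE cOm O1 O2 (t := 2^-1); rewrite invr_ge0 ler0n invf_le1// ler1n => /(_ isT).
congr Om; apply/rowP => j; rewrite !mxE; field.
by rewrite (inj_eq (@complexI R)) gt_eqF.
Qed.

End NearBoundary.

Lemma CAT0_locally_convex (R : realType) : exists m : nat, (0 < m)%N /\
  forall (d : nat) (Om : set (Cvec R d)), convex_domain Om -> C_proper Om ->
  CAT0 Om (kobayashi_dist Om) -> locally_convex_order m Om.
Proof.
have [e e01 flat] := CAT0_not_flat R; have [e0 e1] := andP e01.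
have be0 : 0 < e / 4 by rewrite divr_gt0.
have be1 : e / 4 <= 1 by lra.
have [A hA] := expr_unbounded (3 / 2) be0.
(* A factor 2 / 3 for each change of scale by e / 4 amounts to a power 1 / m. *)
have [m [m0 hm]] : exists m, (0 < m)%N /\ (2 / 3) ^+ m <= e / 4.
  have h2 : (0 : R) < 2^-1 by rewrite invr_gt0.
  have [n hn] := expr_unbounded (4 / e) h2; exists n.+1; split => //.
  have E : (2 / 3 : R) ^+ n = ((1 + 2^-1) ^+ n)^-1.
    by rewrite -exprVn; congr (_ ^+ _); field.
  apply: (@le_trans _ _ ((2 / 3) ^+ n)).
    by rewrite exprS ler_piMl ?exprn_ge0 ?divr_ge0//; lra.
  rewrite E -[e / 4]invrK lef_pV2 ?posrE ?invr_gt0 ?exprn_gt0 ?invf_div//; lra.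
exists m; split => // d Om cdOm cpOm cat0 rho rho0.
(* In dimension 0 there is no direction to test. *)
have [[v1 hv1]|nv] := pselect (exists v : Cvec R d, v != 0); last first.
  by exists 1 => // z v _ _ v0; case: nv; exists v.
have [[ o Oo] _ _] := cdOm.
have [q nq] := C_proper_exit cpOm o hv1.
have h1 := bdist_gt0 cdOm Oo nq.
(* Bounds the distance from o to z and, for z close to the boundary, to its nearest boundary point
   and to the starting point of the radial decay. *)
pose rho1 := rho + enorm o + bdist Om o.
have rho10 : 0 < rho1 by apply: ltr_wpDl h1; apply: addr_ge0 (enorm_ge0 _); exact: ltW.
have [B B0 hB] := bdist_dir_uniform cdOm cpOm Oo rho10.
pose mu : R := m%:R^-1.
have mu0 : 0 <= mu by rewrite invr_ge0.
pose C1 := 6 * B * (rho1 / bdist Om o) ^+ A * (bdist Om o)^-1 `^ mu.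
pose C2 := B * (e / 4 * bdist Om o)^-1 `^ mu.
have C10 : 0 <= C1.
  apply: mulr_ge0 (powR_ge0 _ _); apply: mulr_ge0; first by rewrite mulr_ge0// ltW.
  by apply: exprn_ge0; rewrite divr_ge0// ltW.
have bh0 : 0 < e / 4 * bdist Om o by exact: mulr_gt0.
have C20 : 0 < C2 by apply: mulr_gt0 => //; rewrite powR_gt0// invr_gt0.
exists (C1 + C2); first by rewrite ltr_wpDl.
move=> z v Oz zr v0; have dz := bdist_gt0 cdOm Oz nq.
have dz_ge0 := powR_ge0 (bdist Om z) mu.
have zo : enorm (z - o) <= rho1.
  apply: le_trans (enormD _ _) _; rewrite enormN /rho1 -addrA; apply: lerD; first exact: ltW.
  by rewrite lerDl ltW.
(* Away from the boundary the uniform bound suffices. Close to it, z is compared with the point of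
   parameter s = bdist z / bdist o on the radius from its nearest boundary point. *)
rewrite mulrDl; have [small|big] := leP (bdist Om z) (e / 4 * bdist Om o); last first.
  apply: (@le_trans _ _ (C2 * bdist Om z `^ mu)); last by rewrite lerDr mulr_ge0.
  apply: (le_trans (hB _ _ Oz zo v0)); rewrite /C2 -mulrA -powRM ?invr_ge0 ?(ltW bh0) ?(ltW dz)//.
  have E1 : 1 `^ mu = 1 :> R by rewrite powR1.
  rewrite ler_pMr// -[X in X <= _]E1; apply: ge0_ler_powR => //; rewrite ?nnegrE//.
    by rewrite mulr_ge0 ?invr_ge0 ?(ltW bh0) ?(ltW dz).
  by rewrite mulrC ler_pdivlMr// mul1r ltW.
apply: (@le_trans _ _ (C1 * bdist Om z `^ mu)); last by rewrite lerDl mulr_ge0// ltW.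
have [x bx [dzx ball]] := bdist_nearest cdOm Oz nq.
pose s := bdist Om z / bdist Om o.
have s0 : 0 < s by exact: divr_gt0.
have sb : s <= e / 4 by rewrite ler_pdivrMr.
have s21 : 2 * s < 1 by lra.
have xo : enorm (o - x) <= rho1.
  have -> : o - x = (o - z) + (z - x) by rewrite addrA subrK.
  apply: le_trans (enormD _ _) _; rewrite /rho1; apply: lerD; last first.
    by rewrite -dzx; apply: (le_trans small); exact: (ler_piMl (ltW h1) be1).
  apply: le_trans (enormD _ _) _; rewrite enormN addrC; apply: lerD (lexx _).
  exact: ltW.
have near : enorm (z - x) < 2 * s * bdist Om o.
  by rewrite -dzx -mulrA divfK ?gt_eqF// ltr_pMl// ltr1n.
have nf b N u : ~ Om b -> N != 0 -> (forall w, enorm w < enorm N -> Om (b + N + w)) ->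
   ~ Om (b + N + u) -> ~ (forall om, cmod om < 4^-1 -> Om (b + e%:C *: N + om *: u)).
  by move=> *; exact: flat.
have dec := radial_decay cdOm cpOm bx Oo e01 nf hA m0 hm v0 s0 sb.
apply: (le_trans (bdist_dir_le_radial cdOm cpOm bx Oo Oz v0 s0 s21 near)).
have Ob : Om (x + (e / 4)%:C *: (o - x)).
  by apply: (radial_point_in cdOm bx Oo); rewrite be0.
have bo : enorm (x + (e / 4)%:C *: (o - x) - o) <= rho1.
  have -> : x + (e / 4)%:C *: (o - x) - o = (- (1 - e / 4))%:C *: (o - x).
    by apply/rowP => j; rewrite !mxE; ring.
  apply: (le_trans _ xo); rewrite enormZ cmod_real normrN ger0_norm; last by rewrite subr_ge0.
  by apply: ler_piMl; rewrite ?enorm_ge0// gerBl ltW.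
have gb := hB _ _ Ob bo v0.
have gb0 := bdist_dir_gt0 cdOm cpOm Ob v0.
have -> : C1 * bdist Om z `^ mu = 2 * (3 * B * (rho1 / bdist Om o) ^+ A * s `^ mu).
  by rewrite /C1 /s powRM ?(ltW dz) ?invr_ge0 ?(ltW h1)//; ring.
rewrite ler_pM2l//; apply: (le_trans dec); apply: ler_wpM2r; first exact: powR_ge0.
apply: ler_pM.
- by rewrite mulr_ge0// ltW.
- by rewrite exprn_ge0// divr_ge0 ?enorm_ge0// ltW.
- by rewrite ler_pM2l.
have hx : 0 <= enorm (o - x) / bdist Om o by rewrite divr_ge0 ?enorm_ge0// ltW.
have hr : 0 <= rho1 / bdist Om o by rewrite divr_ge0// ltW.
by apply: lerXn2r; rewrite ?nnegrE// ler_pM2r// invr_gt0.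
Qed.

(** * Finite line type *)

Section DirectionalDerivatives.
Variable R : realType.

Lemma is_derive_line (V : normedModType R[i]) (g : V -> R) (z w : V) (t : R) :
  (forall y, rderivable g w y) ->
  is_derive t (1 : R) (fun s => g (z + s%:C *: w)) (rderive g w (z + t%:C *: w)).
Proof.
move=> dg; pose H (s : R) := g (z + t%:C *: w + s%:C *: w).
have dH : is_derive (0 : R) (1 : R) H (derive1 H 0).
  by apply: DeriveDef; [exact: dg|rewrite derive1E].
have dl : is_derive t (1 : R) (fun s : R => s - t) 1.
  by apply: is_derive_eq; rewrite subr0.
have -> : (fun s => g (z + s%:C *: w)) = H \o (fun s : R => s - t).
  apply/funext => s /=; rewrite /H -addrA -scalerDl -rcD.
  by rewrite [t + _]addrC subrK.
have dH' : is_derive (t - t) (1 : R) H (derive1 H 0) by rewrite subrr.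
by have := @is_derive1_comp R H (fun s => s - t) t _ _ dH' dl; rewrite mulr1.
Qed.

Lemma rderive_MVT (V : normedModType R[i]) (g : V -> R) (z w : V) (a : R) :
  (forall y, rderivable g w y) ->
  exists2 t : R, `|t| <= `|a| & g (z + a%:C *: w) - g z = a * rderive g w (z + t%:C *: w).
Proof.
move=> dg; pose F (s : R) := g (z + s%:C *: w).
have E0 : g z = F 0 by rewrite /F scale0r addr0.
have dF s : is_derive s (1 : R) F (rderive g w (z + s%:C *: w)) by exact: is_derive_line.
have cF p q : {within `[p, q], continuous F}.
  by apply: derivable_within_continuous => s _; apply: ex_derive.
have [a0|a0] := leP 0 a.
  have [c] := MVT_segment a0 (fun s _ => dF s) (cF _ _).
  rewrite in_itv/= => /andP[c0 ca]; rewrite subr0 => E; exists c; first by rewrite !ger0_norm.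
  by rewrite E0 -/(F a) E mulrC.
have [c] := MVT_segment (ltW a0) (fun s _ => dF s) (cF _ _).
rewrite in_itv/= => /andP[ca c0]; rewrite sub0r => E; exists c.
  by rewrite (ler0_norm c0) (ler0_norm (ltW a0)) lerN2.
by rewrite E0 -/(F a) -opprB E mulrN opprK mulrC.
Qed.

Lemma rderive_increment (V : normedModType R[i]) (g : V -> R) (z w : V) (a K : R) :
  (forall y, rderivable g w y) ->
  (forall t : R, `|t| <= `|a| -> `|rderive g w (z + t%:C *: w)| <= K) ->
  `|g (z + a%:C *: w) - g z| <= K * `|a|.
Proof.
move=> dg hK; have [t ta ->] := rderive_MVT z a dg.
by rewrite normrM mulrC ler_wpM2r// hK.
Qed.

Lemma continuous_box_bounded (g : Cplane R -> R) : continuous g ->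
  exists2 C : R, 0 <= C & forall z, `|complex.Re z| <= 1 -> `|complex.Im z| <= 1 -> `|g z| <= C.
Proof.
move=> cg; have cB := @ReIm_box_compact R 1.
have cn : continuous (fun z => `|g z|).
  by move=> z; apply: (@continuous_comp _ _ _ g (fun t : R => `|t|)); [exact: cg|exact: norm_continuous].
have ne : [set z : Cplane R | `|complex.Re z| <= 1 /\ `|complex.Im z| <= 1] !=set0.
  by exists 0; rewrite /= normr0.
have [c _ hc] := compact_EVT_max ne cB (continuous_subspaceT cn).
by exists `|g c| => // z z1 z2; apply: hc; rewrite inE.
Qed.

(** Downward induction on the number of derivatives: those of order N are bounded on the square, and
    lower ones are recovered from their zero at the origin by mean values along the real axis, then
    parallel to the imaginary one. *)
Lemma taylor_bound (f : Cplane R -> R) (N : nat) : smooth f ->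
  (forall vs : seq (Cplane R), (size vs < N)%N -> iter_rderive vs f 0 = 0) ->
  exists2 C : R, 0 <= C & forall z, `|complex.Re z| <= 1 -> `|complex.Im z| <= 1 ->
    `|f z| <= C * (`|complex.Re z| + `|complex.Im z|) ^+ N.
Proof.
move=> sf vf.
suff main k (vs : seq (Cplane R)) : (size vs + k)%N = N ->
   exists2 C : R, 0 <= C & forall z, `|complex.Re z| <= 1 -> `|complex.Im z| <= 1 ->
    `|iter_rderive vs f z| <= C * (`|complex.Re z| + `|complex.Im z|) ^+ k.
  exact: (main N [::]).
elim: k vs => [|k IH] vs sz.
  have [C C0 hC] := continuous_box_bounded (sf vs).1.
  by exists C => // z z1 z2; rewrite expr0 mulr1; exact: hC.
have [|C1 C10 h1] := IH ((1 : Cplane R) :: vs); first by rewrite /= addSnnS.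
have [|C2 C20 h2] := IH (('i : Cplane R) :: vs); first by rewrite /= addSnnS.
exists (C1 + C2); first exact: addr_ge0.
move=> [a b] /= a1 b1; set M := `|a| + `|b|.
have M0 : 0 <= M by rewrite addr_ge0.
pose g := iter_rderive vs f.
have g0 : g 0 = 0 by apply: vf; rewrite -sz addnS ltnS leq_addr.
have ea (t : R) : (0 : Cplane R) + t%:C *: (1 : Cplane R) = t +i* 0.
  by apply/eqP; rewrite eq_complex/= !(mul0r, mulr0, mulr1, subr0, addr0, add0r) !eqxx.
have eb (t : R) : (a +i* 0 : Cplane R) + t%:C *: ('i : Cplane R) = a +i* t.
  by apply/eqP; rewrite eq_complex/= !(mul0r, mulr0, mulr1, subr0, addr0, add0r) !eqxx.
have A := @rderive_increment _ g 0 1 a (C1 * M ^+ k) ((sf vs).2 _) _.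
have B := @rderive_increment _ g (a +i* 0) 'i b (C2 * M ^+ k) ((sf vs).2 _) _.
have {A} A : `|g (a +i* 0) - g 0| <= C1 * M ^+ k * `|a|.
  rewrite -ea; apply: A => t ta; rewrite ea.
  apply: (le_trans (h1 (t +i* 0) (le_trans ta a1) _)); first by rewrite /= normr0.
  apply: ler_wpM2l => //; rewrite lerXn2r ?nnegrE ?addr_ge0//=.
  by rewrite normr0 addr0 (le_trans ta)// lerDl.
have {B} B : `|g (a +i* b) - g (a +i* 0)| <= C2 * M ^+ k * `|b|.
  rewrite -(eb b); apply: B => t tb; rewrite eb.
  apply: (le_trans (h2 (a +i* t) a1 (le_trans tb b1))).
  by apply: ler_wpM2l => //; rewrite lerXn2r ?nnegrE ?addr_ge0//= lerD2l.
have : `|g (a +i* b)| <= C2 * M ^+ k * `|b| + C1 * M ^+ k * `|a|.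
  have -> : g (a +i* b) = (g (a +i* b) - g (a +i* 0)) + (g (a +i* 0) - g 0).
    by rewrite g0 subr0 subrK.
  by apply: le_trans (ler_normD _ _) _; exact: lerD.
move=> /le_trans; apply; rewrite mulrDl addrC exprSr.
have Mk : 0 <= M ^+ k by rewrite exprn_ge0.
rewrite !mulrA; apply: lerD; apply: ler_wpM2l; rewrite ?mulr_ge0// /M ?lerDl ?lerDr//.
Qed.

(** Directions w in the parameter plane become directions w v in C^d, so the restriction of r to a
    complex line inherits its derivatives without a chain rule. *)
Lemma iter_rderive_line d (r : Cvec R d -> R) (x v : Cvec R d) (vs : seq (Cplane R)) :
  iter_rderive vs (fun zeta : Cplane R => r (x + zeta *: v)) =
  (fun zeta => iter_rderive [seq w *: v | w <- vs] r (x + zeta *: v)).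
Proof.
elim: vs => [//|w vs IH]; apply/funext => zeta; rewrite /= IH /rderive.
congr (derive1 _ 0); apply/funext => t.
by rewrite scalerDl -addrA scalerA.
Qed.

Lemma smooth_line d (r : Cvec R d -> R) (x v : Cvec R d) : smooth r ->
  smooth (fun zeta : Cplane R => r (x + zeta *: v)).
Proof.
move=> sr vs; rewrite iter_rderive_line; have [cr dr] := sr [seq w *: v | w <- vs]; split.
  move=> zeta; apply: (@continuous_comp _ _ _ (fun zeta : Cplane R => x + zeta *: v)); last exact: cr.
  have c1 : {for zeta, continuous (fun _ : Cplane R => x)} by exact: cst_continuous.
  have c2 : {for zeta, continuous (fun z : Cplane R => z *: v)} by exact: scalel_continuous.
  exact: (continuousD c1 c2).
move=> w zeta; pose g := iter_rderive [seq w *: v | w <- vs] r.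
have E : (fun t : R => g (x + zeta *: v + t%:C *: (w *: v))) =
    (fun t : R => g (x + (zeta + t%:C *: w) *: v)).
  by apply/funext => t; rewrite [in RHS]scalerDl -addrA scalerA.
have h : derivable (fun t : R => g (x + zeta *: v + t%:C *: (w *: v))) 0 1 by exact: dr.
by move: h; rewrite E.
Qed.

End DirectionalDerivatives.

Section FiniteLineType.
Variable R : realType.
Variable d : nat.
Implicit Types (Om : set (Cvec R d)) (r : Cvec R d -> R) (x v w : Cvec R d).

Lemma bounded_C_proper Om : bounded_domain Om -> C_proper Om.
Proof.
move=> [M hM] [p [v [v0 hv]]].
have ev : 0 < enorm v by rewrite lt_def enorm_ge0 andbT enorm_eq0.
pose t := (`|M| + enorm p + 1) / enorm v.
have Mp : 0 < `|M| + enorm p + 1 by rewrite ltr_wpDl// addr_ge0// enorm_ge0.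
have h := hM _ (hv t%:C).
have h2 := enormD (p + t%:C *: v) (- p); move: h2.
rewrite addrAC subrr add0r enormN enormZ cmod_real gtr0_norm ?divr_gt0// divfK ?gt_eqF// => h2.
have := ler_norm M; lra.
Qed.

Lemma nbhs_enormP x (A : set (Cvec R d)) : nbhs x A ->
  exists2 e : R, 0 < e & forall y, enorm (y - x) < e -> A y.
Proof.
rewrite nbhsE => -[U [oU Ux] UA]; have [e e0 he] := (open_enormP U).1 oU x Ux.
by exists e => // y /he/UA.
Qed.

Lemma gradient_neq0_direction r x : gradient r x != 0 -> exists w, rderive r w x != 0.
Proof.
move=> g0; apply: contrapT => E; move: g0; apply/negP/negPn/eqP/rowP => j.
have D w : rderive r w x = 0.
  by apply/eqP; apply: contra_notT E => h; exists w.
by rewrite !mxE !D.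
Qed.

(** w is a direction of nonzero derivative D at x, reversed if D > 0 so that r decreases along it;
    by continuity at least half of |D| survives near x. *)
Lemma transversal_direction Om r x : smooth_defining_function Om r -> boundary Om x ->
  exists w, exists2 kap : R, 0 < kap & exists2 rho : R, 0 < rho &
  forall y s, 0 <= s -> enorm (y - x) + s * enorm w < rho -> r (y + s%:C *: w) <= r y - kap * s.
Proof.
move=> [sr _ gr] bx.
have [w D0] := gradient_neq0_direction (nbhs_singleton (gr x bx)).
set D := rderive r w x in D0.
have nD : 0 < `|D| / 2 by rewrite divr_gt0// normr_gt0.
have [rho rho0 hrho] : exists2 e : R, 0 < e &
    forall y, enorm (y - x) < e -> `|D - rderive r w y| < `|D| / 2.
  apply: nbhs_enormP.
  have cr : {for x, continuous (rderive r w)} by exact: ((sr [:: w]).1 x).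
  exact: ((@cvgrPdist_lt _ _ _ (nbhs x) (nbhs_filter x) _ _).1 cr _ nD).
exists ((- Num.sg D)%:C *: w), (`|D| / 2) => //; exists rho => // y s s0.
have sg1 : `|Num.sg D| = 1 by rewrite normr_sg D0.
rewrite enormZ cmod_real normrN sg1 mul1r => hy.
rewrite scalerA -rcM.
have [t ta E] := @rderive_MVT R _ r y w (s * - Num.sg D) ((sr [::]).2 w).
have ta' : `|t| <= s by move: ta; rewrite normrM normrN sg1 mulr1 ger0_norm.
have near : `|D - rderive r w (y + t%:C *: w)| < `|D| / 2.
  apply: hrho; rewrite addrAC; apply: le_lt_trans hy.
  apply: le_trans (enormD _ _) _; rewrite lerD2l enormZ cmod_real.
  by apply: ler_wpM2r => //; exact: enorm_ge0.
rewrite -[r (_ + _)](subrK (r y)) E addrC lerD2l.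
move: near; set D' := rderive r w (_ + _) => near.
have DE : Num.sg D * D = `|D| by rewrite normrEsg.
have : - Num.sg D * D' <= - (`|D| / 2).
  have -> : - Num.sg D * D' = Num.sg D * (D - D') - Num.sg D * D by ring.
  rewrite DE; have : Num.sg D * (D - D') <= `|D - D'|.
    by apply: le_trans (ler_norm _) _; rewrite normrM sg1 mul1r.
  lra.
move=> /(ler_wpM2l s0); rewrite mulrA mulrN; lra.
Qed.

Lemma small_parameter (P1 P2 P3 q1 q2 q3 : R) : 0 <= P1 -> 0 <= P2 -> 0 <= P3 ->
  0 < q1 -> 0 < q2 -> 0 < q3 ->
  exists a, [/\ 0 < a, a <= 1, a * P1 < q1, a * P2 < q2 & a * P3 < q3].
Proof.
move=> h1 h2 h3 p1 p2 p3.
have aux (P q a : R) : 0 <= P -> 0 < q -> 0 < a -> a <= q / (P + 1) -> a * P < q.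
  move=> P0 q0 a0; rewrite ler_pdivlMr ?ltr_wpDl// mulrDr mulr1; lra.
pose a := Num.min 1 (Num.min (q1 / (P1 + 1)) (Num.min (q2 / (P2 + 1)) (q3 / (P3 + 1)))).
have a0 : 0 < a by rewrite !lt_min ltr01 !divr_gt0// ltr_wpDl.
exists a; split => //.
- by rewrite ge_min lexx.
- by apply: aux => //; rewrite !ge_min lexx ?orbT.
- by apply: aux => //; rewrite !ge_min lexx ?orbT.
- by apply: aux => //; rewrite !ge_min lexx ?orbT.
Qed.

Lemma locally_convex_vanishing_order Om r x v m n : convex_domain Om -> C_proper Om ->
  smooth_defining_function Om r -> (0 < m)%N -> locally_convex_order m Om -> boundary Om x ->
  v != 0 -> (forall vs : seq (Cplane R), (size vs < n)%N ->
    iter_rderive vs (fun zeta : Cplane R => r (x + zeta *: v)) 0 = 0) -> (n <= m)%N.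
Proof.
move=> cdOm cpOm sdf m0 lc bx v0 hn; rewrite leqNgt; apply/negP => mn.
have [sr OmE _] := sdf.
have [w [kap kap0 [rho rho0 hw]]] := transversal_direction sdf bx.
have [cx nx] := (boundaryE cdOm x).1 bx.
have [|C C0 hC] := taylor_bound (N := m.+1) (smooth_line x v sr).
  by move=> vs hvs; apply: hn; exact: leq_trans hvs _.
have x1 : 0 < enorm x + 1 by rewrite ltr_wpDl// enorm_ge0.
have [C' C'0 hC'] := lc _ x1.
have ev : 0 < enorm v by rewrite lt_def enorm_ge0 andbT enorm_eq0.
(* K makes kap s equal to (C 2^(m+1) + 1) a^(m+1), which exceeds the Taylor bound C (2 a)^(m+1) for
   r on the disc |zeta| < a. *)
pose K := (C * 2 ^+ m.+1 + 1) / kap.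
have K0 : 0 < K by rewrite divr_gt0// ltr_wpDl// mulr_ge0// exprn_ge0.
have W0 := enorm_ge0 w.
have KW0 : 0 <= K * enorm w by rewrite mulr_ge0// ltW.
(* The three conditions keep the disc in the range of the transversal direction, keep its centre
   within |x| + 1, and contradict the final estimate. *)
have [a [a0 a1 r1 r2 r3]] := @small_parameter (enorm v + K * enorm w) (K * enorm w)
  (C' ^+ m * (K * enorm w)) rho 1 (enorm v ^+ m) (addr_ge0 (ltW ev) KW0) KW0
  (mulr_ge0 (exprn_ge0 _ (ltW C'0)) KW0) rho0 ltr01 (exprn_gt0 _ ev).
pose s := K * a ^+ m.+1.
have s0 : 0 < s by rewrite mulr_gt0// exprn_gt0.
have sa : s * enorm w <= a * (K * enorm w).
  have : a ^+ m.+1 <= a by rewrite exprS ler_piMr ?(ltW a0)// exprn_ile1 ?(ltW a0).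
  by move=> h; rewrite /s mulrAC mulrC ler_wpM2r.
have disc zeta : cmod zeta < a -> Om (x + s%:C *: w + zeta *: v).
  move=> za; rewrite OmE /= addrAC.
  have near : enorm (x + zeta *: v - x) + s * enorm w < rho.
    rewrite addrAC subrr add0r enormZ; apply: le_lt_trans r1; rewrite mulrDr.
    by apply: lerD sa; apply: ler_wpM2r (ltW za); exact: ltW.
  apply: le_lt_trans (hw _ _ (ltW s0) near) _.
  have Rz : `|complex.Re zeta| <= a by apply: (le_trans (Re_le_cmod zeta)); exact: ltW.
  have Iz : `|complex.Im zeta| <= a by apply: (le_trans (Im_le_cmod zeta)); exact: ltW.
  have := hC zeta (le_trans Rz a1) (le_trans Iz a1).
  move=> /(le_trans (ler_norm _)) h.
  have h2 : C * (`|complex.Re zeta| + `|complex.Im zeta|) ^+ m.+1 <= C * (2 * a) ^+ m.+1.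
    apply: ler_wpM2l => //; apply: lerXn2r; rewrite ?nnegrE ?addr_ge0// ?mulr_ge0 ?(ltW a0)//.
    lra.
  have E : kap * s = (C * 2 ^+ m.+1 + 1) * a ^+ m.+1.
    by rewrite /s /K; field; rewrite gt_eqF.
  rewrite subr_lt0; apply: le_lt_trans (le_trans h h2) _.
  by rewrite E exprMn mulrA [(_ + 1) * _]mulrDl mul1r ltrDl exprn_gt0.
have Oc : Om (x + s%:C *: w).
  by have := disc 0; rewrite cmod0 scale0r addr0; apply.
have lo : a * enorm v <= bdist_dir Om (x + s%:C *: w) v.
  by apply: (bdist_dir_ge cdOm cpOm Oc v0) => zeta; rewrite ltr_pM2r//; exact: disc.
have hi : bdist Om (x + s%:C *: w) <= s * enorm w.
  apply: le_trans (bdist_le cdOm Oc nx) _.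
  by rewrite addrC addKr enormZ cmod_real gtr0_norm.
have bd0 := ltW (bdist_gt0 cdOm Oc nx).
have zn : enorm (x + s%:C *: w) < enorm x + 1.
  apply: le_lt_trans (enormD _ _) _; rewrite ltrD2l enormZ cmod_real gtr0_norm//.
  exact: le_lt_trans r2.
have := le_trans lo (hC' _ _ Oc zn v0) => est.
have est2 : (a * enorm v) ^+ m <= C' ^+ m * bdist Om (x + s%:C *: w).
  have E : (bdist Om (x + s%:C *: w) `^ m%:R^-1) ^+ m = bdist Om (x + s%:C *: w).
    rewrite -powR_mulrn ?powR_ge0// -powRrM mulVf ?powRr1//.
    by rewrite pnatr_eq0 -lt0n.
  rewrite -[X in _ <= _ * X]E -exprMn; apply: lerXn2r; rewrite ?nnegrE//.
    by rewrite mulr_ge0// ltW.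
  by rewrite mulr_ge0 ?powR_ge0// ltW.
(* The slice contributes order a^m and the boundary distance order a^(m+1); small a separates
   them. *)
have : a ^+ m * enorm v ^+ m <= a ^+ m * (a * (C' ^+ m * (K * enorm w))).
  rewrite -exprMn; apply: (le_trans est2).
  apply: (@le_trans _ _ (C' ^+ m * (s * enorm w))).
    by apply: ler_wpM2l hi; rewrite exprn_ge0// ltW.
  by rewrite le_eqVlt; apply/orP; left; rewrite /s exprS; apply/eqP; ring.
by rewrite ler_pM2l ?exprn_gt0// leNgt r3.
Qed.

Lemma locally_convex_finite_line_type Om r m : convex_domain Om -> C_proper Om ->
  smooth_defining_function Om r -> (0 < m)%N -> locally_convex_order m Om -> finite_line_type Om r.
Proof.
move=> cdOm cpOm sdf m0 lc x bx.
apply: (@le_lt_trans _ _ m%:R%:E); last exact: ltry.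
apply: ge_ereal_sup => _ [ell [[p [v hE]] nc e0] <-].
apply: ge_ereal_sup => _ [n hn <-]; rewrite lee_fin ler_nat.
have px : p = x by rewrite -e0 hE scale0r addr0.
have v0 : v != 0.
  by apply: contra_notN nc => /eqP v0; exists p => zeta; rewrite hE v0 scaler0 addr0.
apply: (locally_convex_vanishing_order cdOm cpOm sdf m0 lc bx v0) => vs /hn.
suff -> : r \o ell = (fun zeta : Cplane R => r (x + zeta *: v)) by [].
by apply/funext => zeta; rewrite /= hE px.
Qed.

End FiniteLineType.

Theorem theorem1p1 (R : realType) :
  (forall Om : set (Cvec R 2),
     convex_domain Om -> C_proper Om ->
     CAT0 Om (kobayashi_dist Om) ->
     exists m : nat, (0 < m)%N /\ locally_convex_order m Om)
  /\
  (forall (d : nat) (Om : set (Cvec R d)) (r : Cvec R d -> R),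
     (2 <= d)%N ->
     convex_domain Om -> bounded_domain Om ->
     smooth_defining_function Om r ->
     CAT0 Om (kobayashi_dist Om) ->
     finite_line_type Om r).
Proof.
have [m [m0 lc]] := CAT0_locally_convex R.
split=> [Om cdOm cpOm cat0|d Om r _ cdOm bOm sdf cat0].
  by exists m; split => //; exact: lc.
have cpOm := bounded_C_proper bOm.
exact: (locally_convex_finite_line_type cdOm cpOm sdf m0 (lc _ _ cdOm cpOm cat0)).
Qed.
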